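(* Let $(X_t)_{t\in\mathbb{Z}_+}$ be a stationary Markov process with invariant measure $\Pi$ and transition kernels $(\mathcal{P}_t)_{t\in\mathbb{Z}_+}$. Assume there are a function $M:\mathbf{X}\to[1,\infty)$ and a function $R:[0,\infty)\to(0,1]$ strictly monotonically decreasing to $0$ such that $\|\mathcal{P}_t(x,\cdot)-\Pi\|_{BL(d)}\le M(x)R(t)$ for every $x\in\mathbf{X}$ and $t\in\mathbb{Z}_+$. Assume $\int_{\mathbf{X}}M\,d\Pi<\infty$ and that for some $p>1$ $$\int_0^\infty R(u)^{\frac12(1-1/p)}\,du<\infty .$$ Then for every Lipschitz function $f:\mathbf{X}\to\mathbb{R}$ such that $\|f\|_{L_{2p}(\Pi)}<\infty$, the limit $$\sigma^2(f)=\lim_{n\to\infty}\mathrm{Var}\left(\frac{1}{\sqrt n}\sum_{s=0}^{n-1}f(X_s)\right)$$ is bounded above (i.e. exists and is finite), and for every $z\in\mathbb{R}$, $$\lim_{n\to\infty}\mathbb{P}\left(\frac{1}{\sqrt n}\sum_{s=0}^{n-1}\Big(f(X_s)-\int_{\mathbf{X}}f\,d\Pi\Big)\le z\right)=\Phi(z),$$ where $\Phi$ is the Gaussian distribution function with mean $0$ and variance $\sigma^2(f)$.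
   Context: $\mathbf{X}$ is a nonempty metric space with metric $d$; all sets, functions and measures are Borel. $\mathbb{Z}_+=\{0,1,2,\dots\}$. $\mathcal{P}_t(x,\cdot)=\mathbb{P}(X_t\in\cdot\mid X_0=x)$ are the transition kernels of the (time-homogeneous) Markov process, forming a Markov semigroup on $L_2(\Pi)$; $\Pi$ is the unique invariant probability measure, and stationary means $X_0\sim\Pi$. Write $\mathcal{P}_tf(x)=\int f(y)\,\mathcal{P}_t(x,dy)$. $\|f\|_\infty=\sup_x|f(x)|$, $\|f\|_{\mathrm{Lip}(d)}=\sup_{x\ne y}|f(y)-f(x)|/d(x,y)$, and $$\|\mathcal{P}_t(x,\cdot)-\Pi\|_{BL(d)}=\sup\Big\{\Big|\mathcal{P}_tf(x)-\int f\,d\Pi\Big|:\|f\|_{\mathrm{Lip}(d)}+\|f\|_\infty\le1\Big\}.$$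
   Formalization: When σ²(f)=0 the limit law is read as the unit mass at 0 and convergence is claimed only for z≠0; at z=0 the claim can fail (X_s=(Y_{s-1},Y_s), Y_s i.i.d. fair signs, f(a,b)=b−a: the probability is 3/4, not 1). *)

(* Defs.v *)
From HB Require Import structures.
From mathcomp Require Import all_boot all_order all_algebra.
From mathcomp Require Import all_classical all_reals all_analysis.

Set Implicit Arguments.
Unset Strict Implicit.
Unset Printing Implicit Defensive.
Import Order.TTheory GRing.Theory Num.Theory.
Import numFieldNormedType.Exports.

Local Open Scope classical_set_scope.
Local Open Scope ring_scope.

(* Measurable types carry a distinguished point, so
   a nonempty metric space is a metric space with a point. *)
#[short(type="pointedMetricType")]
HB.structure Definition PointedMetric (K : numDomainType) :=
  { M of Metric K M & Pointed M }.

Notation borel X := (g_sigma_algebraType (@open X)).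

Section BoundedLipschitz.
Context {R : realType} {X : pointedMetricType R}.
Local Open Scope ereal_scope.

(* The maximum with 0 only matters when X is a single point, where the set of
   difference quotients is empty and its supremum in \bar R would be -oo. *)
Definition lip_norm (f : X -> R) : \bar R :=
  maxe 0 (ereal_sup [set r | exists x y : X,
    x <> y /\ r = (`|f y - f x| / mdist x y)%:E]).

Definition sup_norm (f : X -> R) : \bar R :=
  ereal_sup [set `|f x|%:E | x in [set: X]].

Definition BL_dist (mu nu : {measure set (borel X) -> \bar R}) : \bar R :=
  ereal_sup [set `| \int[mu]_x (f x)%:E - \int[nu]_x (f x)%:E |
            | f in [set f : X -> R | lip_norm f + sup_norm f <= 1]].

End BoundedLipschitz.

Section StationaryMarkov.
Context d (Omega : measurableType d) dX (X : measurableType dX) (R : realType).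
Variables (P : probability Omega R) (Pi : probability X R).
Variables (Pt : nat -> R.-pker X ~> X) (X_ : nat -> {RV P >-> X}).

Definition kernel_op (t : nat) (f : X -> R) (x : X) : R := \int[Pt t x]_y f y.

Definition invariant (nu : probability X R) : Prop :=
  forall (t : nat) (A : set X), measurable A ->
    (\int[nu]_x Pt t x A)%E = nu A.

(* The sigma-algebra generated by X_0, ..., X_s. *)
Definition past (s : nat) : set (set Omega) :=
  <<s \bigcup_(i in [set i | (i <= s)%N])
        preimage_set_system setT (X_ i) measurable >>.

(* [markov_property] says that Pt t (X_s) B is a version of the conditional
   probability of {X_(s+t) \in B} given X_0, ..., X_s; for s = 0 it also gives
   Pt t x B = P(X_t \in B | X_0 = x).
   In [semigroup0] and [semigroupD] the identities hold in L_2(Pi), i.e.,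
   Pi-almost everywhere; that each kernel_op t acts on (classes of functions
   of) L_2(Pi) follows from the invariance of Pi. *)
Record stationary_markov : Prop := {
  invariant_Pi : invariant Pi ;
  unique_Pi : forall nu : probability X R, invariant nu ->
    forall A : set X, measurable A -> nu A = Pi A ;
  semigroup0 : forall f : X -> R, f \in Lfun Pi 2%:E ->
    {ae Pi, forall x, kernel_op 0 f x = f x} ;
  semigroupD : forall (s t : nat) (f : X -> R), f \in Lfun Pi 2%:E ->
    {ae Pi, forall x, kernel_op (s + t) f x = kernel_op s (kernel_op t f) x} ;
  initial_law : forall A : set X, measurable A ->
    distribution P (X_ 0%N) A = Pi A ;
  markov_property : forall (s t : nat) (E : set Omega) (B : set X),
    past s E -> measurable B ->
    P (E `&` X_ (s + t)%N @^-1` B) = (\int[P]_(w in E) Pt t (X_ s w) B)%E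
}.

End StationaryMarkov.

(* Distribution function of the normal law with mean 0 and variance v >= 0,
   the unit mass at 0 when v = 0.  The case v = 0 has to be treated apart
   because [normal_prob _ 0] is the uniform law on [0, 1]. *)
Definition gaussian_cdf (R : realType) (v z : R) : \bar R :=
  if v == 0 then ((0 <= z)%R%:R)%:E
  else normal_prob 0 (Num.sqrt v) `]-oo, z].

(* Main.v *)
(* Truncating [f] at a power of the rate and interpolating between the bounded
   Lipschitz distance and the moment of order [2p] gives
   [||P_t f - Pi f||_2 = O(rate(t)^((1 - 1/p)/2))], which is summable in [t].
   Hence, up to sums of variance at most [dl^2 n], the centered sums of [f] are
   those of [g - P_1 g] for a bounded [g] (a truncated resolvent of a truncation
   of [f]), that is, a stationary martingale with bounded increments plus a
   bounded boundary term; in particular the normalized standard deviations form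
   a Cauchy sequence.

   The martingale is treated by Lindeberg's method with the test functions
   [u(v, x) = Phi((z - x) / sqrt v)], which solve the heat equation explicitly.
   The conditional variances are averaged without an ergodic theorem: they are
   approximated in L_1(Pi) by a constant plus a coboundary [q - P_1 q] with [q]
   bounded (bounded Lipschitz functions are dense in L_1(Pi) and are mixed by the
   chain), and a coboundary disappears by summation by parts.  Mollified
   indicators finally sandwich the distribution function. *)
Require Import Defs.
From HB Require Import structures.
From mathcomp Require Import all_boot all_order all_algebra.
From mathcomp Require Import all_classical all_reals all_analysis.
From mathcomp Require Import measurable_realfun ring lra.

Set Implicit Arguments.
Unset Strict Implicit.
Unset Printing Implicit Defensive.
Import Order.TTheory GRing.Theory Num.Theory.
Import numFieldNormedType.Exports.

Local Open Scope classical_set_scope.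
Local Open Scope ring_scope.

(** * Gaussian calculus *)

(** One estimate carries the approximation: the second moment of a stationary sum of [phi] over [n]
    steps is at most [2 |phi|_2 (sum_t |P_t phi|_2) n]. It is linear in the norm of [phi], so a
    summand of small norm is negligible at scale sqrt n as soon as its decay sum is merely bounded.
    Both errors of the martingale approximation are of this kind, the tail of [f] beyond the
    truncation level and [P_T] of the truncated function, because the decay constant depends only on
    the Lipschitz constant, the mean of [M] and the moment of [f], never on the truncation level.
    [kernel_op] is applied to bounded functions only: these are integrable for every [Pt t x],
    whereas the moment of [f] is controlled under [Pi]. The semigroup laws hold [Pi]-almost
    everywhere, hence enter as vanishing L_2 norms. The heat functions are used at variances at
    least [e > 0], where their derivatives are uniformly bounded. This smoothing stays fixed while
    [n] grows and is removed at the very end, so a degenerate limit needs no separate martingale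
    argument. *)

Section pointwise_derivatives.
Context {R : realType}.
Implicit Types (f g : R -> R) (x a b c : R).

Lemma is_derive1_eq f x a b : is_derive x 1 f a -> a = b -> is_derive x 1 f b.
Proof. by move=> ? <-. Qed.

Lemma is_derive1_id x : is_derive x 1 (fun y : R => y) 1.
Proof. exact: is_derive_id. Qed.

Lemma is_derive1_cst c x : is_derive x 1 (fun _ : R => c) 0.
Proof. exact: is_derive_cst. Qed.

Lemma is_derive1D f g x a b : is_derive x 1 f a -> is_derive x 1 g b ->
  is_derive x 1 (fun y => f y + g y) (a + b).
Proof. by move=> fa gb; exact: is_deriveD. Qed.

Lemma is_derive1B f g x a b : is_derive x 1 f a -> is_derive x 1 g b ->
  is_derive x 1 (fun y => f y - g y) (a - b).
Proof. by move=> fa gb; exact: is_deriveB. Qed.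

Lemma is_derive1M f g x a b : is_derive x 1 f a -> is_derive x 1 g b ->
  is_derive x 1 (fun y => f y * g y) (f x * b + g x * a).
Proof. by move=> fa gb; exact: is_deriveM. Qed.

Lemma is_derive1Z c f x a : is_derive x 1 f a ->
  is_derive x 1 (fun y => c * f y) (c * a).
Proof. by move=> fa; exact: is_deriveZ. Qed.

Lemma is_derive1_sqr f x a : is_derive x 1 f a ->
  is_derive x 1 (fun y => f y ^+ 2) (2 * f x * a).
Proof.
by move=> fa; apply: (is_derive1_eq (is_derive1M fa fa)); ring.
Qed.

Lemma is_derive1_chain f g x a b : is_derive (g x) 1 f a ->
  is_derive x 1 g b -> is_derive x 1 (fun y => f (g y)) (a * b).
Proof. by move=> fa gb; exact: is_derive1_comp. Qed.

End pointwise_derivatives.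

(** * Mean value and Taylor estimates *)

Section taylor.
Context {R : realType}.
Implicit Types (f df : R -> R) (x b h C : R).

Lemma MVT_norm f df a C b :
  (forall x, `|x - a| <= `|b - a| -> is_derive x 1 f (df x)) ->
  (forall x, `|x - a| <= `|b - a| -> `|df x| <= C) ->
  `|f b - f a| <= C * `|b - a|.
Proof.
move=> fdf dfC.
have [ab|ba] := leP a b.
- have ba0 : `|b - a| = b - a by rewrite ger0_norm// subr_ge0.
  have near_a x : x \in `[a, b] -> `|x - a| <= `|b - a|.
    rewrite in_itv/= => /andP[ax xb]; rewrite ba0 ger0_norm ?subr_ge0//.
    by rewrite lerD2r.
  have [||c /near_a cab ->] := @MVT_segment R f df a b ab.
  + move=> x /subset_itv_oo_cc xab; exact/fdf/near_a.
  + apply: derivable_within_continuous => x /near_a/fdf fx.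
    exact: (@ex_derive _ _ _ _ _ _ _ fx).
  + by rewrite normrM ler_wpM2r// dfC.
- have ba0 : `|b - a| = a - b by rewrite ltr0_norm ?opprB// subr_lt0.
  have near_a x : x \in `[b, a] -> `|x - a| <= `|b - a|.
    rewrite in_itv/= => /andP[bx xa]; rewrite ba0 ler0_norm ?subr_le0//.
    by rewrite opprB lerD2l lerN2.
  have [||c /near_a cab fE] := @MVT_segment R f df b a (ltW ba).
  + move=> x /subset_itv_oo_cc xab; exact/fdf/near_a.
  + apply: derivable_within_continuous => x /near_a/fdf fx.
    exact: (@ex_derive _ _ _ _ _ _ _ fx).
  + by rewrite distrC fE normrM distrC ler_wpM2r// dfC.
Qed.

(** One integration step of Taylor's formula. The factor [1 / k.+1] is given up, so that the same
    [C] survives the three uses in [taylor2], where the remainder and its first two derivatives all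
    vanish at 0. *)
Lemma MVT_norm0 f df C k b : 0 <= C -> f 0 = 0 ->
  (forall x, `|x| <= `|b| -> is_derive x 1 f (df x)) ->
  (forall x, `|x| <= `|b| -> `|df x| <= C * `|x| ^+ k) ->
  `|f b| <= C * `|b| ^+ k.+1.
Proof.
move=> C0 f0 fdf dfC; rewrite exprSr mulrA -[f b]subr0 -[X in `|_ - X|]f0.
rewrite -[in leRHS](subr0 b) [X in _ <= _ * _ ^+ _ * X](_ : _ = `|b - 0|); last by rewrite subr0.
apply: (@MVT_norm _ df) => x; rewrite !subr0 => xb; first exact: fdf.
by rewrite (le_trans (dfC _ xb))// ler_wpM2l// lerXn2r ?nnegrE.
Qed.

Lemma taylor2 (f f1 f2 f3 : R -> R) C x b : 0 <= C ->
  (forall y : R, is_derive y 1 f (f1 y)) -> (forall y : R, is_derive y 1 f1 (f2 y)) ->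
  (forall y : R, is_derive y 1 f2 (f3 y)) -> (forall y, `|f3 y| <= C) ->
  `|f (x + b) - f x - f1 x * b - 2^-1 * f2 x * b ^+ 2| <= C * `|b| ^+ 3.
Proof.
move=> C0 ff1 f12 f23 f3C.
have shift (g dg : R -> R) (y : R) : (forall y : R, is_derive y 1 g (dg y)) ->
    is_derive y 1 (fun y => g (x + y)) (dg (x + y)).
  move=> gdg; apply: (is_derive1_eq (is_derive1_chain (gdg _)
    (is_derive1D (is_derive1_cst x y) (is_derive1_id y)))).
  by rewrite add0r mulr1.
apply: (@MVT_norm0 (fun b => f (x + b) - f x - f1 x * b - 2^-1 * f2 x * b ^+ 2)
  (fun b => f1 (x + b) - f1 x - f2 x * b)) => //.
- by rewrite addr0 expr0n/= !mulr0 !subr0 subrr.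
- move=> y _; apply: (is_derive1_eq (is_derive1B (is_derive1B
      (is_derive1B (shift f f1 y ff1) (is_derive1_cst (f x) y))
      (is_derive1Z (f1 x) (is_derive1_id y)))
      (is_derive1Z (2^-1 * f2 x) (is_derive1_sqr (is_derive1_id y))))).
  by field.
move=> y _; apply: (@MVT_norm0 (fun b => f1 (x + b) - f1 x - f2 x * b)
  (fun b => f2 (x + b) - f2 x)) => //.
- by rewrite addr0 !mulr0 !subr0 subrr.
- move=> z _; apply: (is_derive1_eq (is_derive1B
      (is_derive1B (shift f1 f2 z f12) (is_derive1_cst (f1 x) z))
      (is_derive1Z (f2 x) (is_derive1_id z)))).
  by ring.
move=> z _; apply: (@MVT_norm0 (fun b => f2 (x + b) - f2 x) (fun b => f3 (x + b))) => //.
- by rewrite addr0 subrr.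
- move=> t _; apply: (is_derive1_eq (is_derive1B (shift _ _ _ f23) (is_derive1_cst _ _))).
  by rewrite subr0.
- by move=> t _; rewrite expr0 mulr1.
Qed.

End taylor.

Section gauss.
Context {R : realType}.
Implicit Types x y z v s : R.

Definition ncdf y : R := fine (normal_prob 0 1 `]-oo, y]).
Definition npdf y : R := normal_pdf 0 1 y.

Lemma npdfE y : npdf y = normal_peak 1 * expR (- 2^-1 * y ^+ 2).
Proof.
by rewrite /npdf normal_pdfE ?oner_neq0// /normal_fun subr0 expr1n; congr (_ * expR _); field.
Qed.

Lemma npdf_ge0 y : 0 <= npdf y. Proof. exact: normal_pdf_ge0. Qed.

Lemma is_derive_ncdf y : is_derive y 1 ncdf (npdf y).
Proof.
have [||||dG GE] := @continuous_FTC1 R npdf -oo%O y (y + 1).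
- by rewrite ltrDl.
- by apply: integrableS (integrable_normal_pdf 0 1).
- by rewrite ltNyr.
- exact: continuous_normal_pdf (oner_neq0 _) _.
- by apply: (@DeriveDef _ _ _ _ _ _ _ dG); rewrite -derive1E; exact: GE.
Qed.

Lemma is_derive_npdf y : is_derive y 1 npdf (- y * npdf y).
Proof.
have -> : npdf = (fun y => normal_peak 1 * expR (- 2^-1 * y ^+ 2)).
  by apply/funext => t; rewrite npdfE.
apply: (is_derive1_eq (is_derive1Z (normal_peak 1) (is_derive1_chain
  (is_derive_expR _) (is_derive1Z (- 2^-1) (is_derive1_sqr (is_derive1_id y)))))).
by field.
Qed.

(* [t exp(-t) <= 1] at [t = y^2/4] *)
Lemma npdf_decay : exists2 C : R, 0 <= C &
  forall y k, (k <= 4)%N -> `|y| ^+ k * npdf y <= C.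
Proof.
(* [17 = 1 + 16]: a power of [|y|] is at most [1 + |y| ^+ 4], where [|y| ^+ 4 = 16 * t ^+ 2], and
   the exponential is the square of [expR (- t)]. *)
exists (17 * normal_peak 1); first by rewrite mulr_ge0// normal_peak_ge0.
move=> y k k4; rewrite npdfE mulrCA mulrC ler_wpM2r ?normal_peak_ge0//.
have sq : (`|y| ^+ 2 = y ^+ 2) by rewrite real_normK// num_real.
set t := 4^-1 * y ^+ 2.
have t0 : 0 <= t by rewrite mulr_ge0// sqr_ge0.
have e0 : 0 < expR (- t) by exact: expR_gt0.
have eE : expR (- 2^-1 * y ^+ 2) = expR (- t) ^+ 2.
  by rewrite -expRM_natl; congr expR; rewrite /t; field.
have te : t * expR (- t) <= 1.
  rewrite expRN ler_pdivrMr ?expR_gt0// mul1r.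
  by apply: le_trans (expR_ge1Dx t); rewrite lerDr.
have e1 : expR (- t) <= 1 by rewrite expR_le1 oppr_le0.
have yk : `|y| ^+ k <= 1 + `|y| ^+ 4.
  have [y1|y1] := leP `|y| 1.
    by rewrite (le_trans (exprn_ile1 _ _ y1))// lerDl exprn_ge0.
  by rewrite (le_trans (ler_weXn2l (ltW y1) k4))// lerDr.
apply: (le_trans (y := (1 + `|y| ^+ 4) * expR (- t) ^+ 2)).
  by rewrite eE ler_wpM2r// exprn_ge0// ltW.
have -> : `|y| ^+ 4 = 16 * t ^+ 2.
  by rewrite (_ : 4 = 2 * 2)%N// exprM sq /t; field.
rewrite mulrDl mul1r -mulrA -exprMn (_ : 17 = 1 + 16 * 1); last by ring.
apply: lerD; first by rewrite exprn_ile1// ltW.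
by rewrite ler_wpM2l// exprn_ile1// mulr_ge0// ltW.
Qed.

End gauss.

Section heat.
Context {R : realType} (z : R).
Implicit Types x v s h b : R.

(* [heat0 v x] is the probability that [x + sqrt v N <= z] for a standard normal
   [N]; [heat1] and [heat2] are its derivatives in [x], and its derivative in [v]
   is [heat2 / 2]. *)
Definition heat0 v x : R := ncdf ((z - x) / Num.sqrt v).
Definition heat1 v x : R := - npdf ((z - x) / Num.sqrt v) / Num.sqrt v.
Definition heat2 v x : R :=
  - ((z - x) / Num.sqrt v * npdf ((z - x) / Num.sqrt v)) / v.

Let yx s x : is_derive x 1 (fun x => (z - x) / s) (- s^-1).
Proof.
apply: (is_derive1_eq (is_derive1M (is_derive1B (is_derive1_cst z x)
  (is_derive1_id x)) (is_derive1_cst s^-1 x))).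
by rewrite mulr0 add0r sub0r mulrN1.
Qed.

Lemma is_derive_heat0 v x : is_derive x 1 (heat0 v) (heat1 v x).
Proof.
apply: (is_derive1_eq (is_derive1_chain (is_derive_ncdf _) (yx (Num.sqrt v) x))).
by rewrite /heat1 mulrN mulNr.
Qed.

Lemma is_derive_heat1 v x : 0 < v -> is_derive x 1 (heat1 v) (heat2 v x).
Proof.
move=> v0; have s0 : Num.sqrt v != 0 by rewrite sqrtr_eq0 -ltNge.
have -> : heat1 v = fun x => (- (Num.sqrt v)^-1) * npdf ((z - x) / Num.sqrt v).
  by apply/funext => t; rewrite /heat1 mulrC mulrN mulNr.
apply: (is_derive1_eq (is_derive1Z _ (is_derive1_chain (is_derive_npdf _)
  (yx (Num.sqrt v) x)))).
rewrite /heat2 -[X in _ = _ / X](sqr_sqrtr (ltW v0)).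
move: (npdf ((z - x) / Num.sqrt v)) (Num.sqrt v) s0 => g s s0.
by field.
Qed.

Lemma is_derive_heat2 v x : 0 < v -> is_derive x 1 (heat2 v)
  (- (((z - x) / Num.sqrt v) ^+ 2 - 1) * npdf ((z - x) / Num.sqrt v) / (v * Num.sqrt v)).
Proof.
move=> v0; have s0 : Num.sqrt v != 0 by rewrite sqrtr_eq0 -ltNge.
have -> : heat2 v = fun x =>
    (- v^-1) * ((z - x) / Num.sqrt v * npdf ((z - x) / Num.sqrt v)).
  by apply/funext => t; rewrite /heat2 mulrC mulrN mulNr.
apply: (is_derive1_eq (is_derive1Z _ (is_derive1M (yx (Num.sqrt v) x)
  (is_derive1_chain (is_derive_npdf _) (yx (Num.sqrt v) x))))).
have vE : v = Num.sqrt v ^+ 2 by rewrite sqr_sqrtr// ltW.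
move: (npdf ((z - x) / Num.sqrt v)) (Num.sqrt v) s0 vE => g s s0 ->.
by field.
Qed.

Let yv v x : 0 < v ->
  is_derive v 1 (fun v => (z - x) / Num.sqrt v) (- 2^-1 * ((z - x) / Num.sqrt v) / v).
Proof.
move=> v0; have s0 : Num.sqrt v != 0 by rewrite sqrtr_eq0 -ltNge.
have sV : is_derive v 1 (fun v => (Num.sqrt v)^-1)
    (- Num.sqrt v ^- 2 * (2 * Num.sqrt v)^-1).
  exact: (is_deriveV s0 (is_derive1_sqrt v0)).
apply: (is_derive1_eq (is_derive1Z (z - x) sV)).
rewrite -[X in _ = _ / X](sqr_sqrtr (ltW v0)).
move: (Num.sqrt v) s0 => s s0.
by field.
Qed.

Lemma is_derive_heat0v v x : 0 < v ->
  is_derive v 1 (heat0 ^~ x) (2^-1 * heat2 v x).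
Proof.
move=> v0; apply: (is_derive1_eq (is_derive1_chain (is_derive_ncdf _) (yv x v0))).
rewrite /heat2; move: (npdf ((z - x) / Num.sqrt v)) ((z - x) / Num.sqrt v) => g s.
by have v0' := lt0r_neq0 v0; field.
Qed.

Lemma is_derive_heat2v v x : 0 < v ->
  is_derive v 1 (heat2 ^~ x) ((3 / 2 * ((z - x) / Num.sqrt v) -
    2^-1 * ((z - x) / Num.sqrt v) ^+ 3) * npdf ((z - x) / Num.sqrt v) / v ^+ 2).
Proof.
move=> v0; have v0' := lt0r_neq0 v0.
have vV : is_derive v 1 (fun v => v^-1) (- v ^- 2 * 1).
  exact: (is_deriveV v0' (is_derive1_id v)).
have -> : heat2 ^~ x = (fun v =>
    (- 1) * ((z - x) / Num.sqrt v * npdf ((z - x) / Num.sqrt v)) * v^-1).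
  by apply/funext => t; rewrite /heat2 mulN1r.
apply: (is_derive1_eq (is_derive1M (is_derive1Z (-1) (is_derive1M (yv x v0)
  (is_derive1_chain (is_derive_npdf _) (yv x v0)))) vV)).
move: (npdf ((z - x) / Num.sqrt v)) ((z - x) / Num.sqrt v) => g s.
by field.
Qed.

Lemma ncdf_ge0 y : 0 <= ncdf y :> R. Proof. exact: fine_ge0. Qed.

Lemma ncdf_le1 y : ncdf y <= 1 :> R.
Proof.
rewrite -lee_fin fineK ?fin_num_measure//; exact: probability_le1.
Qed.

(** Every derivative involved is a polynomial of degree at most 3 in [y = (z - x) / sqrt v], times
    [npdf y], times a negative power of [v]. The first two factors are bounded by [npdf_decay], and
    the last one because [v] stays above [e]. *)
Lemma heat_bounds e : 0 < e -> exists2 C : R, 0 <= C &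
  forall v, e <= v ->
  [/\ forall x, `|heat1 v x| <= C, forall x, `|heat2 v x| <= C,
   forall x b, `|heat0 v (x + b) - heat0 v x| <= C * `|b|,
   forall x b, `|heat2 v (x + b) - heat2 v x| <= C * `|b| &
   forall x b, `|heat0 v (x + b) - heat0 v x - heat1 v x * b
     - 2^-1 * heat2 v x * b ^+ 2| <= C * `|b| ^+ 3] /\
  (forall x h, 0 <= h -> `|heat2 (v + h) x - heat2 v x| <= C * h /\
    `|heat0 (v + h) x - heat0 v x - 2^-1 * heat2 v x * h| <= C * h ^+ 2).
Proof.
move=> e0; have [C C0 gC] := @npdf_decay R.
have se0 : 0 < Num.sqrt e by rewrite sqrtr_gt0.
(* [a] dominates both [(sqrt v)^-1] and [v^-1]; being at least 1, its square dominates all the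
   powers of [v] that occur. *)
pose a := 1 + (Num.sqrt e)^-1 + e^-1.
have a1 : 1 <= a by rewrite /a -addrA lerDl addr_ge0// invr_ge0 ltW.
have a0 : 0 <= a by rewrite (le_trans _ a1).
have sa v : e <= v -> (Num.sqrt v)^-1 <= a.
  move=> ev; apply: (le_trans (y := (Num.sqrt e)^-1)).
    by rewrite lef_pV2 ?posrE ?sqrtr_gt0 ?(lt_le_trans e0 ev)// ler_wsqrtr.
  by rewrite /a addrAC lerDr addr_ge0// invr_ge0 ltW.
have va v : e <= v -> v^-1 <= a.
  move=> ev; apply: (le_trans (y := e^-1)).
    by rewrite lef_pV2 ?posrE ?(lt_le_trans e0 ev).
  by rewrite /a lerDr addr_ge0// invr_ge0 ltW.
have a12 : a <= a ^+ 2 by rewrite expr2 ler_peMr.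
have a02 : 0 <= a ^+ 2 by rewrite exprn_ge0.
(* The factor 4 leaves room for the coefficients of the polynomials in [y], with absolute sums
   [1 + 1] and [3 / 2 + 1 / 2]. *)
pose D := 4 * C * a ^+ 2.
have D0 : 0 <= D by rewrite !mulr_ge0.
have gk (k : nat) y : (k <= 4)%N -> `|y ^+ k * npdf y| <= C.
  by move=> k4; rewrite normrM normrX [X in _ * X]ger0_norm ?npdf_ge0// gC.
have CD : C * a ^+ 2 <= D.
  by rewrite /D -[4 * C * _]mulrA ler_peMl ?ler1n// mulr_ge0.
have b1 v : e <= v -> forall x, `|heat1 v x| <= D.
  move=> ev x; apply: le_trans CD; rewrite /heat1 normrM normrN.
  apply: ler_pM => //; first by rewrite -[npdf _]mul1r -[1](expr0 ((z - x) / Num.sqrt v)) gk.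
  by rewrite ger0_norm ?invr_ge0 ?sqrtr_ge0// (le_trans (sa _ ev)).
have b2 v : e <= v -> forall x, `|heat2 v x| <= D.
  move=> ev x; apply: le_trans CD; rewrite /heat2 normrM normrN.
  apply: ler_pM => //; first exact: (gk 1%N).
  by rewrite ger0_norm ?invr_ge0 ?(le_trans (va _ ev))// ltW// (lt_le_trans e0).
have b3 v : e <= v -> forall x, `|- (((z - x) / Num.sqrt v) ^+ 2 - 1) *
    npdf ((z - x) / Num.sqrt v) / (v * Num.sqrt v)| <= D.
  move=> ev x; rewrite normrM mulNr normrN /D.
  have v0 := lt_le_trans e0 ev.
  apply: ler_pM => //.
    rewrite mulrBl mul1r (le_trans (ler_normB _ _))//.
    have h2 := @gk 2 ((z - x) / Num.sqrt v) isT.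
    have h0 := @gk 0 ((z - x) / Num.sqrt v) isT; rewrite mul1r in h0.
    rewrite (le_trans (lerD h2 h0))//; lra.
  rewrite invfM normrM expr2 !ger0_norm ?invr_ge0 ?sqrtr_ge0 ?(ltW v0)//.
  by apply: ler_pM; rewrite ?invr_ge0 ?sqrtr_ge0 ?(ltW v0)//; [exact: va|exact: sa].
have b2v v : e <= v -> forall x, `|(3 / 2 * ((z - x) / Num.sqrt v) -
    2^-1 * ((z - x) / Num.sqrt v) ^+ 3) * npdf ((z - x) / Num.sqrt v) / v ^+ 2| <= D.
  move=> ev x; rewrite normrM /D.
  have v0 := lt_le_trans e0 ev.
  apply: ler_pM => //.
    have := @gk 3 ((z - x) / Num.sqrt v) isT.
    have := @gk 1 ((z - x) / Num.sqrt v) isT; rewrite expr1.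
    move: (npdf ((z - x) / Num.sqrt v)) ((z - x) / Num.sqrt v) => g y h1 h3.
    rewrite (_ : _ * _ = 3 / 2 * (y * npdf y) - 2^-1 * (y ^+ 3 * npdf y)); last by ring.
    rewrite (le_trans (ler_normB _ _))// normrM [`|3 / 2|]ger0_norm//.
    rewrite [X in _ + X]normrM [`|2^-1|]ger0_norm ?invr_ge0//.
    lra.
  rewrite -exprVn ger0_norm ?exprn_ge0 ?invr_ge0 ?(ltW v0)//.
  by rewrite lerXn2r ?nnegrE ?invr_ge0 ?(ltW v0)// va.
exists D => // v ev; have v0 := lt_le_trans e0 ev.
split.
  split; [exact: b1 _ ev|exact: b2 _ ev| | |].
  - move=> x b; have -> : `|b| = `|x + b - x| by rewrite addrAC subrr add0r.
    by apply: (@MVT_norm _ _ (heat1 v)) => y _; [exact: is_derive_heat0|exact: b1 _ ev _].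
  - move=> x b; have -> : `|b| = `|x + b - x| by rewrite addrAC subrr add0r.
    apply: (@MVT_norm _ (heat2 v) (fun x => - (((z - x) / Num.sqrt v) ^+ 2 - 1) *
      npdf ((z - x) / Num.sqrt v) / (v * Num.sqrt v))) => y _.
      exact: is_derive_heat2.
    exact: b3.
  - move=> x b; exact: (taylor2 x b D0 (is_derive_heat0 v)
      (fun y => is_derive_heat1 y v0) (fun y => is_derive_heat2 y v0) (b3 v ev)).
have L h x : 0 <= h -> `|heat2 (v + h) x - heat2 v x| <= D * h.
  move=> h0.
  have dom t : t \in `[v, v + h] -> e <= t.
    by rewrite in_itv/= => /andP[vt _]; exact: le_trans vt.
  have [|||c cI ->] := @MVT_segment R (heat2 ^~ x) (fun v => (3 / 2 * ((z - x) / Num.sqrt v) -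
    2^-1 * ((z - x) / Num.sqrt v) ^+ 3) * npdf ((z - x) / Num.sqrt v) / v ^+ 2) v (v + h).
  - by rewrite lerDl.
  - move=> t /subset_itv_oo_cc/dom et; apply: is_derive_heat2v.
    exact: lt_le_trans et.
  - apply: derivable_within_continuous => t /dom et.
    exact: (@ex_derive _ _ _ _ _ _ _ (is_derive_heat2v x (lt_le_trans e0 et))).
  by rewrite addrAC subrr add0r normrM [`|h|]ger0_norm// ler_wpM2r// b2v// dom.
move=> x h h0; split; first exact: L.
have dom t : t \in `[0, h] -> 0 < v + t.
  by rewrite in_itv/= => /andP[t0 _]; rewrite ltr_wpDr.
(* By the heat equation the derivative of this time remainder is half an increment of [heat2], which
   [L] makes of order [h]. *)
pose F (h : R) : R := heat0 (v + h) x - heat0 v x - 2^-1 * heat2 v x * h.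
pose dF (h : R) : R := 2^-1 * heat2 (v + h) x - 2^-1 * heat2 v x.
have der t : t \in `[0, h] -> is_derive t 1 F (dF t).
  move=> /dom vt; apply: (is_derive1_eq (is_derive1B (is_derive1B
    (is_derive1_chain (is_derive_heat0v x vt)
      (is_derive1D (is_derive1_cst v t) (is_derive1_id t)))
    (is_derive1_cst (heat0 v x) t))
    (is_derive1Z (2^-1 * heat2 v x) (is_derive1_id t)))).
  by rewrite add0r subr0 !mulr1.
have cF : {within `[0, h], continuous F}.
  apply: derivable_within_continuous => t /der dt.
  exact: (@ex_derive _ _ _ _ _ _ _ dt).
have der' t : t \in `]0, h[ -> is_derive t 1 F (dF t).
  by move=> /subset_itv_oo_cc; exact: der.
have [c cI Fh] := MVT_segment h0 der' cF.
have F0 : F 0 = 0 by rewrite /F addr0 mulr0 subr0 subrr.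
move: Fh; rewrite F0 !subr0 => Fh.
rewrite -/(F h) Fh /dF.
rewrite expr2 mulrA normrM [`|h|]ger0_norm// ler_wpM2r//.
rewrite -mulrBr normrM ger0_norm ?invr_ge0//.
move: cI; rewrite in_itv/= => /andP[c0 ch].
have := L c x c0; have : D * c <= D * h by rewrite ler_wpM2l.
by move: (`|_|) (normr_ge0 (heat2 (v + c) x - heat2 v x)) => w w0 *; lra.
Qed.

End heat.

(** * Limits and scaling of the normal distribution function *)

Section normal_cdf_limits.
Context {R : realType}.
Implicit Types (s y z : R).

(** Seen as a random variable under a normal law, the identity has that law as its distribution, so
    the general limits of [cdf] apply. *)
Let idTR : measurableTypeR R -> R := idfun.

#[local] HB.instance Definition _ :=
  @isMeasurableFun.Build _ _ _ _ idTR (@measurable_id _ _ setT).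

Let idRV s : {RV (normal_prob 0 s : probability _ R) >-> R} := idTR.

Lemma cvg_normal_Ny s : fine (normal_prob 0 s `]-oo, y]) @[y --> -oo] --> (0 : R).
Proof.
by apply: fine_cvg; exact: (cvg_cdfNy0 (idRV s)).
Qed.

Lemma cvg_ncdf_y : ncdf y @[y --> +oo] --> (1 : R).
Proof.
by apply: fine_cvg; exact: (cvg_cdfy1 (idRV 1)).
Qed.

Lemma cvg_ncdf_Ny : ncdf y @[y --> -oo] --> (0 : R).
Proof. exact: cvg_normal_Ny. Qed.

Lemma ncdf_le y z : y <= z -> ncdf y <= ncdf z.
Proof.
move=> yz; rewrite fine_le ?fin_num_measure//.
exact: (cdf_nondecreasing (idRV 1)).
Qed.

Lemma continuous_ncdf : continuous (@ncdf R).
Proof.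
move=> y; apply: differentiable_continuous; apply/derivable1_diffP.
exact: (@ex_derive _ _ _ _ _ _ _ (is_derive_ncdf y)).
Qed.

(** Both sides have the same derivative in [z], hence differ by a constant, which is 0 because both
    tend to 0 at [-oo]. *)
Lemma normal_prob_scale s z : 0 < s ->
  normal_prob 0 s `]-oo, z] = (ncdf (z / s))%:E.
Proof.
move=> s0; rewrite -[LHS]fineK; last by apply: fin_num_measure; exact: measurable_itv.
congr EFin.
pose F y : R := fine (normal_prob 0 s `]-oo, y]).
have dF y : is_derive y 1 F (normal_pdf 0 s y).
  have [||||dG GE] := @continuous_FTC1 R (normal_pdf 0 s) -oo%O y (y + 1).
  - by rewrite ltrDl.
  - by apply: integrableS (integrable_normal_pdf 0 s).
  - by rewrite ltNyr.
  - by apply: continuous_normal_pdf; rewrite gt_eqF.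
  - by apply: (@DeriveDef _ _ _ _ _ _ _ dG); rewrite -derive1E; exact: GE.
have dD y : is_derive y 1 (fun y => F y - ncdf (y / s)) 0.
  apply: (is_derive1_eq (is_derive1B (dF y) (is_derive1_chain (is_derive_ncdf _)
    (is_derive1M (is_derive1_id y) (is_derive1_cst s^-1 y))))).
  rewrite mulr0 mulr1 add0r normal_pdfE ?gt_eqF// npdfE /normal_fun subr0 /normal_peak.
  rewrite expr1n mul1r -(mulr_natr (s ^+ 2 * pi)) -mulrA sqrtrM ?sqr_ge0// sqrtr_sqr gtr0_norm//.
  rewrite -(mulr_natr pi) (_ : - y ^+ 2 / (s ^+ 2 *+ 2) = - 2^-1 * (y / s) ^+ 2); last first.
    by have := lt0r_neq0 s0 => s0'; field.
  by rewrite invfM; ring.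
have cstD y : F y - ncdf (y / s) = F z - ncdf (z / s).
  exact: (is_derive_0_is_cst _ _ dD).
have lim0 : F y - ncdf (y / s) @[y --> -oo] --> (0 - 0 : R).
  apply: cvgB; first exact: cvg_normal_Ny.
  apply: (cvg_comp (fun y => y / s) ncdf _ cvg_ncdf_Ny).
  have sV : 0 < s^-1 by rewrite invr_gt0.
  by apply: gt0_cvgMlNy => //; exact: cvg_id.
have lim1 : F y - ncdf (y / s) @[y --> -oo] --> F z - ncdf (z / s).
  have -> : (fun y => F y - ncdf (y / s)) = cst (F z - ncdf (z / s)).
    by apply/funext => y; exact: cstD.
  exact: cvg_cst.
apply/eqP; rewrite -subr_eq0 -[X in _ == X](subr0 0); apply/eqP.
exact: cvg_unique lim1 lim0.
Qed.

End normal_cdf_limits.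

(** * Integration on probability spaces *)

Section bounded_measurable.
Context d (T : measurableType d) (R : realType).
Implicit Types (f g : T -> R) (c : R).

(** The bound holds at every point, not just almost everywhere: the function is then integrable for
    each kernel measure [Pt t x], and the class is stable under [kernel_op]. *)
Definition bounded_mfun f : Prop :=
  measurable_fun setT f /\ exists B : R, forall x, `|f x| <= B.

Lemma bounded_mfun_cst c : bounded_mfun (fun _ => c).
Proof. by split; [exact: measurable_cst|exists `|c|]. Qed.

Lemma bounded_mfunD f g : bounded_mfun f -> bounded_mfun g ->
  bounded_mfun (fun x => f x + g x).
Proof.
move=> [mf [B fB]] [mg [C gC]]; split; first exact: measurable_funD.
by exists (B + C) => x; rewrite (le_trans (ler_normD _ _))// lerD.
Qed.

Lemma bounded_mfunM f g : bounded_mfun f -> bounded_mfun g ->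
  bounded_mfun (fun x => f x * g x).
Proof.
move=> [mf [B fB]] [mg [C gC]]; split; first exact: measurable_funM.
by exists (B * C) => x; rewrite normrM ler_pM.
Qed.

Lemma bounded_mfunZ c f : bounded_mfun f -> bounded_mfun (fun x => c * f x).
Proof. by move=> bf; apply: bounded_mfunM => //; exact: bounded_mfun_cst. Qed.

Lemma bounded_mfunB f g : bounded_mfun f -> bounded_mfun g ->
  bounded_mfun (fun x => f x - g x).
Proof.
move=> bf bg; under eq_fun do rewrite -mulN1r.
by apply: bounded_mfunD => //; exact: bounded_mfunZ.
Qed.

Lemma bounded_mfunX f n : bounded_mfun f -> bounded_mfun (fun x => f x ^+ n).
Proof.
move=> bf; elim: n => [|n ih]; first exact: bounded_mfun_cst.
by under eq_fun do rewrite exprS; exact: bounded_mfunM.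
Qed.

Lemma bounded_mfun_norm f : bounded_mfun f -> bounded_mfun (fun x => `|f x|).
Proof.
move=> [mf [B fB]]; split; first exact: measurableT_comp.
by exists B => x; rewrite normr_id.
Qed.

Lemma bounded_mfun_sum n (F : nat -> T -> R) : (forall i, bounded_mfun (F i)) ->
  bounded_mfun (fun x => \sum_(i < n) F i x).
Proof.
move=> bF; elim: n => [|n ih].
  by under eq_fun do rewrite big_ord0; exact: bounded_mfun_cst.
by under eq_fun do rewrite big_ord_recr/=; exact: bounded_mfunD.
Qed.

Lemma bounded_mfun_indic (A : set T) : measurable A ->
  bounded_mfun (\1_A : T -> R).
Proof.
move=> mA; split; first exact: measurable_indic.
by exists 1 => x; rewrite indicE; case: (_ \in _); rewrite ?normr0 ?normr1.
Qed.

Lemma bounded_mfun_integrable (mu : probability T R) f : bounded_mfun f ->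
  mu.-integrable setT (EFin \o f).
Proof.
move=> [mf [B fB]]; apply: (@le_integrable _ _ _ mu setT measurableT _ (EFin \o cst B)).
- exact/measurable_EFinP.
- by move=> x _ /=; rewrite lee_fin (le_trans (fB x))// ler_norm.
- exact: finite_measure_integrable_cst.
Qed.

End bounded_measurable.

Lemma bounded_mfun_comp d d' (T : measurableType d) (U : measurableType d')
    (R : realType) (f : U -> R) (g : T -> U) :
  bounded_mfun f -> measurable_fun setT g -> bounded_mfun (fun x => f (g x)).
Proof.
move=> [mf [B fB]] mg; split; first exact: measurableT_comp.
by exists B.
Qed.

Section probability_integral.
Context d (T : measurableType d) (R : realType) (mu : probability T R).
Implicit Types (f g : T -> R) (c : R).
Let intT f := mu.-integrable setT (EFin \o f).

Lemma prob_int_cst c : \int[mu]_x c = c.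
Proof. by rewrite Rintegral_cst// [X in fine X](_ : _ = 1%E) ?mulr1//; exact: probability_setT. Qed.

Lemma prob_intD f g : intT f -> intT g ->
  \int[mu]_x (f x + g x) = \int[mu]_x f x + \int[mu]_x g x.
Proof. exact: RintegralD. Qed.

Lemma prob_intB f g : intT f -> intT g ->
  \int[mu]_x (f x - g x) = \int[mu]_x f x - \int[mu]_x g x.
Proof. exact: RintegralB. Qed.

Lemma prob_intZ c f : intT f -> \int[mu]_x (c * f x) = c * \int[mu]_x f x.
Proof. exact: RintegralZl. Qed.

Lemma prob_int_le f g : intT f -> intT g -> (forall x, f x <= g x) ->
  \int[mu]_x f x <= \int[mu]_x g x.
Proof. by move=> fi gi fg; apply: le_Rintegral => // x _; exact: fg. Qed.

Lemma prob_int_norm f : intT f -> `|\int[mu]_x f x| <= \int[mu]_x `|f x|.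
Proof. by move=> fi; exact: le_normr_Rintegral. Qed.

Lemma prob_int_sum n (F : nat -> T -> R) : (forall i, bounded_mfun (F i)) ->
  \int[mu]_x (\sum_(i < n) F i x) = \sum_(i < n) \int[mu]_x F i x.
Proof.
move=> bF; elim: n => [|n ih].
  by under eq_Rintegral do rewrite big_ord0; rewrite big_ord0 prob_int_cst.
under eq_Rintegral do rewrite big_ord_recr/=.
rewrite prob_intD ?big_ord_recr/= ?ih//.
  by apply: bounded_mfun_integrable; exact: bounded_mfun_sum.
exact: bounded_mfun_integrable.
Qed.

Lemma prob_int_bound f c : bounded_mfun f -> (forall x, `|f x| <= c) ->
  `|\int[mu]_x f x| <= c.
Proof.
move=> bf fc; apply: (le_trans (prob_int_norm (bounded_mfun_integrable mu bf))).
rewrite -[leRHS]prob_int_cst; apply: prob_int_le => //.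
  by apply: bounded_mfun_integrable; exact: bounded_mfun_norm.
by apply: bounded_mfun_integrable; exact: bounded_mfun_cst.
Qed.

Lemma prob_int_indic (A : set T) : measurable A -> \int[mu]_x \1_A x = fine (mu A).
Proof. by move=> mA; rewrite /Rintegral integral_indic// setIT. Qed.

End probability_integral.

(** * Uniform approximation by combinations of indicators *)

Section layers.
Context {R : realType}.

(** The sum counts the multiples of [1 / N] in []0, y]], so it is the integer part of [y * N]. With
    [f x] for [y] its terms are indicators of superlevel sets of [f]. *)
Lemma layer_approx (N : nat) (y : R) : (0 < N)%N -> 0 <= y <= 1 ->
  `|y - N%:R^-1 * \sum_(j < N) ((j.+1%:R / N%:R <= y)%R)%:R| <= N%:R^-1.
Proof.
move=> N0 /andP[y0 y1].
have N0' : (0 : R) < N%:R by rewrite ltr0n.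
have Ny0 : 0 <= y * N%:R by rewrite mulr_ge0.
set m := Num.truncn (y * N%:R).
have mN : (m <= N)%N.
  rewrite -(@ler_nat R) (le_trans (y := y * N%:R))//.
    by rewrite /m truncn_le.
  by rewrite ler_piMl// ltW.
have -> : \sum_(j < N) ((j.+1%:R / N%:R <= y)%R)%:R = m%:R :> R.
  transitivity ((\sum_(j < N) (j < m)%N)%:R : R).
    rewrite natr_sum; apply: eq_bigr => j _; congr (_%:R); congr nat_of_bool.
    by rewrite ler_pdivrMr// truncn_ge_nat.
  congr (_%:R); rewrite -(big_mkord xpredT (fun j => (j < m)%N : nat)).
  rewrite (big_cat_nat (leq0n m) mN)//= [X in (X + _)%N](_ : _ = m) ?[X in (_ + X)%N](_ : _ = 0%N) ?addn0//.
    by rewrite big_nat_cond big1// => i; rewrite andbT => /andP[mi _]; rewrite ltnNge mi.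
  rewrite (eq_big_nat _ _ (F2 := fun=> 1%N)); last by move=> i /andP[_ ->].
  by rewrite sum_nat_const_nat subn0 muln1.
have := truncn_itv Ny0; rewrite -/m => /andP[m1 m2].
rewrite ger0_norm; last by rewrite subr_ge0 mulrC ler_pdivrMr.
rewrite lerBlDl -[X in _ <= _ + X]mulr1 -mulrDr mulrC ler_pdivlMr//.
by rewrite natr1 ltW.
Qed.

End layers.

Section bounded_mfun_induction.
Context d (T : measurableType d) (R : realType).

(** Layers approximate a function with values in [[0, 1]] uniformly, so closure under uniform limits
    replaces the monotone limits of a monotone class argument. A general bounded function is first
    rescaled affinely into [[0, 1]]. *)
Lemma bounded_mfun_ind (S : (T -> R) -> Prop) :
  (forall f g, bounded_mfun f -> bounded_mfun g -> S f -> S g ->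
    S (fun x => f x + g x)) ->
  (forall c f, bounded_mfun f -> S f -> S (fun x => c * f x)) ->
  (forall A : set T, measurable A -> S \1_A) ->
  (forall f, bounded_mfun f -> (forall e, 0 < e -> exists g,
    [/\ bounded_mfun g, S g & forall x, `|f x - g x| <= e]) -> S f) ->
  forall f, bounded_mfun f -> S f.
Proof.
move=> SD SZ SA Slim.
have Scst c : S (fun=> c).
  rewrite (_ : (fun=> c) = (fun x => c * \1_(@setT T) x)); last first.
    by apply/funext => x; rewrite indicE in_setT mulr1.
  by apply: SZ; [exact: bounded_mfun_indic|exact: SA].
have Ssum n (F : nat -> T -> R) : (forall i, bounded_mfun (F i)) ->
    (forall i, S (F i)) -> S (fun x => \sum_(i < n) F i x).
  move=> bF SF; elim: n => [|n ih].
    by under eq_fun do rewrite big_ord0; exact: Scst.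
  under eq_fun do rewrite big_ord_recr/=.
  by apply: SD => //; exact: bounded_mfun_sum.
have S01 f : bounded_mfun f -> (forall x, 0 <= f x <= 1) -> S f.
  move=> bf f01; apply: Slim => // e e0.
  pose N := (Num.truncn e^-1).+1.
  have N0 : (0 : R) < N%:R by rewrite ltr0n.
  pose F (j : nat) : T -> R := \1_(f @^-1` `[j.+1%:R / N%:R, +oo[).
  have mF j : measurable (f @^-1` `[j.+1%:R / N%:R, +oo[).
    by rewrite -[X in measurable X]setTI; apply: (proj1 bf).
  have bF j : bounded_mfun (F j) by exact: bounded_mfun_indic.
  exists (fun x => N%:R^-1 * \sum_(j < N) F j x); split.
  - by apply: bounded_mfunZ; exact: bounded_mfun_sum.
  - apply: SZ; first exact: bounded_mfun_sum.
    by apply: Ssum => // j; exact: SA.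
  move=> x; apply: (le_trans (y := N%:R^-1)).
    rewrite (eq_bigr (fun j : 'I_N => ((j.+1%:R / N%:R <= f x)%R)%:R)).
      by apply: layer_approx.
    move=> j _; rewrite /F indicE; congr (_%:R); congr nat_of_bool.
    apply/idP/idP; first by rewrite inE/= in_itv/= andbT.
    by move=> h; rewrite inE/= in_itv/= andbT.
  by rewrite -[leRHS]invrK lef_pV2 ?posrE ?invr_gt0// ltW// truncnS_gt.
move=> f bf; have [mf [B fB]] := bf.
pose B' := Num.max B 1; have B'0 : 0 < B' by rewrite lt_max ltr01 orbT.
have fB' x : `|f x| <= B' by rewrite (le_trans (fB x))// le_max lexx.
have bc c : bounded_mfun (fun _ : T => c) by exact: bounded_mfun_cst.
have bf1 : bounded_mfun (fun x => (2 * B')^-1 * (f x + B')).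
  by apply/bounded_mfunZ/bounded_mfunD.
rewrite (_ : f = fun x => 2 * B' * ((2 * B')^-1 * (f x + B')) + (- B')); last first.
  by apply/funext => x; field; rewrite gt_eqF.
apply: SD => //; first exact: bounded_mfunZ.
apply: SZ => //; apply: S01 => // x.
have := fB' x; rewrite ler_norml => /andP[h1 h2].
rewrite mulr_ge0 ?invr_ge0 ?mulr_ge0 ?(ltW B'0)//=; last by rewrite -lerBlDr sub0r.
rewrite mulrC ler_pdivrMr ?mulr_gt0// mul1r; lra.
Qed.

(** Meant for [L] the difference of two integrals: an identity between them then has to be checked
    on indicators only. *)
Lemma bounded_functional_eq0 (L : (T -> R) -> R) (C : R) :
  (forall f g, bounded_mfun f -> bounded_mfun g ->
    L (fun x => f x + g x) = L f + L g) ->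
  (forall c f, bounded_mfun f -> L (fun x => c * f x) = c * L f) ->
  (forall f c, bounded_mfun f -> (forall x, `|f x| <= c) -> `|L f| <= C * c) ->
  (forall A : set T, measurable A -> L \1_A = 0) ->
  forall f, bounded_mfun f -> L f = 0.
Proof.
move=> LD LZ LC LA; apply: bounded_mfun_ind => // [f g bf bg f0 g0|c f bf f0|f bf limf].
- by rewrite LD// f0 g0 addr0.
- by rewrite LZ// f0 mulr0.
apply/eqP; rewrite -normr_le0; apply/ler_addgt0Pl => e e0; rewrite addr0.
pose C' := Num.max C 1; have C'0 : 0 < C' by rewrite lt_max ltr01 orbT.
have [g [bg g0 fg]] := limf (e / C') (divr_gt0 e0 C'0).
have -> : L f = L (fun x => f x + (-1) * g x).
  by rewrite LD// ?LZ// ?g0 ?mulr0 ?addr0//; exact: bounded_mfunZ.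
have bfg : bounded_mfun (fun x => f x + (-1) * g x).
  by apply: bounded_mfunD => //; exact: bounded_mfunZ.
have fg' x : `|f x + (-1) * g x| <= e / C' by rewrite mulN1r.
apply: le_trans (LC _ _ bfg fg') _.
apply: (le_trans (y := C' * (e / C'))).
  by rewrite ler_wpM2r ?divr_ge0 ?(ltW e0) ?(ltW C'0)// le_max lexx.
by rewrite mulrC divfK// gt_eqF.
Qed.

End bounded_mfun_induction.

(** * The L_2 norm on a probability space *)

Section square_integrable.
Context d (T : measurableType d) (R : realType) (mu : probability T R).
Implicit Types (f g : T -> R) (c : R).

Definition sq_integrable f : Prop :=
  measurable_fun setT f /\ mu.-integrable setT (EFin \o (fun x => f x ^+ 2)).

Definition L2norm f : R := Num.sqrt (\int[mu]_x (f x ^+ 2)).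

Lemma real_integrableD f g :
  mu.-integrable setT (EFin \o f) -> mu.-integrable setT (EFin \o g) ->
  mu.-integrable setT (EFin \o (fun x => f x + g x)).
Proof. by move=> fi gi; have := integrableD measurableT fi gi. Qed.

Lemma real_integrableZ c f : mu.-integrable setT (EFin \o f) ->
  mu.-integrable setT (EFin \o (fun x => c * f x)).
Proof. by move=> fi; have := integrableZl measurableT c fi. Qed.

Lemma bounded_mfun_sq f : bounded_mfun f -> sq_integrable f.
Proof.
move=> bf; split; first exact: bf.1.
by apply: bounded_mfun_integrable; exact: bounded_mfunX.
Qed.

Lemma sq_integrableM f g : sq_integrable f -> sq_integrable g ->
  mu.-integrable setT (EFin \o (fun x => f x * g x)).
Proof.
move=> [mf fi] [mg gi].
apply: (@le_integrable _ _ _ mu setT measurableT _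
  (EFin \o (fun x => f x ^+ 2 + g x ^+ 2))).
- by apply/measurable_EFinP; exact: measurable_funM.
- move=> x _ /=; rewrite lee_fin normrM (ger0_norm (addr_ge0 (sqr_ge0 _) (sqr_ge0 _))).
  rewrite -(real_normK (num_real (f x))) -(real_normK (num_real (g x))).
  have := sqr_ge0 (`|f x| - `|g x|); have := sqr_ge0 (`|f x| + `|g x|).
  by rewrite !expr2; lra.
- exact: real_integrableD.
Qed.

Lemma sq_integrableZ c f : sq_integrable f -> sq_integrable (fun x => c * f x).
Proof.
move=> [mf fi]; split; first exact: measurable_funM.
under eq_fun do rewrite exprMn.
exact: real_integrableZ.
Qed.

Lemma sq_integrableD f g : sq_integrable f -> sq_integrable g ->
  sq_integrable (fun x => f x + g x).
Proof.
move=> sf sg; split; first exact: measurable_funD sf.1 sg.1.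
have -> : (fun x => (f x + g x) ^+ 2) =
    (fun x => f x ^+ 2 + (g x ^+ 2 + 2 * f x * g x)).
  by apply/funext => x; ring.
apply: real_integrableD; first exact: sf.2.
apply: real_integrableD; first exact: sg.2.
by apply: sq_integrableM => //; exact: sq_integrableZ.
Qed.

Lemma sq_integrableB f g : sq_integrable f -> sq_integrable g ->
  sq_integrable (fun x => f x - g x).
Proof.
move=> sf sg; under eq_fun do rewrite -mulN1r.
by apply: sq_integrableD => //; exact: sq_integrableZ.
Qed.

Lemma sq_integrable_cst c : sq_integrable (fun=> c).
Proof. by apply: bounded_mfun_sq; exact: bounded_mfun_cst. Qed.

Lemma sq_integrable_sum n (F : nat -> T -> R) : (forall i, sq_integrable (F i)) ->
  sq_integrable (fun x => \sum_(i < n) F i x).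
Proof.
move=> bF; elim: n => [|n ih].
  by under eq_fun do rewrite big_ord0; exact: sq_integrable_cst.
by under eq_fun do rewrite big_ord_recr/=; exact: sq_integrableD.
Qed.

Lemma sq_integrable_integrable f : sq_integrable f ->
  mu.-integrable setT (EFin \o f).
Proof.
move=> sf; have := sq_integrableM sf (sq_integrable_cst 1).
by under eq_fun do rewrite mulr1.
Qed.

Lemma le_sq_integrable f g : measurable_fun setT f -> sq_integrable g ->
  (forall x, `|f x| <= `|g x|) -> sq_integrable f.
Proof.
move=> mf [mg gi] fg; split => //.
apply: le_integrable gi => //; first by apply/measurable_EFinP; exact: measurable_funX.
by move=> x _ /=; rewrite lee_fin !normrX lerXn2r ?nnegrE.
Qed.

Let int2_ge0 f : 0 <= \int[mu]_x (f x ^+ 2).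
Proof. by apply: Rintegral_ge0 => x _; exact: sqr_ge0. Qed.

Lemma L2norm_ge0 f : 0 <= L2norm f. Proof. exact: sqrtr_ge0. Qed.

Lemma L2norm_sqr f : L2norm f ^+ 2 = \int[mu]_x (f x ^+ 2).
Proof. by rewrite sqr_sqrtr. Qed.

Lemma L2norm_le f c : 0 <= c -> \int[mu]_x (f x ^+ 2) <= c ^+ 2 -> L2norm f <= c.
Proof. by move=> c0 h; rewrite -(@ler_pXn2r _ 2) ?nnegrE ?L2norm_ge0// L2norm_sqr. Qed.

Lemma L2normZ c f : sq_integrable f -> L2norm (fun x => c * f x) = `|c| * L2norm f.
Proof.
move=> sf; rewrite /L2norm; under eq_Rintegral do rewrite exprMn.
by rewrite prob_intZ ?sf.2// sqrtrM ?sqr_ge0// sqrtr_sqr.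
Qed.

Lemma L2norm_cst c : L2norm (fun=> c) = `|c|.
Proof. by rewrite /L2norm prob_int_cst sqrtr_sqr. Qed.

Lemma cauchy_schwarz f g : sq_integrable f -> sq_integrable g ->
  `|\int[mu]_x (f x * g x)| <= L2norm f * L2norm g.
Proof.
move=> sf sg.
(* This integrates [(a f - b g)^2 >= 0]. With [A], [B], [I] the integrals of [f^2], [g^2], [f g],
   the choice [(a, b) = (I, A)] concludes when [A] is positive; when [A = 0] other weights force
   [I = 0]. *)
have quad a b : 2 * (a * b) * \int[mu]_x (f x * g x) <=
    a ^+ 2 * \int[mu]_x (f x ^+ 2) + b ^+ 2 * \int[mu]_x (g x ^+ 2).
  have ifg := sq_integrableM sf sg.
  have ifg' : mu.-integrable setT (EFin \o (fun x => 2 * (a * b) * (f x * g x))).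
    exact: real_integrableZ.
  have iff : mu.-integrable setT (EFin \o (fun x => a ^+ 2 * f x ^+ 2)).
    by apply: real_integrableZ; exact: sf.2.
  have igg : mu.-integrable setT (EFin \o (fun x => b ^+ 2 * g x ^+ 2)).
    by apply: real_integrableZ; exact: sg.2.
  rewrite -!prob_intZ//; [|exact: sg.2|exact: sf.2].
  rewrite -prob_intD//; apply: prob_int_le => //.
    exact: real_integrableD.
  by move=> x; have := sqr_ge0 (a * f x - b * g x); rewrite !expr2; nra.
rewrite -(@ler_pXn2r _ 2) ?nnegrE ?mulr_ge0 ?L2norm_ge0// exprMn !L2norm_sqr real_normK ?num_real//.
move: (\int[mu]_x (f x ^+ 2)) (int2_ge0 f) (\int[mu]_x (g x ^+ 2)) (int2_ge0 g)
  (\int[mu]_x (f x * g x)) quad => A A0 B B0 I quad.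
have [A00|An0] := eqVneq A 0.
  have [B00|Bn0] := eqVneq B 0.
    have := quad 1 I; rewrite A00 B00; nra.
  have := quad (B + 1) I; have := quad (I * (B + 1)) 1; rewrite A00 !mulr0 !mul0r => h1 h2.
  nra.
have := quad I A; nra.
Qed.

Lemma L2norm_triangle f g : sq_integrable f -> sq_integrable g ->
  L2norm (fun x => f x + g x) <= L2norm f + L2norm g.
Proof.
move=> sf sg; apply: L2norm_le; first by rewrite addr_ge0 ?L2norm_ge0.
have ifg := sq_integrableM sf sg.
have ifg' : mu.-integrable setT (EFin \o (fun x => 2 * (f x * g x))).
  exact: real_integrableZ.
have -> : \int[mu]_x ((f x + g x) ^+ 2) =
    L2norm f ^+ 2 + L2norm g ^+ 2 + 2 * \int[mu]_x (f x * g x).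
  under eq_Rintegral => x _.
    rewrite (_ : (f x + g x) ^+ 2 = (f x ^+ 2 + g x ^+ 2) + 2 * (f x * g x)); last by ring.
    over.
  rewrite prob_intD ?prob_intD ?prob_intZ ?L2norm_sqr//; try exact: sf.2; try exact: sg.2.
  by apply: real_integrableD; [exact: sf.2|exact: sg.2].
have := cauchy_schwarz sf sg; have := ler_norm (\int[mu]_x (f x * g x)).
rewrite !expr2; lra.
Qed.

Lemma L2norm_dist f g : sq_integrable f -> sq_integrable g ->
  `|L2norm f - L2norm g| <= L2norm (fun x => f x - g x).
Proof.
move=> sf sg.
have sfg := sq_integrableB sf sg.
have h1 : L2norm f <= L2norm (fun x => f x - g x) + L2norm g.
  rewrite [X in X <= _](_ : _ = L2norm (fun x => (f x - g x) + g x)).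
    exact: L2norm_triangle.
  by congr L2norm; apply/funext => x; rewrite subrK.
have h2 : L2norm g <= L2norm (fun x => f x - g x) + L2norm f.
  rewrite [X in X <= _](_ : _ = L2norm (fun x => (-1) * (f x - g x) + f x)).
    apply: (le_trans (L2norm_triangle (sq_integrableZ (-1) sfg) sf)).
    by rewrite L2normZ// normrN1 mul1r.
  by congr L2norm; apply/funext => x; ring.
by rewrite ler_norml; lra.
Qed.

Lemma prob_int_le_L2norm f : sq_integrable f -> \int[mu]_x `|f x| <= L2norm f.
Proof.
move=> sf.
have sf' : sq_integrable (fun x => `|f x|).
  apply: (le_sq_integrable _ sf); first exact: measurableT_comp sf.1.
  by move=> x; rewrite normr_id.
have := cauchy_schwarz sf' (sq_integrable_cst 1).
rewrite L2norm_cst normr1 mulr1; under eq_Rintegral do rewrite mulr1.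
move=> /(le_trans (ler_norm _))/le_trans; apply.
by rewrite /L2norm; under eq_Rintegral do rewrite real_normK ?num_real//.
Qed.

End square_integrable.

(** * Stationary Markov chains *)

Section kernel_probability.
Context d d' (X : measurableType d) (Y : measurableType d') (R : realType).
Variables (k : R.-pker X ~> Y) (x : X).

Let kx : set Y -> \bar R := k x.
HB.instance Definition _ := Measure.on kx.
Let kx_setT : kx setT = 1%E. Proof. exact: prob_kernel. Qed.
HB.instance Definition _ := @Measure_isProbability.Build _ _ R kx kx_setT.

(** Turns the measure [k x] into a [probability], so that the integration lemmas above apply to each
    kernel measure. *)
Lemma kernel_probability : exists mu : probability Y R,
  (forall f : Y -> R, \int[k x]_y f y = \int[mu]_y f y) /\
  (forall f : Y -> \bar R, \int[k x]_y f y = \int[mu]_y f y)%E.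
Proof. by exists kx. Qed.

End kernel_probability.

Section kernel_operator.
Context dX (X : measurableType dX) (R : realType) (Pt : nat -> R.-pker X ~> X).
Implicit Types (f g : X -> R) (c : R) (t : nat).

Lemma kernel_opD t f g : bounded_mfun f -> bounded_mfun g ->
  kernel_op Pt t (fun x => f x + g x) = (fun x => kernel_op Pt t f x + kernel_op Pt t g x).
Proof.
move=> bf bg; apply/funext => x; rewrite /kernel_op.
by have [mu [muE _]] := kernel_probability (Pt t) x; rewrite !muE prob_intD//; exact: bounded_mfun_integrable.
Qed.

Lemma kernel_opB t f g : bounded_mfun f -> bounded_mfun g ->
  kernel_op Pt t (fun x => f x - g x) = (fun x => kernel_op Pt t f x - kernel_op Pt t g x).
Proof.
move=> bf bg; apply/funext => x; rewrite /kernel_op.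
by have [mu [muE _]] := kernel_probability (Pt t) x; rewrite !muE prob_intB//; exact: bounded_mfun_integrable.
Qed.

Lemma kernel_opZ t c f : bounded_mfun f ->
  kernel_op Pt t (fun x => c * f x) = (fun x => c * kernel_op Pt t f x).
Proof.
move=> bf; apply/funext => x; rewrite /kernel_op.
by have [mu [muE _]] := kernel_probability (Pt t) x; rewrite !muE prob_intZ//; exact: bounded_mfun_integrable.
Qed.

Lemma kernel_op_cst t c : kernel_op Pt t (fun=> c) = (fun=> c).
Proof.
apply/funext => x; rewrite /kernel_op.
by have [mu [muE _]] := kernel_probability (Pt t) x; rewrite !muE prob_int_cst.
Qed.

Lemma kernel_op_bound t f c : bounded_mfun f -> (forall x, `|f x| <= c) ->
  forall x, `|kernel_op Pt t f x| <= c.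
Proof.
move=> bf fc x; rewrite /kernel_op.
by have [mu [muE _]] := kernel_probability (Pt t) x; rewrite muE; exact: prob_int_bound.
Qed.

Lemma kernel_opE t f x : bounded_mfun f ->
  (\int[Pt t x]_y (f y)%:E = (kernel_op Pt t f x)%:E)%E.
Proof.
move=> bf; rewrite /kernel_op.
have [mu [muE muE']] := kernel_probability (Pt t) x; rewrite muE muE' /Rintegral fineK//.
exact: integrable_fin_num (bounded_mfun_integrable mu bf).
Qed.

Lemma kernel_op_indic t A : measurable A ->
  kernel_op Pt t \1_A = (fun x => fine (Pt t x A)).
Proof. by move=> mA; apply/funext => x; rewrite /kernel_op /Rintegral integral_indic// setIT. Qed.

Lemma kernel_op_sqr_le t f : bounded_mfun f ->
  forall x, kernel_op Pt t f x ^+ 2 <= kernel_op Pt t (fun x => f x ^+ 2) x.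
Proof.
move=> bf x; rewrite /kernel_op.
have [mu [muE _]] := kernel_probability (Pt t) x; rewrite !muE.
have := cauchy_schwarz (bounded_mfun_sq mu bf) (sq_integrable_cst mu 1).
rewrite L2norm_cst normr1 mulr1; under eq_Rintegral do rewrite mulr1.
move=> h; rewrite -L2norm_sqr -real_normK ?num_real//.
by rewrite lerXn2r ?nnegrE ?L2norm_ge0.
Qed.

Lemma kernel_op_bounded t f : bounded_mfun f -> bounded_mfun (kernel_op Pt t f).
Proof.
move=> bf; have [mf [B fB]] := bf; split; last first.
  by exists B => x; exact: kernel_op_bound.
(* Measurability of a kernel integral is available for nonnegative integrands; the shift by [B]
   reduces to them, since kernels fix constants. *)
have -> : f = fun x => (f x + B) - B by apply/funext => x; rewrite addrK.
have bc : bounded_mfun (fun _ : X => B) by exact: bounded_mfun_cst.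
rewrite (kernel_opB t (bounded_mfunD bf bc) bc) kernel_op_cst.
apply: measurable_funB => //; apply: measurableT_comp => //.
apply: measurable_fun_integral_kernel.
- by move=> U mU; exact: measurable_kernel.
- by move=> x; rewrite lee_fin -lerBlDr sub0r; have := fB x; rewrite ler_norml => /andP[].
- by apply/measurable_EFinP; exact: measurable_funD.
Qed.

End kernel_operator.

Section markov.
Context d (Omega : measurableType d) dX (X : measurableType dX) (R : realType).
Variables (P : probability Omega R) (Pi : probability X R).
Variables (Pt : nat -> R.-pker X ~> X) (X_ : nat -> {RV P >-> X}).
Hypothesis hX : stationary_markov Pi Pt X_.
Implicit Types (f g : X -> R) (Z : Omega -> R) (s t : nat).

(** With [past] as the sigma-algebra of a type, a variable determined by [X_0, ..., X_s] is just a
    measurable function on [past_type s], and all closure lemmas on [bounded_mfun] serve for adapted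
    variables. *)
Definition past_type s := g_sigma_algebraType
  (\bigcup_(i in [set i | (i <= s)%N]) preimage_set_system setT (X_ i) measurable).

Let mX i B : measurable B -> measurable (X_ i @^-1` B).
Proof.
by move=> mB; rewrite -[X in measurable X]setTI; exact: (@measurable_funP _ _ _ _ setT (X_ i)).
Qed.

Lemma past_measurable s E : past X_ s E -> measurable E.
Proof.
apply: smallest_sub; first exact: sigma_algebra_measurable.
by move=> _ [i _ [B mB <-]]; rewrite setTI; exact: mX.
Qed.

Lemma measurable_past s i : (i <= s)%N ->
  measurable_fun setT (X_ i : past_type s -> X).
Proof.
move=> ilts _ B mB; apply: sub_sigma_algebra; exists i => //.
by exists B.
Qed.

Lemma bounded_past s Z : bounded_mfun (T := past_type s) Z -> bounded_mfun Z.
Proof.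
move=> [mZ bZ]; split => // _ B mB; apply: (@past_measurable s).
exact: mZ.
Qed.

Let bc f s : bounded_mfun f -> bounded_mfun (fun w => f (X_ s w)).
Proof. by move=> bf; apply: bounded_mfun_comp bf _. Qed.

(** Both sides are linear and bounded in [Z] and in [f], so [bounded_functional_eq0], used first in
    [Z] and then in [f], reduces to two indicators, which is [markov_property]. In this form it
    stands in for conditional expectations throughout. *)
Lemma markov_expectation s t Z f : bounded_mfun (T := past_type s) Z ->
  bounded_mfun f ->
  \int[P]_w (Z w * f (X_ (s + t)%N w)) = \int[P]_w (Z w * kernel_op Pt t f (X_ s w)).
Proof.
move=> bZ bf; apply/eqP; rewrite -subr_eq0; apply/eqP.
have bfX := bc (s + t) bf.
have bkX := bc s (kernel_op_bounded Pt t bf).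
pose L (Z : past_type s -> R) :=
  \int[P]_w (Z w * f (X_ (s + t)%N w)) - \int[P]_w (Z w * kernel_op Pt t f (X_ s w)).
have [B fB] := bf.2.
apply: (@bounded_functional_eq0 _ (past_type s) R L (2 * B)) => //.
- move=> Z1 Z2 /bounded_past b1 /bounded_past b2; rewrite /L.
  under eq_Rintegral do rewrite mulrDl.
  under [X in _ - X = _]eq_Rintegral do rewrite mulrDl.
  rewrite !prob_intD; try by apply: bounded_mfun_integrable; exact: bounded_mfunM.
  by rewrite opprD addrACA.
- move=> c Z1 /bounded_past b1; rewrite /L.
  under eq_Rintegral do rewrite -mulrA.
  under [X in _ - X = _]eq_Rintegral do rewrite -mulrA.
  rewrite !prob_intZ; try by apply: bounded_mfun_integrable; exact: bounded_mfunM.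
  by rewrite mulrBr.
- move=> Z1 c /bounded_past b1 Z1c; rewrite /L (le_trans (ler_normB _ _))//.
  rewrite -mulrA mulr_natl mulr2n; apply: lerD; apply: prob_int_bound.
  + exact: bounded_mfunM.
  + by move=> w; rewrite normrM mulrC ler_pM.
  + exact: bounded_mfunM.
  + by move=> w; rewrite normrM mulrC ler_pM// kernel_op_bound.
move=> E pE; rewrite /L {L bZ Z}.
have mE := @past_measurable s E pE.
have bE := @bounded_mfun_indic _ _ R _ mE.
pose L (f : X -> R) :=
  \int[P]_w (\1_E w * f (X_ (s + t)%N w)) - \int[P]_w (\1_E w * kernel_op Pt t f (X_ s w)).
apply: (@bounded_functional_eq0 _ X R L 2) => //.
- move=> f1 f2 b1 b2; rewrite /L kernel_opD//.
  under eq_Rintegral do rewrite mulrDr.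
  under [X in _ - X = _]eq_Rintegral do rewrite mulrDr.
  rewrite !prob_intD; try by apply: bounded_mfun_integrable; apply: bounded_mfunM => //;
    apply: bc => //; exact: kernel_op_bounded.
  by rewrite opprD addrACA.
- move=> c f1 b1; rewrite /L kernel_opZ//.
  under eq_Rintegral do rewrite mulrCA.
  under [X in _ - X = _]eq_Rintegral do rewrite mulrCA.
  rewrite !prob_intZ; try by apply: bounded_mfun_integrable; apply: bounded_mfunM => //;
    apply: bc => //; exact: kernel_op_bounded.
  by rewrite mulrBr.
- move=> f1 c b1 f1c; rewrite /L (le_trans (ler_normB _ _))//.
  have E1 w : `|\1_E w : R| <= 1.
    by rewrite indicE; case: (_ \in _); rewrite ?normr0 ?normr1.
  rewrite mulr_natl mulr2n; apply: lerD; apply: prob_int_bound.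
  + by apply: bounded_mfunM => //; exact: bc.
  + by move=> w; rewrite normrM -[c]mul1r ler_pM.
  + by apply: bounded_mfunM => //; apply: bc; exact: kernel_op_bounded.
  + by move=> w; rewrite normrM -[c]mul1r ler_pM// kernel_op_bound.
move=> A mA; rewrite /L kernel_op_indic//.
apply/eqP; rewrite subr_eq0; apply/eqP.
have mXA : measurable (X_ (s + t)%N @^-1` A) by exact: mX.
transitivity (fine (P (E `&` X_ (s + t)%N @^-1` A))).
  rewrite -prob_int_indic; last exact: measurableI.
  by apply: eq_Rintegral => w _; rewrite indicI.
rewrite (markov_property hX t pE mA) /Rintegral [in LHS]integral_mkcond; congr fine.
apply: eq_integral => w _; rewrite patchE indicE.
case: ifPn => _; last by rewrite mul0r.
by rewrite mul1r fineK// finite_kernel_measure.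
Qed.

(** The law is prescribed at time 0 only; the Markov property from time 0 on the sure event,
    together with invariance, carries it to time [s]. *)
Let law s A : measurable A -> distribution P (X_ s) A = Pi A.
Proof.
move=> mA; rewrite -(invariant_Pi hX s mA) /distribution/= /pushforward.
have pT : past X_ 0 setT by exact: (@measurableT _ (past_type 0)).
have := markov_property hX s pT mA; rewrite setTI add0n => ->.
transitivity (\int[distribution P (X_ 0%N)]_x Pt s x A)%E.
  by rewrite ge0_integral_distribution//; exact: measurable_kernel.
by apply: eq_measure_integral => B mB _; exact: (initial_law hX mB).
Qed.

Lemma stationary_integrable s f : Pi.-integrable setT (EFin \o f) ->
  P.-integrable setT (EFin \o (fun w => f (X_ s w))).
Proof.
move=> fi; have mf := measurable_int _ fi.
apply/integrableP; split.
  by apply: (measurableT_comp mf); exact: (@measurable_funP _ _ _ _ setT (X_ s)).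
have <- : (\int[distribution P (X_ s)]_x (abse \o (EFin \o f)) x =
    \int[P]_w `|(EFin \o (fun w => f (X_ s w))) w|)%E.
  rewrite ge0_integral_distribution//; first exact: (measurableT_comp _ mf).
  by move=> x; exact: abse_ge0.
have -> : (\int[distribution P (X_ s)]_x (abse \o (EFin \o f)) x =
    \int[Pi]_x (abse \o (EFin \o f)) x)%E.
  by apply: eq_measure_integral => A mA _; exact: law.
by have /integrableP[] := fi.
Qed.

Lemma stationary_expectation s f : Pi.-integrable setT (EFin \o f) ->
  \int[P]_w f (X_ s w) = \int[Pi]_x f x.
Proof.
move=> fi; have mf := measurable_int _ fi.
rewrite /Rintegral; congr fine.
transitivity (\int[distribution P (X_ s)]_x (EFin \o f) x)%E.
  by rewrite integral_distribution//; exact: stationary_integrable.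
by apply: eq_measure_integral => A mA _; exact: law.
Qed.

Lemma stationary_sq_integrable s f : sq_integrable Pi f ->
  sq_integrable P (fun w => f (X_ s w)).
Proof.
move=> [mf fi]; split; first by apply: measurableT_comp.
by have := stationary_integrable s fi.
Qed.

Lemma stationary_L2norm s f : sq_integrable Pi f ->
  L2norm P (fun w => f (X_ s w)) = L2norm Pi f.
Proof.
by move=> [mf fi]; rewrite /L2norm (stationary_expectation s fi).
Qed.

Lemma kernel_op_expectation t f : bounded_mfun f ->
  \int[Pi]_x kernel_op Pt t f x = \int[Pi]_x f x.
Proof.
move=> bf.
rewrite -(stationary_expectation 0); last by apply: bounded_mfun_integrable; exact: kernel_op_bounded.
rewrite -(stationary_expectation (0 + t)); last exact: bounded_mfun_integrable.
have := @markov_expectation 0 t (fun=> 1) f (@bounded_mfun_cst _ _ _ _) bf.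
under eq_Rintegral do rewrite mul1r.
by under [X in _ = X -> _]eq_Rintegral do rewrite mul1r.
Qed.

(** Jensen's inequality [kernel_op_sqr_le], integrated against the invariant measure. *)
Lemma kernel_op_L2norm t f : bounded_mfun f ->
  L2norm Pi (kernel_op Pt t f) <= L2norm Pi f.
Proof.
move=> bf; apply: L2norm_le; first exact: L2norm_ge0.
rewrite L2norm_sqr -[leRHS](kernel_op_expectation t); last exact: bounded_mfunX.
apply: prob_int_le => [||x]; last exact: kernel_op_sqr_le.
  apply: bounded_mfun_integrable; apply: bounded_mfunX; exact: kernel_op_bounded.
apply: bounded_mfun_integrable; apply: kernel_op_bounded; exact: bounded_mfunX.
Qed.

Let bounded_Lfun f : bounded_mfun f -> f \in Lfun Pi 2%:E.
Proof.
move=> bf; have [mf [B fB]] := bf.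
rewrite inE; apply/andP; split; rewrite inE//= /finite_norm unlock poweR_lty//.
have [_ fi] := bounded_mfun_sq Pi bf.
have /integrableP[_] := fi; apply: le_lt_trans.
rewrite le_eqVlt; apply/orP; left; apply/eqP; apply: eq_integral => x _ /=.
by congr EFin; rewrite powR_mulrn// normrX.
Qed.

Lemma ae_sq_integral0 f : bounded_mfun f -> {ae Pi, forall x, f x = 0} ->
  \int[Pi]_x (f x ^+ 2) = 0.
Proof.
move=> bf f0; rewrite -(prob_int_cst Pi 0); congr fine.
apply: ae_eq_integral => //.
- by apply/measurable_EFinP; apply: measurable_funX; exact: bf.1.
- by apply: filterS f0 => x fx _; rewrite fx expr0n.
Qed.

(** The semigroup laws hold only almost everywhere; as null squared distances they can be absorbed
    by the triangle inequality for [L2norm]. *)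
Lemma kernel_op0_sq f : bounded_mfun f ->
  \int[Pi]_x ((kernel_op Pt 0 f x - f x) ^+ 2) = 0.
Proof.
move=> bf; apply: ae_sq_integral0.
  by apply: bounded_mfunB => //; exact: kernel_op_bounded.
by apply: filterS (semigroup0 hX (bounded_Lfun bf)) => x ->; rewrite subrr.
Qed.

Lemma kernel_opS_sq s t f : bounded_mfun f ->
  \int[Pi]_x ((kernel_op Pt s (kernel_op Pt t f) x - kernel_op Pt (s + t) f x) ^+ 2) = 0.
Proof.
move=> bf; apply: ae_sq_integral0.
  by apply: bounded_mfunB; do !apply: kernel_op_bounded.
by apply: filterS (semigroupD hX s t (bounded_Lfun bf)) => x ->; rewrite subrr.
Qed.

Lemma kernel_opS_L2norm s t f : bounded_mfun f ->
  L2norm Pi (kernel_op Pt s (kernel_op Pt t f)) = L2norm Pi (kernel_op Pt (s + t) f).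
Proof.
move=> bf.
have b1 := kernel_op_bounded Pt s (kernel_op_bounded Pt t bf).
have b2 := kernel_op_bounded Pt (s + t) bf.
apply/eqP; rewrite -subr_eq0 -normr_le0.
apply: le_trans (L2norm_dist (bounded_mfun_sq Pi b1) (bounded_mfun_sq Pi b2)) _.
by rewrite /L2norm kernel_opS_sq// sqrtr0.
Qed.

End markov.

(** * Central limit theorem for bounded martingale increments *)

Section heat_measurable.
Context {R : realType} (z v : R).
Hypothesis v0 : 0 < v.

Let cont_meas (f df : R -> R) : (forall x : R, is_derive x 1 f (df x)) ->
  measurable_fun setT f.
Proof.
move=> fdf; apply: continuous_measurable_fun => x.
apply: differentiable_continuous; apply/derivable1_diffP.
exact: (@ex_derive _ _ _ _ _ _ _ (fdf x)).
Qed.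

Lemma measurable_heat0 : measurable_fun setT (heat0 z v).
Proof. exact: cont_meas (is_derive_heat0 z v). Qed.

Lemma measurable_heat1 : measurable_fun setT (heat1 z v).
Proof. exact: cont_meas (fun x => is_derive_heat1 z x v0). Qed.

Lemma measurable_heat2 : measurable_fun setT (heat2 z v).
Proof. exact: cont_meas (fun x => is_derive_heat2 z x v0). Qed.

End heat_measurable.

Section heat_step.
Context {R : realType} (z e : R) (e0 : 0 < e).

(* In a Lindeberg step the space increment [b] is compensated by the time
   decrement [h]. *)
Lemma heat_step : exists2 C : R, 0 <= C &
  forall v x b h, e <= v -> 0 <= h ->
  [/\ `|heat0 z (v + h) x| <= 1, `|heat1 z v x| <= C, `|heat2 z v x| <= C,
    `|heat0 z v (x + b) - heat0 z (v + h) x - heat1 z v x * b -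
      2^-1 * heat2 z (v + h) x * (b ^+ 2 - h)| <=
      C * (`|b| ^+ 3 + h ^+ 2 + h * (b ^+ 2 + h)) &
    `|heat2 z v (x + b) - heat2 z (v + h) x| <= C * (`|b| + h)].
Proof.
have [C C0 bounds] := heat_bounds z e0.
exists C => // v x b h ev h0.
have [[h1 h2 _ h2x h03] vbd] := bounds v ev.
have [h2v h0v] := vbd x h h0.
split; [|exact: h1|exact: h2| |].
- by rewrite ger0_norm ?ncdf_ge0// ncdf_le1.
- have := h03 x b; have := h0v; have := h2v.
  set A := heat0 z v (x + b); set B := heat0 z (v + h) x; set A0 := heat0 z v x.
  set D := heat1 z v x; set S := heat2 z v x; set S' := heat2 z (v + h) x.
  move=> k1 k2 k3.
  have -> : A - B - D * b - 2^-1 * S' * (b ^+ 2 - h) =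
    (A - A0 - D * b - 2^-1 * S * b ^+ 2) - (B - A0 - 2^-1 * S * h) +
    - (2^-1 * (S' - S) * (b ^+ 2 - h)) by ring.
  rewrite (le_trans (ler_normD _ _))// [leRHS]mulrDr; apply: lerD.
    by rewrite (le_trans (ler_normB _ _))// [leRHS]mulrDr lerD.
  rewrite normrN !normrM [`|2^-1|]ger0_norm ?invr_ge0//.
  have b2 : `|b ^+ 2 - h| <= b ^+ 2 + h.
    by rewrite (le_trans (ler_normB _ _))// !ger0_norm ?sqr_ge0.
  have := ler_pM (normr_ge0 _) (normr_ge0 _) k1 b2.
  have : 0 <= `|S' - S| * `|b ^+ 2 - h| by rewrite mulr_ge0.
  by rewrite -!mulrA; move: (`|S' - S| * _) => w w0 wC; lra.
- have := h2x x b; have := h2v.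
  move=> k1 k2.
  rewrite (_ : heat2 z v (x + b) - _ = (heat2 z v (x + b) - heat2 z v x) -
     (heat2 z (v + h) x - heat2 z v x)); last by ring.
  by rewrite (le_trans (ler_normB _ _))// [leRHS]mulrDr lerD.
Qed.

End heat_step.

Section martingale.
Context d (Omega : measurableType d) dX (X : measurableType dX) (R : realType).
Variables (P : probability Omega R) (Pi : probability X R).
Variables (Pt : nat -> R.-pker X ~> X) (X_ : nat -> {RV P >-> X}).
Hypothesis hX : stationary_markov Pi Pt X_.

Definition coboundary_dense := forall h : X -> R, bounded_mfun h ->
  forall dl : R, 0 < dl -> exists2 q : X -> R, bounded_mfun q &
  \int[Pi]_x `|h x - \int[Pi]_y h y - (q x - kernel_op Pt 1 q x)| <= dl.

Variable g : X -> R.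
Hypothesis bg : bounded_mfun g.
Let Q := kernel_op Pt 1 g.
Let bQ : bounded_mfun Q. Proof. exact: kernel_op_bounded. Qed.

Definition increment i (w : Omega) : R := g (X_ i.+1 w) - kernel_op Pt 1 g (X_ i w).
Definition martingale n (w : Omega) : R := \sum_(i < n) increment i w.
Definition cond_variance (x : X) : R :=
  kernel_op Pt 1 (fun y => g y ^+ 2) x - kernel_op Pt 1 g x ^+ 2.
Definition increment_variance : R := \int[Pi]_x cond_variance x.

Let D := increment.
Let M := martingale.
Let h := cond_variance.
Let sig2 := increment_variance.

Lemma bounded_cond_variance : bounded_mfun cond_variance.
Proof.
apply: bounded_mfunB; last by apply: bounded_mfunX; exact: bQ.
by apply: kernel_op_bounded; exact: bounded_mfunX.
Qed.
Let bh := bounded_cond_variance.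

Let bpast s i (f : X -> R) : (i <= s)%N -> bounded_mfun f ->
  @bounded_mfun _ (past_type X_ s) R (fun w => f (X_ i w)).
Proof. by move=> si bf; apply: (bounded_mfun_comp bf); exact: measurable_past. Qed.

Let bfull i (f : X -> R) : bounded_mfun f -> bounded_mfun (fun w => f (X_ i w)).
Proof. by move=> bf; apply: bounded_mfun_comp bf _. Qed.

Lemma bounded_increment s i : (i < s)%N ->
  @bounded_mfun _ (past_type X_ s) R (D i).
Proof.
move=> lt_is; apply: bounded_mfunB; first exact: bpast.
by apply: bpast bQ; exact: ltnW.
Qed.

Let bD i : bounded_mfun (D i).
Proof. exact: bounded_past (bounded_increment (ltnSn i)). Qed.

Lemma bounded_martingale s n : (n <= s)%N ->
  @bounded_mfun _ (past_type X_ s) R (M n).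
Proof.
elim: n => [_|n ih ns].
  rewrite (_ : M 0 = fun=> 0); first exact: bounded_mfun_cst.
  by apply/funext => w; rewrite /M /martingale big_ord0.
rewrite (_ : M n.+1 = fun w => M n w + D n w).
  apply: bounded_mfunD; [exact: ih (ltnW ns)|exact: bounded_increment].
by apply/funext => w; rewrite /M /martingale big_ord_recr.
Qed.

(** The martingale property, tested against bounded variables of the past. *)
Lemma increment_mean s (Z : Omega -> R) : @bounded_mfun _ (past_type X_ s) R Z ->
  \int[P]_w (Z w * D s w) = 0.
Proof.
move=> bZ; have bZ' := bounded_past bZ.
under eq_Rintegral do rewrite mulrBr.
rewrite prob_intB; last 2 first.
- by apply: bounded_mfun_integrable; apply: bounded_mfunM => //; exact: bfull.
- by apply: bounded_mfun_integrable; apply: bounded_mfunM => //; exact: bfull.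
by have := markov_expectation hX 1 bZ bg; rewrite addn1 => ->; rewrite subrr.
Qed.

Lemma increment_sqr s (Z : Omega -> R) : @bounded_mfun _ (past_type X_ s) R Z ->
  \int[P]_w (Z w * D s w ^+ 2) = \int[P]_w (Z w * h (X_ s w)).
Proof.
move=> bZ; have bZ' := bounded_past bZ.
have bQX : @bounded_mfun _ (past_type X_ s) R (fun w => Q (X_ s w)) by exact: bpast.
have bQX' := bounded_past bQX.
have bg2 := bounded_mfunX 2 bg.
have b1 : bounded_mfun (fun w => Z w * g (X_ s.+1 w) ^+ 2).
  by apply: bounded_mfunM => //; exact: (bfull s.+1 bg2).
have b2 : bounded_mfun (fun w => Z w * Q (X_ s w) * g (X_ s.+1 w)).
  by apply: bounded_mfunM; [exact: bounded_mfunM|exact: bfull].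
have b2' : bounded_mfun (fun w => 2 * (Z w * Q (X_ s w) * g (X_ s.+1 w))).
  exact: bounded_mfunZ.
have b3 : bounded_mfun (fun w => Z w * Q (X_ s w) ^+ 2).
  by apply: bounded_mfunM => //; exact: (bfull s (bounded_mfunX 2 bQ)).
have b4 : bounded_mfun (fun w => Z w * kernel_op Pt 1 (fun y => g y ^+ 2) (X_ s w)).
  by apply: bounded_mfunM => //; exact: (bfull s (kernel_op_bounded Pt 1 bg2)).
have E1 := markov_expectation hX 1 bZ bg2.
(* In the cross term [Q (X_ s)] belongs to the past and joins the test variable [Z]. *)
have E2 := markov_expectation hX 1 (bounded_mfunM bZ bQX) bg.
rewrite addn1 in E1 E2.
transitivity (\int[P]_w (Z w * g (X_ s.+1 w) ^+ 2 -
    2 * (Z w * Q (X_ s w) * g (X_ s.+1 w)) + Z w * Q (X_ s w) ^+ 2)).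
  by apply: eq_Rintegral => w _; rewrite /D /increment /Q; ring.
rewrite prob_intD ?prob_intB ?prob_intZ; try by apply: bounded_mfun_integrable => //; exact: bounded_mfunB.
rewrite E1 E2.
transitivity (\int[P]_w (Z w * kernel_op Pt 1 (fun y => g y ^+ 2) (X_ s w)) -
   \int[P]_w (Z w * Q (X_ s w) ^+ 2)).
  have -> : \int[P]_w (Z w * Q (X_ s w) * kernel_op Pt 1 g (X_ s w)) =
    \int[P]_w (Z w * Q (X_ s w) ^+ 2).
    by apply: eq_Rintegral => w _; rewrite /Q expr2 mulrA.
  by ring.
rewrite -prob_intB; try exact: bounded_mfun_integrable.
by apply: eq_Rintegral => w _; rewrite /h /cond_variance mulrBr.
Qed.

Lemma increment_varianceE i : sig2 = \int[P]_w (D i w ^+ 2).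
Proof.
have := increment_sqr (@bounded_mfun_cst _ (past_type X_ i) R 1).
under eq_Rintegral do rewrite mul1r.
under [X in _ = X -> _]eq_Rintegral do rewrite mul1r.
by rewrite (stationary_expectation hX i (bounded_mfun_integrable Pi bh)) => ->.
Qed.

Lemma increment_variance_ge0 : 0 <= sig2.
Proof.
by rewrite (increment_varianceE 0); apply: Rintegral_ge0 => w _; exact: sqr_ge0.
Qed.

Lemma martingale_variance n : \int[P]_w (M n w ^+ 2) = sig2 * n%:R.
Proof.
elim: n => [|n ih].
  rewrite mulr0 -[RHS](prob_int_cst P); apply: eq_Rintegral => w _.
  by rewrite /M /martingale big_ord0 expr0n.
have bM := bounded_martingale (leqnn n); have bM' := bounded_past bM.
transitivity (\int[P]_w (M n w ^+ 2 + (2 * M n w * D n w + D n w ^+ 2))).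
  by apply: eq_Rintegral => w _; rewrite /M /martingale big_ord_recr/= -/D; ring.
have b1 : bounded_mfun (fun w => M n w ^+ 2) by exact: bounded_mfunX.
have b2 : bounded_mfun (fun w => 2 * M n w * D n w).
  by apply: bounded_mfunM => //; exact: bounded_mfunZ.
have b3 : bounded_mfun (fun w => D n w ^+ 2) by exact: bounded_mfunX.
rewrite !prob_intD; try apply: bounded_mfun_integrable => //; last exact: bounded_mfunD.
rewrite ih (increment_mean (bounded_mfunZ 2 bM)) -increment_varianceE.
by rewrite add0r -natr1 mulrDr mulr1.
Qed.

End martingale.

Section martingale_clt.
Context d (Omega : measurableType d) dX (X : measurableType dX) (R : realType).
Variables (P : probability Omega R) (Pi : probability X R).
Variables (Pt : nat -> R.-pker X ~> X) (X_ : nat -> {RV P >-> X}).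
Hypothesis hX : stationary_markov Pi Pt X_.
Hypothesis dense : coboundary_dense Pi Pt.
Variable g : X -> R.
Hypothesis bg : bounded_mfun g.

Let D := increment Pt X_ g.
Let M := martingale Pt X_ g.
Let h := cond_variance Pt g.
Let s : R := increment_variance Pi Pt g.
Let s0 : 0 <= s. Proof. exact: (increment_variance_ge0 hX bg). Qed.
Let bh : bounded_mfun h. Proof. exact: bounded_cond_variance. Qed.

Let bfull i (f : X -> R) : bounded_mfun f -> bounded_mfun (fun w => f (X_ i w)).
Proof. by move=> bf; apply: bounded_mfun_comp bf _. Qed.

Let bint (f : Omega -> R) : bounded_mfun f -> P.-integrable setT (EFin \o f).
Proof. exact: bounded_mfun_integrable. Qed.

Section rate.
Variables (z e : R) (e0 : 0 < e).

(** The expectation of [heat0] is followed along the path that starts at variance [e + s] and value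
    0 and ends at variance [e] and value [c * M n], each increment of the martingale being paid for
    by a decrease [s / n] of the variance. The quantifiers matter: [C] precedes [dl], while [C']
    depends on the sup norm of the function [q] attached to [dl], so [dl] can be fixed before [n] is
    sent to infinity. *)
Lemma martingale_clt_bound : exists2 C : R, 0 <= C & forall dl : R, 0 < dl ->
  exists C' : R, forall n, (0 < n)%N ->
  `|\int[P]_w heat0 z e ((Num.sqrt n%:R)^-1 * M n w) - heat0 z (e + s) 0| <=
    C * dl + C' * (Num.sqrt n%:R)^-1.
Proof.
(* These identities are stated on plain variables to keep integrals and heat functions out of
   [ring]. *)
have alg1 (a1 a0 k I0 y0 y1 J0 : R) : a1 - a0 - 2^-1 * k * (y0 - y1) =
    (a1 - a0 - 2^-1 * k * I0) + 2^-1 * k * ((I0 - (y0 - J0)) + (y1 - J0)) by ring.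
have alg2 (u k H0 D0 Z0 t : R) : u - k * (H0 * D0) -
    2^-1 * k ^+ 2 * (Z0 * D0 ^+ 2 - Z0 * t) =
    u - H0 * (k * D0) - 2^-1 * Z0 * ((k * D0) ^+ 2 - t * k ^+ 2) by ring.
have alg3 (a2 a1 a0 k y2 y1 y0 : R) : a2 - a0 - k * (y0 - y2) =
    (a1 - a0 - k * (y0 - y1)) + (a2 - a1 - k * (y1 - y2)) by ring.
have alg4 (a1 a0 k y1 y0 : R) : a1 - a0 =
    (a1 - a0 - 2^-1 * k ^+ 2 * (y0 - y1)) + k * (2^-1 * k * (y0 - y1)) by ring.
have [C C0 step] := heat_step z e0.
exists C => // dl dl0.
have [B gB] := bg.2.
have DK i w : `|D i w| <= 2 * B.
  rewrite (le_trans (ler_normB _ _))// mulr_natl mulr2n lerD//.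
  exact: kernel_op_bound.
have [q bq qdl] := dense bh dl0.
have [Bq qB] := bq.2.
set K := 2 * B in DK.
have K0 : 0 <= K by apply: le_trans (DK 0 point).
have Bq0 : 0 <= Bq by apply: le_trans (qB point).
pose C1 := C * (K ^+ 3 + s ^+ 2 + s * (K ^+ 2 + s)).
have C10 : 0 <= C1.
  by do ![apply: mulr_ge0 => //|apply: addr_ge0 => //|apply: exprn_ge0 => //].
(* The three terms pay for the Lindeberg remainders, for the replacement of [Z i] by [Z i.+1] in the
   summation by parts, and for its boundary terms. *)
exists (C1 + 2^-1 * (C * (K + s) * Bq) + C * Bq) => n n0.
set c := (Num.sqrt n%:R)^-1.
have sn0 : 0 < Num.sqrt n%:R :> R by rewrite sqrtr_gt0 ltr0n.
have c0 : 0 < c by rewrite invr_gt0.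
have c1 : c <= 1.
  rewrite invf_le1// -[leLHS]sqrtr1 ler_wsqrtr// ler1n//.
have c2 : c ^+ 2 * n%:R = 1.
  by rewrite /c exprVn sqr_sqrtr ?ler0n// mulVf// pnatr_eq0 -lt0n.
pose hh := s * c ^+ 2.
have hh0 : 0 <= hh by rewrite mulr_ge0// exprn_ge0// ltW.
(* The variance left after [i] steps: [v 0 = e + s] because [c ^+ 2 * n = 1], and [v n = e]. *)
pose v i := e + hh * (n - i)%:R.
have ev i : e <= v i by rewrite lerDl mulr_ge0.
have v0 i : 0 < v i := lt_le_trans e0 (ev i).
have vS i : (i < n)%N -> v i = v i.+1 + hh.
  by move=> ltin; rewrite /v -addrA -[X in _ = _ + (_ + X)]mulr1 -mulrDr natr1 subnSK.
pose U i w := heat0 z (v i) (c * M i w).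
(* [H] is taken at [v i.+1] but [Z] at [v i], as in the expansion of [heat_step]: the second-order
   coefficients at successive steps then belong to one sequence [Z], as summation by parts
   requires. *)
pose H i w := heat1 z (v i.+1) (c * M i w).
pose Z i w := heat2 z (v i) (c * M i w).
have bcM i j : (i <= j)%N -> @bounded_mfun _ (past_type X_ j) R (fun w => c * M i w).
  by move=> ij; apply: bounded_mfunZ; exact: bounded_martingale.
have Z_C i w : `|Z i w| <= C.
  by have [_ _ hC _ _] := step (v i) (c * M i w) 0 0 (ev i) (lexx 0).
have bU i : bounded_mfun (U i).
  split.
    by apply: measurableT_comp; [exact: measurable_heat0|exact: (bounded_past (bcM i i (leqnn i))).1].
  by exists 1 => w; rewrite ger0_norm ?ncdf_ge0// ncdf_le1.
have pH i : @bounded_mfun _ (past_type X_ i) R (H i).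
  split.
    by apply: measurableT_comp; [exact: measurable_heat1|exact: (bcM i i (leqnn i)).1].
  by exists C => w; have [_ hC _ _ _] := step (v i.+1) (c * M i w) 0 0 (ev i.+1) (lexx 0).
have pZ i j : (i <= j)%N -> @bounded_mfun _ (past_type X_ j) R (Z i).
  move=> ij; split.
    by apply: measurableT_comp; [exact: measurable_heat2|exact: (bcM i j ij).1].
  by exists C => w; exact: Z_C.
have bH i : bounded_mfun (H i) := bounded_past (pH i).
have bZ i : bounded_mfun (Z i) := bounded_past (pZ i i (leqnn i)).
have bD i : bounded_mfun (D i).
  exact: bounded_past (bounded_increment Pt X_ bg (ltnSn i)).
have bqX i := bfull i bq.
have bPq := kernel_op_bounded Pt 1 bq.
pose a i := \int[P]_w U i w.
pose y i := \int[P]_w (Z i w * q (X_ i w)).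
pose E := c * C1 + 2^-1 * (C * dl) + 2^-1 * (C * (c * (K + s)) * Bq).
have stepE i : (i < n)%N ->
    `|a i.+1 - a i - 2^-1 * c ^+ 2 * (y i - y i.+1)| <= c ^+ 2 * E.
  move=> ltin.
  have MS w : c * M i.+1 w = c * M i w + c * D i w.
    by rewrite /M /martingale big_ord_recr/= mulrDr.
  pose I := \int[P]_w (Z i w * (h (X_ i w) - s)).
  pose J := \int[P]_w (Z i w * q (X_ i.+1 w)).
  (* Lindeberg step: the first-order term has mean 0, in the second-order term [D i w ^+ 2] may be
     replaced by [h (X_ i w)], and the remainder is of order [c ^+ 3]. *)
  have T1 : `|a i.+1 - a i - 2^-1 * c ^+ 2 * I| <= c ^+ 2 * (c * C1).
    have bf1 : bounded_mfun (fun w => U i.+1 w - U i w - c * (H i w * D i w)).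
      by do !apply: bounded_mfunB => //; apply: bounded_mfunZ; exact: bounded_mfunM.
    have bZs : bounded_mfun (fun w => Z i w * s).
      by apply: bounded_mfunM => //; exact: bounded_mfun_cst.
    have bZD : bounded_mfun (fun w => Z i w * D i w ^+ 2).
      by apply: bounded_mfunM => //; exact: bounded_mfunX.
    have bZh : bounded_mfun (fun w => Z i w * h (X_ i w)).
      by apply: bounded_mfunM => //; exact: bfull.
    have bHD : bounded_mfun (fun w => H i w * D i w) by exact: bounded_mfunM.
    have bUU : bounded_mfun (fun w => U i.+1 w - U i w) by exact: bounded_mfunB.
    have bZDs : bounded_mfun (fun w => Z i w * D i w ^+ 2 - Z i w * s) by exact: bounded_mfunB.
    have IE : I = \int[P]_w (Z i w * h (X_ i w)) - \int[P]_w (Z i w * s).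
      rewrite -prob_intB; try exact: bint.
      by apply: eq_Rintegral => w _; rewrite mulrBr.
    have -> : a i.+1 - a i - 2^-1 * c ^+ 2 * I = \int[P]_w (U i.+1 w - U i w -
        c * (H i w * D i w) - 2^-1 * c ^+ 2 * (Z i w * D i w ^+ 2 - Z i w * s)).
      rewrite !prob_intB ?prob_intZ ?prob_intB; try apply: bint => //; do ?exact: bounded_mfunZ.
      rewrite (increment_mean hX bg (pH i)) (increment_sqr hX bg (pZ i i (leqnn i))).
      by rewrite mulr0 subr0 IE.
    apply: prob_int_bound; first by apply: bounded_mfunB => //; exact: bounded_mfunZ.
    move=> w; have [_ _ _ + _] := step (v i.+1) (c * M i w) (c * D i w) hh (ev _) hh0.
    rewrite -vS// -MS -/(U i.+1 w) -/(U i w) -/(H i w) -/(Z i w) => le1.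
    rewrite alg2 -/hh.
    apply: (le_trans le1).
    have cD : `|c * D i w| <= c * K by rewrite normrM gtr0_norm// ler_wpM2l// ltW.
    have cK0 : 0 <= c * K by rewrite mulr_ge0// ltW.
    have cD3 : `|c * D i w| ^+ 3 <= (c * K) ^+ 3.
      by rewrite lerXn2r ?nnegrE.
    have cD2 : (c * D i w) ^+ 2 <= (c * K) ^+ 2.
      by rewrite -real_normK ?num_real// lerXn2r ?nnegrE.
    have cc : c ^+ 4 <= c ^+ 3 by rewrite ler_wiXn2l// ltW.
    apply: (le_trans (y := C * ((c * K) ^+ 3 + hh ^+ 2 + hh * ((c * K) ^+ 2 + hh)))).
      by rewrite ler_wpM2l// !lerD// ler_wpM2l// lerD.
    rewrite (_ : c ^+ 2 * (c * C1) = C * (c ^+ 3 * (K ^+ 3 + s ^+ 2 + s * (K ^+ 2 + s)))); last by rewrite /C1; ring.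
    rewrite ler_wpM2l//.
    rewrite (_ : _ + _ = c ^+ 3 * K ^+ 3 + c ^+ 4 * (s ^+ 2 + s * (K ^+ 2 + s))); last by rewrite /hh; ring.
    rewrite -addrA [leRHS]mulrDr lerD2l ler_wpM2r//.
    by do ![apply: mulr_ge0 => //|apply: addr_ge0 => //|apply: exprn_ge0 => //].
  (* [h - s] is replaced by [q - P_1 q] at an L_1 cost of [dl]; as [Z i] depends on the past only,
     [P_1 q] at [X_ i] integrates like [q] at [X_ i.+1]. *)
  have T2 : `|I - (y i - J)| <= C * dl.
    have -> : J = \int[P]_w (Z i w * kernel_op Pt 1 q (X_ i w)).
      by have := markov_expectation hX 1 (pZ i i (leqnn i)) bq; rewrite addn1.
    pose r x := h x - \int[Pi]_y h y - (q x - kernel_op Pt 1 q x).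
    have br : bounded_mfun r.
      by do !apply: bounded_mfunB => //; exact: bounded_mfun_cst.
    have brX := bfull i br.
    have -> : I - (y i - \int[P]_w (Z i w * kernel_op Pt 1 q (X_ i w))) =
        \int[P]_w (Z i w * r (X_ i w)).
      have b1 : bounded_mfun (fun w => Z i w * (h (X_ i w) - s)).
        apply: bounded_mfunM => //; apply: bounded_mfunB; last exact: bounded_mfun_cst.
        exact: bfull.
      have b2 : bounded_mfun (fun w => Z i w * q (X_ i w)) by exact: bounded_mfunM.
      have b3 : bounded_mfun (fun w => Z i w * kernel_op Pt 1 q (X_ i w)).
        by apply: bounded_mfunM => //; exact: (bfull i bPq).
      rewrite -!prob_intB; try apply: bint => //; last exact: bounded_mfunB.
      by apply: eq_Rintegral => w _; rewrite /r (_ : \int[Pi]_y h y = s)//; ring.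
    have bZr : bounded_mfun (fun w => Z i w * r (X_ i w)) by exact: bounded_mfunM.
    have bnr := bounded_mfun_norm br.
    apply: (le_trans (prob_int_norm (bint bZr))).
    apply: (le_trans (y := \int[P]_w (C * `|r (X_ i w)|))).
      apply: prob_int_le; [by apply: bint; exact: bounded_mfun_norm| |].
        by apply: bint; apply: bounded_mfunZ; exact: (bfull i bnr).
      by move=> w; rewrite normrM ler_wpM2r.
    rewrite prob_intZ; last by apply: bint; exact: (bfull i bnr).
    rewrite ler_wpM2l//.
    by rewrite (stationary_expectation hX i (bounded_mfun_integrable Pi bnr)).
  (* Moving the weight from [Z i] to [Z i.+1] costs one increment of [heat2], of order [c]; after
     that [y i - y i.+1] telescopes. *)
  have T3 : `|y i.+1 - J| <= C * (c * (K + s)) * Bq.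
    have b1 : bounded_mfun (fun w => Z i.+1 w * q (X_ i.+1 w)) by exact: bounded_mfunM.
    have b2 : bounded_mfun (fun w => Z i w * q (X_ i.+1 w)) by exact: bounded_mfunM.
    rewrite -prob_intB; try exact: bint.
    apply: prob_int_bound; first exact: bounded_mfunB.
    move=> w; rewrite -mulrBl normrM ler_pM//.
    have [_ _ _ _] := step (v i.+1) (c * M i w) (c * D i w) hh (ev _) hh0.
    rewrite -vS// -MS -/(Z i.+1 w) -/(Z i w) => /le_trans; apply.
    rewrite ler_wpM2l// [leRHS]mulrDr lerD//; first by rewrite normrM gtr0_norm// ler_wpM2l// ltW.
    by rewrite /hh mulrC ler_wpM2r// expr2 ler_piMr// ltW.
  rewrite (alg1 _ _ _ I _ _ J).
  rewrite (le_trans (ler_normD _ _))// /E -[X in _ <= _ * X]addrA [leRHS]mulrDr lerD//.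
  have c20 : 0 <= c ^+ 2 by rewrite exprn_ge0// ltW.
  rewrite normrM ger0_norm; last by rewrite mulr_ge0 ?invr_ge0.
  rewrite -[leLHS]mulrA [leLHS]mulrCA ler_wpM2l// -mulrDr ler_wpM2l ?invr_ge0//.
  by rewrite (le_trans (ler_normD _ _))// lerD.
have sumE k : (k <= n)%N ->
    `|a k - a 0 - 2^-1 * c ^+ 2 * (y 0 - y k)| <= k%:R * (c ^+ 2 * E).
  elim: k => [_|k ih kn]; first by rewrite !subrr mulr0 subr0 normr0 mul0r.
  rewrite (alg3 _ (a k) _ _ _ (y k)).
  rewrite (le_trans (ler_normD _ _))// -[k.+1%:R]natr1 mulrDl mul1r lerD//.
    exact: ih (ltnW kn).
  exact: stepE.
have yC k : `|y k| <= C * Bq.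
  apply: prob_int_bound; first exact: bounded_mfunM.
  by move=> w; rewrite normrM ler_pM.
have -> : \int[P]_w heat0 z e (c * M n w) = a n.
  by apply: eq_Rintegral => w _; rewrite /U /v subnn mulr0 addr0.
have -> : heat0 z (e + s) 0 = a 0.
  rewrite -[LHS](prob_int_cst P); apply: eq_Rintegral => w _.
  rewrite /U /v subn0 /hh -mulrA c2 mulr1 /M /martingale big_ord0 mulr0//.
have := sumE n (leqnn n); rewrite mulrA [n%:R * _]mulrC c2 mul1r => le1.
(* The boundary terms carry a factor [c ^+ 2]; since [c <= 1], one [c] may be dropped. *)
rewrite (alg4 _ _ c (y n) (y 0)).
rewrite (le_trans (ler_normD _ _))//.
have le2 : `|c * (2^-1 * c * (y 0 - y n))| <= c * (C * Bq).
  rewrite normrM (gtr0_norm c0) ler_wpM2l ?(ltW c0)// -mulrA normrM ger0_norm ?invr_ge0//.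
  rewrite normrM (gtr0_norm c0).
  have : c * `|y 0 - y n| <= 1 * (C * Bq + C * Bq).
    by rewrite ler_pM ?(ltW c0)// (le_trans (ler_normB _ _))// lerD.
  by move: (c * `|_|) => w; lra.
apply: le_trans (lerD le1 le2) _; rewrite /E.
have : 0 <= C * dl by rewrite mulr_ge0// ltW.
by move: (C * dl) => w w0; nra.
Qed.

End rate.
End martingale_clt.

(** * Density of coboundaries *)

Lemma bounded_convergence d (T : measurableType d) (R : realType)
    (mu : probability T R) (F : nat -> T -> R) (f : T -> R) (B : R) :
  (forall n, measurable_fun setT (F n)) -> (forall n x, `|F n x| <= B) ->
  measurable_fun setT f -> (forall x, F n x @[n --> \oo] --> f x) ->
  \int[mu]_x `|F n x - f x| @[n --> \oo] --> (0 : R).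
Proof.
move=> mF FB mf Ff.
have [] := @dominated_convergence _ _ _ mu setT measurableT (fun n => EFin \o F n)
  (EFin \o f) (EFin \o cst B).
- by move=> n; apply/measurable_EFinP.
- exact/measurable_EFinP.
- by apply: aeW => x _; apply: cvg_EFin; [exact: nearW|exact: Ff].
- exact: finite_measure_integrable_cst.
- by apply: aeW => x n _ /=; rewrite lee_fin.
by move=> _ + _ => /fine_cvg; apply: cvg_trans.
Qed.

Section coboundaries.
Context d (Omega : measurableType d) dX (X : measurableType dX) (R : realType).
Variables (P : probability Omega R) (Pi : probability X R).
Variables (Pt : nat -> R.-pker X ~> X) (X_ : nat -> {RV P >-> X}).
Hypothesis hX : stationary_markov Pi Pt X_.
Implicit Types (f h : X -> R).

(** A partial sum of the Neumann series of [(1 - P_1)^-1], that is, an approximate solution of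
    Poisson's equation. *)
Definition resolvent T f (x : X) : R := \sum_(t < T) kernel_op Pt t f x.

Lemma bounded_resolvent T f : bounded_mfun f -> bounded_mfun (resolvent T f).
Proof.
move=> bf; apply: (@bounded_mfun_sum _ _ _ T (fun t => kernel_op Pt t f)) => t.
exact: kernel_op_bounded.
Qed.

Lemma resolventS T f :
  resolvent T.+1 f = (fun x => resolvent T f x + kernel_op Pt T f x).
Proof. by apply/funext => x; rewrite /resolvent big_ord_recr. Qed.

(** The sum telescopes to [f - P_T f], but each step uses [P_1 P_T = P_(1 + T)], which holds almost
    everywhere; hence an L_2 norm instead of a pointwise identity. *)
Lemma resolvent_eq T f : bounded_mfun f ->
  L2norm Pi (fun x => f x -
    (resolvent T f x - kernel_op Pt 1 (resolvent T f) x) - kernel_op Pt T f x) = 0.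
Proof.
move=> bf; elim: T => [|T ih].
  have -> : resolvent 0 f = fun=> 0.
    by apply/funext => x; rewrite /resolvent big_ord0.
  rewrite kernel_op_cst -[RHS]sqrtr0 -(kernel_op0_sq hX bf); congr Num.sqrt.
  by apply: eq_Rintegral => x _; ring.
have bT := kernel_op_bounded Pt T bf.
have bT1 := kernel_op_bounded Pt 1 bT.
have bTS := kernel_op_bounded Pt T.+1 bf.
have br := bounded_resolvent T bf.
have br1 := kernel_op_bounded Pt 1 br.
have b1 : bounded_mfun (fun x => f x -
    (resolvent T f x - kernel_op Pt 1 (resolvent T f) x) - kernel_op Pt T f x).
  by do !apply: bounded_mfunB.
have b2 : bounded_mfun (fun x => kernel_op Pt 1 (kernel_op Pt T f) x - kernel_op Pt T.+1 f x).
  exact: bounded_mfunB.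
apply/eqP; rewrite eq_le L2norm_ge0 andbT.
rewrite [X in _ <= X](_ : _ = 0 + 0); last by rewrite addr0.
rewrite -[X in _ <= X + _]ih -[X in _ <= _ + X]sqrtr0 -[X in _ <= _ + Num.sqrt X](kernel_opS_sq hX 1 T bf).
apply: le_trans (L2norm_triangle (bounded_mfun_sq Pi b1) (bounded_mfun_sq Pi b2)).
rewrite le_eqVlt; apply/orP; left; apply/eqP; congr L2norm; apply/funext => x.
rewrite resolventS (kernel_opD Pt 1 br bT); ring.
Qed.

Definition near_coboundary h := forall dl : R, 0 < dl ->
  exists2 q : X -> R, bounded_mfun q &
  \int[Pi]_x `|h x - \int[Pi]_y h y - (q x - kernel_op Pt 1 q x)| <= dl.

Let bint f : bounded_mfun f -> Pi.-integrable setT (EFin \o f).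
Proof. exact: bounded_mfun_integrable. Qed.

Let bdef h q : bounded_mfun h -> bounded_mfun q ->
  bounded_mfun (fun x => h x - \int[Pi]_y h y - (q x - kernel_op Pt 1 q x)).
Proof.
move=> b1 b2; apply: bounded_mfunB.
  by apply: bounded_mfunB => //; exact: bounded_mfun_cst.
by apply: bounded_mfunB => //; exact: kernel_op_bounded.
Qed.

Lemma near_coboundaryD h1 h2 : bounded_mfun h1 -> bounded_mfun h2 ->
  near_coboundary h1 -> near_coboundary h2 ->
  near_coboundary (fun x => h1 x + h2 x).
Proof.
move=> b1 b2 c1 c2 dl dl0.
have dl2 : 0 < dl / 2 by rewrite divr_gt0.
have [q1 bq1 h1q] := c1 _ dl2; have [q2 bq2 h2q] := c2 _ dl2.
exists (fun x => q1 x + q2 x); first exact: bounded_mfunD.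
rewrite prob_intD; [|exact: bint..].
have B1 := bounded_mfun_norm (bdef b1 bq1); have B2 := bounded_mfun_norm (bdef b2 bq2).
rewrite kernel_opD// (splitr dl); apply: le_trans (lerD h1q h2q).
rewrite -[leRHS]prob_intD; [|exact: bint..].
apply: prob_int_le.
- apply: bint; apply: bounded_mfun_norm; apply: bounded_mfunB; apply: bounded_mfunB.
  + exact: bounded_mfunD.
  + exact: bounded_mfun_cst.
  + exact: bounded_mfunD.
  + by apply: bounded_mfunD; exact: kernel_op_bounded.
- by apply: bint; exact: bounded_mfunD.
- move=> x; apply: le_trans (ler_normD _ _).
  by rewrite le_eqVlt; apply/orP; left; apply/eqP; congr (`|_|); ring.
Qed.

Lemma near_coboundaryZ c h : bounded_mfun h -> near_coboundary h ->
  near_coboundary (fun x => c * h x).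
Proof.
move=> bh ch dl dl0.
have c1 : 0 < `|c| + 1 by rewrite ltr_wpDl.
have [q bq hq] := ch _ (divr_gt0 dl0 c1).
exists (fun x => c * q x); first exact: bounded_mfunZ.
rewrite prob_intZ; last exact: bint.
have B1 := bounded_mfun_norm (bdef bh bq).
rewrite kernel_opZ//; apply: (le_trans (y := `|c| * (dl / (`|c| + 1)))).
  rewrite -[X in X <= _](_ : \int[Pi]_x (`|c| * `|h x - \int[Pi]_y h y - (q x - kernel_op Pt 1 q x)|) = _).
    by rewrite prob_intZ ?ler_wpM2l//; exact: bint.
  by apply: eq_Rintegral => x _; rewrite -normrM; congr (`|_|); ring.
by rewrite mulrA ler_pdivrMr// mulrC ler_wpM2l ?(ltW dl0)// lerDl.
Qed.

Lemma near_coboundary_lim h : bounded_mfun h ->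
  (forall e, 0 < e -> exists h', [/\ bounded_mfun h', near_coboundary h' &
    \int[Pi]_x `|h x - h' x| <= e]) -> near_coboundary h.
Proof.
move=> bh limh dl dl0.
have dl3 : 0 < dl / 3 by rewrite divr_gt0.
have [h' [bh' ch' hh']] := limh _ dl3.
have [q bq hq] := ch' _ dl3.
exists q => //.
have bhh := bounded_mfunB bh bh'.
have B1 := bounded_mfun_norm bhh; have B2 := bounded_mfun_norm (bdef bh' bq).
have bc c : bounded_mfun (fun _ : X => c) by exact: bounded_mfun_cst.
have hh'2 : `|\int[Pi]_x h x - \int[Pi]_x h' x| <= dl / 3.
  rewrite -prob_intB; [|exact: bint..].
  exact: le_trans (prob_int_norm (bint bhh)) hh'.
apply: (le_trans (y := \int[Pi]_x (`|h x - h' x| + dl / 3 +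
   `|h' x - \int[Pi]_y h' y - (q x - kernel_op Pt 1 q x)|))).
  apply: prob_int_le.
  - by apply: bint; apply: bounded_mfun_norm; exact: bdef.
  - by apply: bint; apply: bounded_mfunD => //; exact: bounded_mfunD.
  - move=> x.
    rewrite (_ : _ - _ = (h x - h' x) + - (\int[Pi]_x h x - \int[Pi]_x h' x) +
      (h' x - \int[Pi]_y h' y - (q x - kernel_op Pt 1 q x))); last by ring.
    rewrite (le_trans (ler_normD _ _))// lerD//.
    by rewrite (le_trans (ler_normD _ _))// normrN lerD.
rewrite prob_intD; [|by apply: bint => //; exact: bounded_mfunD|exact: bint].
rewrite prob_intD; [|exact: bint..].
rewrite prob_int_cst; lra.
Qed.

(** For [q] the resolvent of order [T], the difference of [h] and [q - P_1 q] is [P_T h], which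
    mixing brings close to the mean of [h]. *)
Lemma mixing_near_coboundary h : bounded_mfun h ->
  (forall e, 0 < e -> exists t, \int[Pi]_x `|kernel_op Pt t h x - \int[Pi]_y h y| <= e) ->
  near_coboundary h.
Proof.
move=> bh mix dl dl0; have [T hT] := mix _ dl0.
exists (resolvent T h); first exact: bounded_resolvent.
have bT := kernel_op_bounded Pt T bh.
have br := bounded_resolvent T bh; have br1 := kernel_op_bounded Pt 1 br.
have bc c : bounded_mfun (fun _ : X => c) by exact: bounded_mfun_cst.
have b1 : bounded_mfun (fun x => h x -
    (resolvent T h x - kernel_op Pt 1 (resolvent T h) x) - kernel_op Pt T h x).
  by do !apply: bounded_mfunB.
have b2 : bounded_mfun (fun x => kernel_op Pt T h x - \int[Pi]_y h y).
  exact: bounded_mfunB.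
have := prob_int_le_L2norm (bounded_mfun_sq Pi b1); rewrite resolvent_eq// => le0.
have B1 := bounded_mfun_norm b1; have B2 := bounded_mfun_norm b2.
apply: le_trans (_ : 0 + dl <= dl); last by rewrite add0r.
apply: le_trans (lerD le0 hT).
rewrite -prob_intD; [|exact: bint..].
apply: prob_int_le.
- by apply: bint; apply: bounded_mfun_norm; exact: bdef.
- by apply: bint; exact: bounded_mfunD.
- move=> x; apply: le_trans (ler_normD _ _).
  by rewrite le_eqVlt; apply/orP; left; apply/eqP; congr (`|_|); ring.
Qed.

(* Dynkin's pi-lambda theorem reduces density of coboundaries to indicators of
   a pi-system generating the sigma-algebra. *)
Lemma near_coboundary_dense (G : set (set X)) :
  @measurable _ X = <<s G >> -> setI_closed G ->
  (forall A, G A -> near_coboundary \1_A) -> coboundary_dense Pi Pt.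
Proof.
move=> GE GI GP.
have c1 : near_coboundary (fun=> 1).
  apply: mixing_near_coboundary; first exact: bounded_mfun_cst.
  move=> e e0; exists 0%N; by rewrite kernel_op_cst !prob_int_cst subrr normr0 ltW.
have cA A : measurable A -> near_coboundary \1_A.
  move=> mA; have {mA} : <<s G >> A by rewrite -GE.
  move: A; apply: (@dynkin_induction _ X G (fun A => near_coboundary \1_A) GE GI).
  - rewrite (_ : \1_setT = fun=> 1); first exact: c1.
    by apply/funext => x; rewrite indicE in_setT.
  - exact: GP.
  - move=> A mA PA.
    rewrite (_ : \1_(~` A) = fun x => 1 + (-1) * \1_A x); last first.
      apply/funext => x; rewrite !indicE in_setC.
      by case: (x \in A) => /=; rewrite ?mulr1 ?mulr0 ?subrr ?addr0.
    have bA := @bounded_mfun_indic _ _ R _ mA.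
    exact: (near_coboundaryD (@bounded_mfun_cst _ _ _ 1) (bounded_mfunZ (-1) bA) c1
      (near_coboundaryZ (-1) bA PA)).
  - move=> F mF tF PF.
    have bF n : bounded_mfun (\1_(F n) : X -> R) by exact: bounded_mfun_indic.
    have mU : measurable (\bigcup_k F k) by exact: bigcupT_measurable.
    apply: near_coboundary_lim; first exact: bounded_mfun_indic.
    (* Disjointness makes these partial sums indicators of partial unions: they are bounded by 1, so
       their pointwise convergence is also convergence in L_1, under which [near_coboundary] is
       closed. *)
    pose S n x : R := \sum_(i < n) \1_(F i) x.
    have SE n : S n = \1_(\bigcup_(i < n) F i).
      apply/funext => x; rewrite /S.
      have [[i ni Fix]|nF] := pselect ((\bigcup_(i < n) F i) x).
        rewrite indicE mem_set; last by exists i.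
        rewrite (bigD1 (Ordinal ni))//= indicE mem_set// big1 ?addr0// => j ji.
        rewrite indicE memNset// => Fjx; move/negP: ji; apply; apply/eqP/val_inj => /=.
        by apply: (tF j i I I); exists x.
      rewrite indicE memNset// big1// => j _; rewrite indicE memNset// => Fjx.
      by apply: nF; exists j => /=.
    have bS n : bounded_mfun (S n) by exact: (@bounded_mfun_sum _ _ _ n (fun i => \1_(F i))).
    have cS n : near_coboundary (S n).
      elim: n => [|n ih].
        rewrite (_ : S 0 = fun x => 0 * 1); last first.
          by apply/funext => x; rewrite /S big_ord0 mul0r.
        exact: near_coboundaryZ (@bounded_mfun_cst _ _ _ 1) c1.
      rewrite (_ : S n.+1 = fun x => S n x + \1_(F n) x).
        exact: near_coboundaryD (bS n) (bF n) ih (PF n).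
      by apply/funext => x; rewrite /S big_ord_recr.
    have cvS x : S n x @[n --> \oo] --> (\1_(\bigcup_k F k) x : R).
      have [[i _ Fix]|nF] := pselect ((\bigcup_k F k) x).
        apply: cvg_near_cst; exists i.+1 => // n /= ltin.
        rewrite SE !indicE !mem_set//; first by exists i.
        by exists i.
      apply: cvg_near_cst; apply: nearW => n.
      rewrite SE !indicE !memNset// => -[i _ Fix]; apply: nF; by exists i.
    have Sle n x : `|S n x| <= 1.
      by rewrite SE indicE; case: (_ \in _); rewrite ?normr0 ?normr1.
    have /cvgr0Pnorm_le lim0 := bounded_convergence Pi (fun n => (bS n).1) Sle (@measurable_indic _ _ R _ _ mU) cvS.
    move=> e e0; have [N _ /(_ N (leqnn N)) hN] := lim0 _ e0.
    exists (S N); split; [exact: bS|exact: cS|].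
    apply: le_trans hN; apply: le_trans (ler_norm _).
    by rewrite le_eqVlt; apply/orP; left; apply/eqP; apply: eq_Rintegral => x _; rewrite distrC.
move=> h bh; apply: (@bounded_mfun_ind _ _ R near_coboundary _ _ _ _ h bh).
- by move=> f g bf bg; exact: near_coboundaryD.
- by move=> c f bf; exact: near_coboundaryZ.
- exact: cA.
move=> f bf limf; apply: near_coboundary_lim => // e e0.
have [f' [bf' cf' ff']] := limf e e0; exists f'; split => //.
apply: (le_trans (ler_norm _)); apply: prob_int_bound.
  by apply: bounded_mfun_norm; exact: bounded_mfunB.
by move=> x; rewrite normr_id.
Qed.

End coboundaries.

(** * Lipschitz functions on a metric space *)

Section lipschitz.
Context {R : realType} {X : pointedMetricType R}.
Implicit Types (f : X -> R) (L K : R).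

Definition lip L f := forall x y : X, `|f x - f y| <= L * mdist x y.

Lemma lip_measurable L f : 0 <= L -> lip L f ->
  measurable_fun setT (f : borel X -> R).
Proof.
move=> L0 fL.
apply: (measurability (@RGenOInfty.G R)); first exact: RGenOInfty.measurableE.
move=> _ [_ [a ->] <-]; rewrite setTI; apply: sub_sigma_algebra.
rewrite openE => x /=; rewrite in_itv/= andbT => afx.
have L1 : 0 < L + 1 by rewrite ltr_wpDl.
apply/nbhs_ballP; exists ((f x - a) / (L + 1)) => /=.
  by rewrite divr_gt0// subr_gt0.
move=> y; rewrite ballEmdist/= ltr_pdivlMr// => xy.
rewrite in_itv/= andbT.
have := fL x y; rewrite ler_norml => /andP[_ fxy].
have := mdist_ge0 x y; nra.
Qed.

Lemma lip_bounded_mfun L K f : 0 <= L -> lip L f -> (forall x, `|f x| <= K) ->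
  bounded_mfun (f : borel X -> R).
Proof. by move=> L0 fL fK; split; [exact: lip_measurable fL|exists K]. Qed.

Lemma lip_norm_le L f : 0 <= L -> lip L f -> (lip_norm f <= L%:E)%E.
Proof.
move=> L0 fL; rewrite /lip_norm ge_max lee_fin L0/=.
apply: ge_ereal_sup => _ [x [y [xy ->]]]; rewrite lee_fin.
rewrite ler_pdivrMr; last by rewrite mdist_gt0; apply/eqP.
by rewrite distrC.
Qed.

Lemma lip_norm_lip f : (lip_norm f < +oo)%E -> exists2 L, 0 <= L & lip L f.
Proof.
move=> flip.
have l0 : (0 <= lip_norm f)%E by rewrite /lip_norm le_max lexx.
exists (fine (lip_norm f)); first exact: fine_ge0.
move=> x y; have [->|xy] := eqVneq x y.
  by rewrite subrr normr0 mulr_ge0 ?fine_ge0// mdist_ge0.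
rewrite distrC -ler_pdivrMr ?mdist_gt0// -lee_fin fineK; last by rewrite ge0_fin_numE.
rewrite /lip_norm le_max; apply/orP; right; apply: ereal_sup_ubound.
by exists x, y; split => //; exact/eqP.
Qed.

Lemma lipZ c L f : lip L f -> lip (`|c| * L) (fun x => c * f x).
Proof. by move=> fL x y; rewrite -mulrBr normrM -mulrA ler_wpM2l. Qed.

Lemma sup_norm_le K f : (forall x, `|f x| <= K) -> (sup_norm f <= K%:E)%E.
Proof. by move=> fK; apply: ge_ereal_sup => _ [x _ <-]; rewrite lee_fin. Qed.

End lipschitz.

Section open_sets.
Context {R : realType} {X : pointedMetricType R}.
Variables (U : set X) (oU : open U).

Let S (x : X) : set R := [set mdist x y | y in ~` U].
Let hS x : ~` U !=set0 -> has_inf (S x).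
Proof.
move=> [y Uy]; split; first by exists (mdist x y), y.
by exists 0 => _ [z _ <-]; exact: mdist_ge0.
Qed.

(** The approximants are [min 1 (n d)], where [d] is the distance to the complement of [U], positive
    exactly on the open set [U]. An empty complement is set apart, since its infimum would not be a
    distance. *)
Lemma open_lip_approx : exists F : nat -> X -> R,
  [/\ forall n, lip n%:R (F n), forall n x, `|F n x| <= 1 &
      forall x, F n x @[n --> \oo] --> (\1_U x : R)].
Proof.
have [U0|/set0P U0] := eqVneq (~` U) set0.
  exists (fun _ _ => 1); split.
  - by move=> n x y; rewrite subrr normr0 mulr_ge0// mdist_ge0.
  - by move=> n x; rewrite normr1.
  - move=> x; rewrite indicE mem_set; first exact: cvg_cst.
    by rewrite -(setCK U) U0.
pose dU x := inf (S x).
have dU_ge0 x : 0 <= dU x.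
  by apply: lb_le_inf; [exact: (hS x U0).1|move=> _ [y _ <-]; exact: mdist_ge0].
have dU_lip x y : dU x <= mdist x y + dU y.
  rewrite -lerBlDl; apply: lb_le_inf; first exact: (hS y U0).1.
  move=> _ [z Uz <-]; rewrite lerBlDl; apply: le_trans (metric_triangle x y z).
  by apply: ge_inf; [exact: (hS x U0).2|exists z].
exists (fun n x => Num.min 1 (n%:R * dU x)); split.
- move=> n x y.
  have minL (a b : R) : `|Num.min 1 a - Num.min 1 b| <= `|a - b|.
    by rewrite /Num.min; case: ifPn; case: ifPn; rewrite ?ltNge ?negbK => h1 h2;
      rewrite ?subrr ?normr0// !ler_norml; apply/andP; split;
      have := ler_norm (a - b); have := ler_norm (b - a); rewrite distrC; lra.
  apply: le_trans (minL _ _) _; rewrite -mulrBr normrM ger0_norm// ler_wpM2l//.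
  have := dU_lip x y; have := dU_lip y x; rewrite [mdist y x]metric_sym => h1 h2.
  by rewrite ler_norml; apply/andP; split; lra.
- move=> n x; rewrite ger0_norm ?ge_min ?lexx// le_min ler01/=.
  by rewrite mulr_ge0.
- move=> x; rewrite indicE; have [xU|xU] := boolP (x \in U).
    have /nbhs_ballP[r /= r0 xrU] : nbhs x U by move: oU; rewrite openE; apply; exact/set_mem.
    have dr : r <= dU x.
      apply: lb_le_inf; first exact: (hS x U0).1.
      move=> _ [y Uy <-]; rewrite leNgt; apply/negP => xy; apply: Uy; apply: xrU.
      by rewrite ballEmdist.
    apply: cvg_near_cst; exists (Num.truncn r^-1).+1 => // n /= Nn.
    apply/min_idPl.
    have rn : r^-1 <= n%:R.
      by rewrite (le_trans (ltW (truncnS_gt _)))// ler_nat.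
    apply: (le_trans (y := r^-1 * r)); first by rewrite mulVf// gt_eqF.
    by rewrite ler_pM// ?invr_ge0 ltW.
  have -> : dU x = 0.
    apply/eqP; rewrite eq_le dU_ge0 andbT; apply: ge_inf; first exact: (hS x U0).2.
    by exists x; [move=> /mem_set; exact/negP|rewrite mdistxx].
  under eq_fun do rewrite mulr0 minEle ler10.
  exact: cvg_cst.
Qed.

End open_sets.

Section bounded_lipschitz_mixing.
Context {R : realType} {X : pointedMetricType R}.
Context d (Omega : measurableType d) (P : probability Omega R)
  (Pi : probability (borel X) R) (Pt : nat -> R.-pker (borel X) ~> (borel X))
  (X_ : nat -> {RV P >-> borel X}).
Hypothesis hX : stationary_markov Pi Pt X_.
Variables (M : X -> R) (rate : R -> R).
Hypothesis mM : measurable_fun [set: borel X] (M : borel X -> R).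
Hypothesis M_ge1 : forall x : X, 1 <= M x.
Hypothesis rate_range : forall u : R, 0 <= u -> 0 < rate u <= 1.
Hypothesis rate_lim : rate u @[u --> +oo] --> (0 : R).
Hypothesis hBL : forall (x : X) (t : nat),
  (BL_dist (Pt t x) Pi <= (M x * rate t%:R)%:E)%E.
Hypothesis M_int : (\int[Pi]_x (M x)%:E < +oo)%E.

(** [f / (L + K)] lies in the unit ball that defines [BL_dist]; [K > 0] makes the division
    legitimate also for [L = 0]. *)
Lemma BL_bound (f : X -> R) (L K : R) t x : 0 <= L -> 0 < K -> lip L f ->
  (forall x, `|f x| <= K) ->
  `|kernel_op Pt t f x - \int[Pi]_y f y| <= (L + K) * (M x * rate t%:R).
Proof.
move=> L0 K0 fL fK.
have bf := lip_bounded_mfun L0 fL fK.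
have a0 : 0 < L + K by rewrite ltr_wpDl.
have an : `|(L + K)^-1| = (L + K)^-1 by rewrite gtr0_norm// invr_gt0.
pose phi (x : X) := (L + K)^-1 * f x.
have bphi : bounded_mfun (phi : borel X -> R) by exact: bounded_mfunZ.
have phi1 : (lip_norm phi + sup_norm phi <= 1)%E.
  have -> : 1%E = (((L + K)^-1 * L)%:E + ((L + K)^-1 * K)%:E)%E.
    by rewrite -EFinD -mulrDr mulVf// gt_eqF.
  apply: leeD.
    apply: lip_norm_le; first by rewrite mulr_ge0// invr_ge0 ltW.
    by rewrite -[in X in lip X]an; exact: lipZ.
  by apply: sup_norm_le => y; rewrite normrM an ler_wpM2l// invr_ge0 ltW.
have : (`|(kernel_op Pt t phi x)%:E - (\int[Pi]_y phi y)%:E| <= (M x * rate t%:R)%:E)%E.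
  apply: le_trans (hBL x t); apply: ereal_sup_ubound; exists phi => //.
  rewrite -kernel_opE// /Rintegral fineK//.
  exact: integrable_fin_num (bounded_mfun_integrable Pi bphi).
rewrite (kernel_opZ Pt t _ bf) prob_intZ; last exact: bounded_mfun_integrable.
rewrite -EFinB/= lee_fin -mulrBr normrM an mulrC ler_pdivrMr//.
by rewrite mulrC.
Qed.

Lemma M_integrable : Pi.-integrable setT (EFin \o (M : borel X -> R)).
Proof.
apply/integrableP; split; first exact/measurable_EFinP.
apply: le_lt_trans M_int; rewrite le_eqVlt; apply/orP; left; apply/eqP.
by apply: eq_integral => x _ /=; rewrite ger0_norm// (le_trans ler01).
Qed.

Lemma M_mean_ge0 : 0 <= \int[Pi]_x M x.
Proof. by apply: Rintegral_ge0 => x _; rewrite (le_trans ler01). Qed.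

Lemma lip_mixing_L1 (f : X -> R) (L K : R) t : 0 <= L -> 0 < K -> lip L f ->
  (forall x, `|f x| <= K) ->
  \int[Pi]_x `|kernel_op Pt t f x - \int[Pi]_y f y| <=
    (L + K) * rate t%:R * \int[Pi]_x M x.
Proof.
move=> L0 K0 fL fK; have bf := lip_bounded_mfun L0 fL fK.
rewrite -prob_intZ; last exact: M_integrable.
apply: prob_int_le.
- apply: bounded_mfun_integrable; apply: bounded_mfun_norm; apply: bounded_mfunB.
    exact: kernel_op_bounded.
  exact: bounded_mfun_cst.
- by apply: real_integrableZ; exact: M_integrable.
- by move=> x; rewrite -mulrA [rate _ * _]mulrC; exact: BL_bound.
Qed.

Lemma rate_nat e : 0 < e -> exists t : nat, rate t%:R <= e.
Proof.
move=> e0; have /cvgr0Pnorm_le/(_ e e0)[A [_ hA]] := rate_lim.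
exists (Num.truncn A).+1; rewrite (le_trans (ler_norm _))//; apply: hA.
exact: truncnS_gt.
Qed.

Lemma lip_coboundary_dense : coboundary_dense Pi Pt.
Proof.
apply: (near_coboundary_dense hX (G := @open X)) => //; first exact: openI.
move=> U oU.
have mU : @measurable _ (borel X) U by exact: sub_sigma_algebra.
have [F [FL F1 FU]] := open_lip_approx oU.
have bF n : bounded_mfun (F n : borel X -> R).
  exact: (lip_bounded_mfun (ler0n _ n) (FL n) (F1 n)).
apply: near_coboundary_lim; first exact: bounded_mfun_indic.
have /cvgr0Pnorm_le lim0 := bounded_convergence Pi (fun n => (bF n).1) F1
  (@measurable_indic _ (borel X) R _ _ mU) FU.
move=> e e0; have [N _ /(_ N (leqnn N)) hN] := lim0 _ e0.
exists (F N); split; first exact: bF.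
  apply: (mixing_near_coboundary hX (bF N)) => dl dl0.
  pose C := (N%:R + 1) * (\int[Pi]_x M x + 1).
  have C0 : 0 < C by rewrite mulr_gt0// ltr_wpDl// M_mean_ge0.
  have [t ht] := rate_nat (divr_gt0 dl0 C0); exists t.
  apply: le_trans (lip_mixing_L1 t (ler0n _ N) ltr01 (FL N) (F1 N)) _.
  have /andP[r0 _] := rate_range (ler0n R t).
  apply: (le_trans (y := C * rate t%:R)); last by rewrite mulrC -ler_pdivlMr.
  rewrite /C mulrAC ler_wpM2r ?(ltW r0)// ler_wpM2l ?addr_ge0// lerDl//.
apply: le_trans hN; apply: le_trans (ler_norm _).
by rewrite le_eqVlt; apply/orP; left; apply/eqP; apply: eq_Rintegral => x _; rewrite distrC.
Qed.

End bounded_lipschitz_mixing.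

(** * Decay of correlations and martingale approximation *)

Section monotone_sum.
Context {R : realType}.
Notation mu := (@lebesgue_measure R).

(** The term at [t.+1] lies below the integral over [[t, t.+1[], so the integral bounds the sum from
    index 1 on and [r 0] is added by hand. *)
Lemma nonincreasing_sum_le_integral (r : R -> R) : nonincreasing_fun r ->
  (forall u, 0 <= r u) -> (\int[mu]_(u in `[0%R, +oo[) (r u)%:E < +oo)%E ->
  exists S : R, forall n, \sum_(t < n) r t%:R <= S.
Proof.
move=> r_ni r0 rfin.
have mr D : measurable D -> measurable_fun D (EFin \o r).
  by move=> mD; apply/measurable_EFinP; exact: nonincreasing_measurable.
have int_ge0 D : (0 <= \int[mu]_(u in D) (r u)%:E)%E.
  by apply: integral_ge0 => u _; rewrite lee_fin.
have itv_ge n : ((\sum_(t < n) r t.+1%:R)%:E <= \int[mu]_(u in `[0%R, n%:R[) (r u)%:E)%E.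
  elim: n => [|n ih]; first by rewrite big_ord0.
  rewrite (@itv_bndbnd_setU _ _ _ (BLeft n%:R)) ?bnd_simp ?ler0n ?ler_nat//.
  rewrite ge0_integral_setU//=; last 3 first.
  - by apply: mr; exact: measurableU.
  - by move=> u _; rewrite lee_fin.
  - apply/disj_setPS => u [/=]; rewrite !in_itv/= => /andP[_ un] /andP[nu _].
    by move: un; rewrite ltNge nu.
  rewrite big_ord_recr/= EFinD; apply: leeD => //.
  apply: (le_trans (y := \int[mu]_(u in `[n%:R, n.+1%:R[) (r n.+1%:R)%:E)%E).
    rewrite integral_cst//= lebesgue_measure_itv/= lte_fin ltr_nat ltnSn.
    by rewrite -EFinB -natrB// subSnn mule1.
  apply: ge0_le_integral => //.
  - by move=> u _; rewrite lee_fin.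
  - exact: mr.
  - move=> u /=; rewrite in_itv/= => /andP[_ un]; rewrite lee_fin.
    by apply: r_ni; exact: ltW.
exists (r 0 + fine (\int[mu]_(u in `[0%R, +oo[) (r u)%:E)) => n.
apply: (le_trans (y := \sum_(t < n.+1) r t%:R)).
  by rewrite big_ord_recr/= lerDl.
rewrite big_ord_recl/= lerD2l -lee_fin fineK ?ge0_fin_numE//.
apply: le_trans (itv_ge n) _; apply: ge0_subset_integral => //.
- exact: mr.
- by move=> u _; rewrite lee_fin.
- by move=> u /=; rewrite !in_itv/= => /andP[->].
Qed.

End monotone_sum.

Section truncation.
Context {R : realType}.
Implicit Types (K y : R).

Definition trunc K y : R := if y < - K then - K else if K < y then K else y.

Lemma trunc_le K y : 0 <= K -> `|trunc K y| <= K.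
Proof.
move=> K0; rewrite /trunc; case: ltP => h1; first by rewrite normrN ger0_norm.
by case: ltP => h2; [rewrite ger0_norm|rewrite ler_norml h1].
Qed.

Lemma trunc_lip K x y : 0 <= K -> `|trunc K x - trunc K y| <= `|x - y|.
Proof.
move=> K0; have h1 := ler_norm (x - y); have h2 := ler_norm (y - x).
rewrite distrC in h2; rewrite /trunc ler_norml.
by case: (ltP x); case: (ltP y); case: (ltP K x); case: (ltP K y) => *; apply/andP; split; lra.
Qed.

Lemma trunc_sub K y : 0 <= K -> `|y - trunc K y| <= `|y|.
Proof.
move=> K0; have h1 := ler_norm y; have h2 := ler_norm (- y).
rewrite normrN in h2; rewrite /trunc ler_norml.
by case: (ltP y); case: (ltP K y) => *; apply/andP; split; lra.
Qed.

Lemma trunc_id K y : `|y| <= K -> trunc K y = y.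
Proof.
rewrite ler_norml => /andP[h1 h2]; rewrite /trunc.
by rewrite !ltNge h1 h2.
Qed.

(** Compares two truncation levels: the difference is controlled by the tail at the lower one,
    uniformly in [N]. *)
Lemma trunc_sub_mono K N y : 0 <= K -> K <= N ->
  `|trunc N y - trunc K y| <= `|y - trunc K y|.
Proof.
move=> K0 KN.
have h1 := ler_norm (y - trunc K y); have h2 := ler_norm (trunc K y - y).
rewrite distrC in h2; move: h1 h2; rewrite /trunc ler_norml.
by case: (ltP y (- K)); case: (ltP K y); case: (ltP y (- N)); case: (ltP N y) => *;
  apply/andP; split; lra.
Qed.

(** A pointwise Chebyshev inequality: the left side vanishes unless [|y| > K], and there [K] may be
    replaced by [|y|] in the power. *)
Lemma trunc_tail K y p : 1 < p -> 0 < K ->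
  (y - trunc K y) ^+ 2 * K `^ (2 * p - 2) <= `|y| `^ (2 * p).
Proof.
move=> p1 K0; have [yK|yK] := leP `|y| K.
  by rewrite trunc_id// subrr expr0n/= mul0r powR_ge0.
have y0 : 0 < `|y| := lt_trans K0 yK.
rewrite [X in _ <= _ `^ X](_ : _ = 2 + (2 * p - 2)); last by ring.
rewrite [leRHS]powRD; last by apply/implyP => _; rewrite gt_eqF.
rewrite powR_mulrn//; apply: ler_pM.
- exact: sqr_ge0.
- exact: powR_ge0.
- rewrite -real_normK ?num_real// lerXn2r ?nnegrE//.
  by apply: trunc_sub; exact: ltW.
- by apply: ge0_ler_powR; rewrite ?nnegrE ?(ltW K0) ?(ltW yK)//; lra.
Qed.

End truncation.

Section correlation_decay.
Context {R : realType} {X : pointedMetricType R}.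
Context d (Omega : measurableType d) (P : probability Omega R)
  (Pi : probability (borel X) R) (Pt : nat -> R.-pker (borel X) ~> (borel X))
  (X_ : nat -> {RV P >-> borel X}).
Hypothesis hX : stationary_markov Pi Pt X_.
Variables (M : X -> R) (rate : R -> R).
Hypothesis mM : measurable_fun [set: borel X] (M : borel X -> R).
Hypothesis M_ge1 : forall x : X, 1 <= M x.
Hypothesis rate_range : forall u : R, 0 <= u -> 0 < rate u <= 1.
Hypothesis hBL : forall (x : X) (t : nat),
  (BL_dist (Pt t x) Pi <= (M x * rate t%:R)%:E)%E.
Hypothesis M_int : (\int[Pi]_x (M x)%:E < +oo)%E.
Variables (p : R) (f : X -> R).
Hypothesis p_gt1 : 1 < p.
Hypothesis f_int : Pi.-integrable setT (EFin \o (fun x : borel X => `|f x| `^ (2 * p))).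

Let A : R := \int[Pi]_x (`|f x| `^ (2 * p)).
Let m : R := \int[Pi]_x M x.
Let A0 : 0 <= A. Proof. by apply: Rintegral_ge0 => x _; exact: powR_ge0. Qed.
Let m0 : 0 <= m. Proof. exact: M_mean_ge0. Qed.

Definition rho (t : nat) : R := rate t%:R `^ (2^-1 * (1 - p^-1)).

Lemma lip_trunc (phi : X -> R) L K : 0 <= K -> lip L phi ->
  lip L (fun x => trunc K (phi x)).
Proof. by move=> K0 fL x y; apply: le_trans (trunc_lip _ _ K0) (fL x y). Qed.

(** Only [|phi| <= |f|] is asked, because [phi] will be [f], a truncation of [f] or a difference of
    two truncations, and the constant must be the same for all of them. *)
Lemma trunc_tail_L2 (phi : X -> R) L K : 0 <= L -> lip L phi ->
  (forall x, `|phi x| <= `|f x|) -> 0 < K ->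
  sq_integrable Pi (fun x : borel X => phi x - trunc K (phi x)) /\
  L2norm Pi (fun x : borel X => phi x - trunc K (phi x)) <= Num.sqrt A * K `^ (1 - p).
Proof.
move=> L0 phiL phif K0.
have mphi := lip_measurable L0 phiL.
have mtr := lip_measurable L0 (lip_trunc (ltW K0) phiL).
have K2 : 0 < K `^ (2 * p - 2) by rewrite powR_gt0.
have K2V : (K `^ (2 * p - 2))^-1 = (K `^ (1 - p)) ^+ 2.
  rewrite -powRN -powR_mulrn ?powR_ge0// -powRrM; congr (_ `^ _); ring.
have le1 x : (phi x - trunc K (phi x)) ^+ 2 <= (K `^ (1 - p)) ^+ 2 * `|f x| `^ (2 * p).
  rewrite -K2V mulrC ler_pdivlMr//; apply: le_trans (trunc_tail _ p_gt1 K0) _.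
  by rewrite ge0_ler_powR ?nnegrE// mulr_ge0// ltW// (lt_trans ltr01).
have ib := real_integrableZ ((K `^ (1 - p)) ^+ 2) f_int.
have i1 : Pi.-integrable setT (EFin \o (fun x : borel X => (phi x - trunc K (phi x)) ^+ 2)).
  apply: le_integrable ib => //.
    by apply/measurable_EFinP; apply: measurable_funX; exact: measurable_funB.
  move=> x _ /=; rewrite lee_fin ger0_norm ?sqr_ge0//.
  by apply: le_trans (le1 x) (ler_norm _).
split; first by split=> //; exact: measurable_funB.
apply: L2norm_le; first by rewrite mulr_ge0 ?sqrtr_ge0// powR_ge0.
rewrite exprMn sqr_sqrtr// mulrC -prob_intZ//.
exact: prob_int_le.
Qed.

Lemma trunc_sq_integrable (phi : X -> R) L : 0 <= L -> lip L phi ->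
  (forall x, `|phi x| <= `|f x|) -> sq_integrable Pi (phi : borel X -> R).
Proof.
move=> L0 phiL phif.
have [sq _] := trunc_tail_L2 L0 phiL phif ltr01.
rewrite (_ : phi = fun x => (phi x - trunc 1 (phi x)) + trunc 1 (phi x)); last first.
  by apply/funext => x; rewrite subrK.
apply: sq_integrableD => //; apply: bounded_mfun_sq.
exact: lip_bounded_mfun L0 (lip_trunc ler01 phiL) (fun x => trunc_le _ ler01).
Qed.

Lemma centered_L2norm (phi : borel X -> R) : sq_integrable Pi phi ->
  sq_integrable Pi (fun x => phi x - \int[Pi]_y phi y) /\
  L2norm Pi (fun x => phi x - \int[Pi]_y phi y) <= 2 * L2norm Pi phi.
Proof.
move=> sp; have sc := sq_integrable_cst Pi (\int[Pi]_y phi y).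
split; first exact: sq_integrableB.
under eq_fun do rewrite -mulN1r.
apply: le_trans (L2norm_triangle sp (sq_integrableZ (-1) sc)) _.
rewrite L2normZ// normrN1 mul1r L2norm_cst mulr_natl mulr2n lerD2l.
apply: le_trans (prob_int_norm (sq_integrable_integrable sp)) _.
exact: prob_int_le_L2norm.
Qed.

(** The first term comes from the truncated part, where the square is at most
    [2 K (L + K) M r <= 2 (L + 1) K^2 r M]; the second is the L_2 tail, doubled by centering. *)
Definition decay_cst L := Num.sqrt (2 * (L + 1) * m) + 2 * Num.sqrt A.

(* Truncate at [K = r^(-1/2p)], [r = rate t]: the truncated part is controlled
   by BL distance times sup norm, the rest by the moment of order [2p]. *)
Lemma lip_decay (phi : X -> R) L B t : 0 <= L -> lip L phi ->
  (forall x, `|phi x| <= B) -> (forall x, `|phi x| <= `|f x|) ->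
  L2norm Pi (fun x => kernel_op Pt t phi x - \int[Pi]_y phi y) <= decay_cst L * rho t.
Proof.
move=> L0 phiL phiB phif.
have bphi := lip_bounded_mfun L0 phiL phiB.
have /andP[r0 r1] := rate_range (ler0n R t).
have p0 : 0 < p := lt_trans ltr01 p_gt1.
set r := rate t%:R in r0 r1.
(* The exponent balances the two errors: [K ^+ 2 * r] from the truncated part and the square of K^(1
   - p) from the tail both equal [rho t ^+ 2]. *)
pose K := r `^ (- (2 * p)^-1).
have K0 : 0 < K by rewrite powR_gt0.
(* [r <= 1] gives [1 <= K], whence [L + K <= (L + 1) * K]: this keeps the level out of the
   constant. *)
have K1 : 1 <= K.
  rewrite /K powRN -[leLHS]invr1 lef_pV2 ?posrE ?powR_gt0//.
  rewrite -[X in _ <= X](_ : 1 `^ (2 * p)^-1 = 1); last by rewrite powR1.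
  by rewrite ge0_ler_powR ?nnegrE ?ler01 ?(ltW r0)// invr_ge0 mulr_ge0 ?(ltW p0).
have rhoE : rho t = K `^ (1 - p).
  rewrite /K -powRrM /rho -/r; congr (_ `^ _).
  by field; rewrite gt_eqF.
have rho0 : 0 <= rho t by exact: powR_ge0.
have rho2 : rho t ^+ 2 = K ^+ 2 * r.
  rewrite -(powR_mulrn 2 rho0) -(powR_mulrn 2 (ltW K0)) /rho -/r /K -!powRrM.
  rewrite -[X in _ = _ * X](powRr1 (ltW r0)) -powRD; last first.
    by apply/implyP => _; rewrite gt_eqF.
  by congr (_ `^ _); field; rewrite gt_eqF.
pose phiK x := trunc K (phi x).
have phiKL : lip L phiK := lip_trunc (ltW K0) phiL.
have phiKK x : `|phiK x| <= K := trunc_le _ (ltW K0).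
have bphiK := lip_bounded_mfun L0 phiKL phiKK.
have bpsi : bounded_mfun (fun x : borel X => phi x - phiK x) by exact: bounded_mfunB.
have [sq tail] := trunc_tail_L2 L0 phiL phif K0.
have bPK := kernel_op_bounded Pt t bphiK.
have bPpsi := kernel_op_bounded Pt t bpsi.
have bc (c : R) : bounded_mfun (fun _ : borel X => c) by exact: bounded_mfun_cst.
have main : L2norm Pi (fun x => kernel_op Pt t phiK x - \int[Pi]_y phiK y) <=
    Num.sqrt (2 * (L + 1) * m) * rho t.
  apply: L2norm_le; first by rewrite mulr_ge0 ?sqrtr_ge0.
  rewrite exprMn sqr_sqrtr; last by rewrite !mulr_ge0// addr_ge0.
  rewrite rho2 [leRHS](_ : _ = (2 * (L + 1) * (K ^+ 2 * r)) * m); last by ring.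
  rewrite -prob_intZ; last exact: M_integrable.
  apply: prob_int_le.
  - apply: bounded_mfun_integrable; apply: bounded_mfunX; exact: bounded_mfunB.
  - by apply: real_integrableZ; exact: M_integrable.
  move=> x; rewrite -real_normK ?num_real// expr2.
  (* Only one factor of the square is estimated by [BL_bound], the other by [2 * K]: a single [M x]
     appears, and it is [M], not its square, that is assumed integrable. *)
  have le1 := BL_bound hBL t x L0 K0 phiKL phiKK.
  have le2 : `|kernel_op Pt t phiK x - \int[Pi]_y phiK y| <= 2 * K.
    rewrite (le_trans (ler_normB _ _))// mulr_natl mulr2n lerD//.
      exact: kernel_op_bound.
    exact: prob_int_bound.
  apply: le_trans (ler_pM (normr_ge0 _) (normr_ge0 _) le2 le1) _.
  rewrite (_ : 2 * (L + 1) * (K ^+ 2 * r) * M x = 2 * K * ((L * K + K) * (M x * r))); last by ring.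
  rewrite ler_wpM2l ?mulr_ge0 ?(ltW K0)// ler_wpM2r//.
    by rewrite mulr_ge0 ?(ltW r0)// (le_trans ler01).
  by rewrite lerD2r ler_peMr.
have e1 : (fun x => kernel_op Pt t phi x - \int[Pi]_y phi y) =
    (fun x => (kernel_op Pt t phiK x - \int[Pi]_y phiK y) +
      (kernel_op Pt t (fun x => phi x - phiK x) x - \int[Pi]_y (phi y - phiK y))).
  apply/funext => x; rewrite (kernel_opB Pt t bphi bphiK).
  rewrite prob_intB; [|exact: bounded_mfun_integrable..].
  by ring.
rewrite e1.
have s1 := bounded_mfun_sq Pi (bounded_mfunB bPK (bc (\int[Pi]_y phiK y))).
have s2 := bounded_mfun_sq Pi (bounded_mfunB bPpsi (bc (\int[Pi]_y (phi y - phiK y)))).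
apply: le_trans (L2norm_triangle s1 s2) _.
rewrite /decay_cst mulrDl lerD//.
have := (centered_L2norm (bounded_mfun_sq Pi bPpsi)).2.
rewrite (kernel_op_expectation hX t bpsi) => /le_trans; apply.
rewrite -mulrA ler_wpM2l//; apply: le_trans (kernel_op_L2norm hX t bpsi) _.
by rewrite rhoE.
Qed.

End correlation_decay.

(** * Second moments of stationary sums *)

Section stationary_sums.
Context d (Omega : measurableType d) dX (X : measurableType dX) (R : realType).
Variables (P : probability Omega R) (Pi : probability X R).
Variables (Pt : nat -> R.-pker X ~> X) (X_ : nat -> {RV P >-> X}).
Hypothesis hX : stationary_markov Pi Pt X_.

Let bfull i (f : X -> R) : bounded_mfun f -> bounded_mfun (fun w => f (X_ i w)).
Proof. by move=> bf; apply: bounded_mfun_comp bf _. Qed.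

Lemma kernel_op0_L2norm (phi : X -> R) : bounded_mfun phi ->
  L2norm Pi (kernel_op Pt 0 phi) = L2norm Pi phi.
Proof.
move=> bphi; have b0 := kernel_op_bounded Pt 0 bphi.
apply/eqP; rewrite -subr_eq0 -normr_le0.
apply: le_trans (L2norm_dist (bounded_mfun_sq Pi b0) (bounded_mfun_sq Pi bphi)) _.
by rewrite /L2norm (kernel_op0_sq hX bphi) sqrtr0.
Qed.

Lemma autocovariance_le (phi : X -> R) s t : bounded_mfun phi ->
  \int[P]_w (phi (X_ s w) * phi (X_ (s + t)%N w)) <=
    L2norm Pi phi * L2norm Pi (kernel_op Pt t phi).
Proof.
move=> bphi; have bt := kernel_op_bounded Pt t bphi.
have pphi : @bounded_mfun _ (past_type X_ s) R (fun w => phi (X_ s w)).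
  by apply: (bounded_mfun_comp bphi); exact: measurable_past.
rewrite (markov_expectation hX t pphi bphi).
rewrite (stationary_expectation hX s (f := fun x => phi x * kernel_op Pt t phi x)); last first.
  by apply: bounded_mfun_integrable; exact: bounded_mfunM.
apply: le_trans (ler_norm _) _.
exact: cauchy_schwarz (bounded_mfun_sq Pi bphi) (bounded_mfun_sq Pi bt).
Qed.

(** A new summand adds its square and twice its covariances with the earlier ones. By the Markov
    property a covariance at lag [t] is the inner product of [phi] and [P_t phi], so summability
    over lags makes each increase at most a constant. The norm of [phi] remains as a factor, which
    is the source of smallness later. *)
Lemma sum_sqr_le (phi : X -> R) (S : R) n : bounded_mfun phi ->
  (forall N, \sum_(t < N) L2norm Pi (kernel_op Pt t phi) <= S) ->
  \int[P]_w ((\sum_(s < n) phi (X_ s w)) ^+ 2) <= 2 * L2norm Pi phi * S * n%:R.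
Proof.
move=> bphi sumS; have bX i := bfull i bphi.
pose Sn n w := \sum_(s < n) phi (X_ s w).
have bS k : bounded_mfun (Sn k).
  exact: (@bounded_mfun_sum _ _ _ k (fun s w => phi (X_ s w))).
have SS k w : Sn k.+1 w = Sn k w + phi (X_ k w) by rewrite /Sn big_ord_recr.
elim: n => [|n ih].
  rewrite mulr0 -[leRHS](prob_int_cst P 0) le_eqVlt; apply/orP; left; apply/eqP.
  by apply: eq_Rintegral => w _; rewrite big_ord0 expr0n.
have b1 : bounded_mfun (fun w => Sn n w ^+ 2) by exact: bounded_mfunX.
have b2 : bounded_mfun (fun w => Sn n w * phi (X_ n w)) by exact: bounded_mfunM.
have b2' : bounded_mfun (fun w => 2 * (Sn n w * phi (X_ n w))) by exact: bounded_mfunZ.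
have b3 : bounded_mfun (fun w => phi (X_ n w) ^+ 2) by exact: bounded_mfunX.
have -> : \int[P]_w ((\sum_(s < n.+1) phi (X_ s w)) ^+ 2) =
    \int[P]_w (Sn n w ^+ 2) + (2 * \int[P]_w (Sn n w * phi (X_ n w)) +
      \int[P]_w (phi (X_ n w) ^+ 2)).
  rewrite -prob_intZ -?prob_intD; try exact: bounded_mfun_integrable;
    try by apply: bounded_mfun_integrable; exact: bounded_mfunD.
  by apply: eq_Rintegral => w _; rewrite -/(Sn n.+1 w) SS; ring.
rewrite -[n.+1%:R]natr1 mulrDr mulr1; apply: lerD ih _.
pose b t := L2norm Pi (kernel_op Pt t phi).
have n0 : 0 <= L2norm Pi phi := L2norm_ge0 _ _.
have cross : \int[P]_w (Sn n w * phi (X_ n w)) <= L2norm Pi phi * \sum_(s < n) b s.+1.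
  under eq_Rintegral do rewrite mulr_suml.
  rewrite (prob_int_sum P n (F := fun s w => phi (X_ s w) * phi (X_ n w))); last first.
    by move=> i; exact: bounded_mfunM.
  (* Reversing the index turns the sum over earlier times into a sum over lags [s.+1]. *)
  rewrite mulr_sumr (reindex_inj rev_ord_inj)/=; apply: ler_sum => s _.
  have := autocovariance_le (n - s.+1) s.+1 bphi.
  by rewrite subnK.
have diag : \int[P]_w (phi (X_ n w) ^+ 2) <= L2norm Pi phi * b 0.
  rewrite /b kernel_op0_L2norm// -expr2 L2norm_sqr.
  rewrite (stationary_expectation hX n (f := fun x => phi x ^+ 2))//.
  by apply: bounded_mfun_integrable; exact: bounded_mfunX.
have := sumS n.+1; rewrite big_ord_recl -/(b 0) => sumS'.
have b0 : 0 <= b 0 := L2norm_ge0 _ _.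
have nb : 0 <= L2norm Pi phi * b 0 by rewrite mulr_ge0.
apply: (le_trans (y := 2 * L2norm Pi phi * (b 0 + \sum_(s < n) b s.+1))).
  by lra.
by rewrite ler_wpM2l// mulr_ge0.
Qed.

(** The norm bound is crude, of order [n] where sqrt n is the right scale; it serves for errors that
    are null or can be made small once [n] is fixed. *)
Lemma sum_L2norm_le (F : X -> R) n : sq_integrable Pi F ->
  sq_integrable P (fun w => \sum_(s < n) F (X_ s w)) /\
  L2norm P (fun w => \sum_(s < n) F (X_ s w)) <= n%:R * L2norm Pi F.
Proof.
move=> sF.
have sX i : sq_integrable P (fun w => F (X_ i w)) := stationary_sq_integrable hX i sF.
have sS k : sq_integrable P (fun w => \sum_(s < k) F (X_ s w)).
  exact: (@sq_integrable_sum _ _ _ _ k (fun s w => F (X_ s w))).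
split => //; elim: n => [|n ih].
  rewrite mul0r (_ : (fun w => _) = fun=> 0); first by rewrite L2norm_cst normr0.
  by apply/funext => w; rewrite big_ord0.
rewrite (_ : (fun w => _) = fun w => \sum_(s < n) F (X_ s w) + F (X_ n w)); last first.
  by apply/funext => w; rewrite big_ord_recr.
apply: le_trans (L2norm_triangle (sS n) (sX n)) _.
by rewrite -natr1 mulrDl mul1r lerD// (stationary_L2norm hX n sF).
Qed.

Lemma sum_L2norm_sqrt (phi : X -> R) (S D dl : R) n : bounded_mfun phi ->
  (forall N, \sum_(t < N) L2norm Pi (kernel_op Pt t phi) <= S) -> 0 <= S ->
  L2norm Pi phi <= D -> 0 <= dl -> 2 * D * S <= dl ^+ 2 ->
  L2norm P (fun w => \sum_(s < n) phi (X_ s w)) <= dl * Num.sqrt n%:R.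
Proof.
move=> bphi sumS S0 phiD dl0 DS; apply: L2norm_le.
  by rewrite mulr_ge0// sqrtr_ge0.
rewrite exprMn sqr_sqrtr// (le_trans (sum_sqr_le n bphi sumS))// ler_wpM2r//.
apply: le_trans DS; rewrite ler_wpM2r// ler_wpM2l//.
Qed.

End stationary_sums.

Section martingale_approximation.
Context {R : realType} {X : pointedMetricType R}.
Context d (Omega : measurableType d) (P : probability Omega R)
  (Pi : probability (borel X) R) (Pt : nat -> R.-pker (borel X) ~> (borel X))
  (X_ : nat -> {RV P >-> borel X}).
Hypothesis hX : stationary_markov Pi Pt X_.
Variables (M : X -> R) (rate : R -> R).
Hypothesis mM : measurable_fun [set: borel X] (M : borel X -> R).
Hypothesis M_ge1 : forall x : X, 1 <= M x.
Hypothesis rate_range : forall u : R, 0 <= u -> 0 < rate u <= 1.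
Hypothesis hBL : forall (x : X) (t : nat),
  (BL_dist (Pt t x) Pi <= (M x * rate t%:R)%:E)%E.
Hypothesis M_int : (\int[Pi]_x (M x)%:E < +oo)%E.
Variables (p : R) (f : X -> R) (L S : R).
Hypothesis p_gt1 : 1 < p.
Hypothesis f_int : Pi.-integrable setT (EFin \o (fun x : borel X => `|f x| `^ (2 * p))).
Hypothesis L0 : 0 <= L.
Hypothesis fL : lip L f.
Hypothesis rho_sum : forall N, \sum_(t < N) rho rate p t <= S.

Let A : R := \int[Pi]_x (`|f x| `^ (2 * p)).
(** A difference of two [L]-Lipschitz truncations is [2 * L]-Lipschitz, so this one constant serves
    both for truncations and for their differences. *)
Let C := decay_cst Pi M p f (2 * L).
Let fc (x : borel X) : R := f x - \int[Pi]_y f y.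
Let ft K (x : X) : R := trunc K (f x).
Let ftc K (x : borel X) : R := ft K x - \int[Pi]_y ft K y.

Let L20 : 0 <= 2 * L. Proof. by rewrite mulr_ge0. Qed.
Let lip2 (h : X -> R) : lip L h -> lip (2 * L) h.
Proof.
move=> hL x y; apply: le_trans (hL x y) _.
by rewrite ler_wpM2r ?mdist_ge0// ler_peMl// ler1n.
Qed.
Let S0 : 0 <= S. Proof. by have := rho_sum 0; rewrite big_ord0. Qed.
Let C0 : 0 <= C.
Proof. by rewrite addr_ge0 ?mulr_ge0 ?sqrtr_ge0. Qed.
Let rho0 t : 0 <= rho rate p t. Proof. exact: powR_ge0. Qed.

Let ftL K : 0 <= K -> lip L (ft K). Proof. by move=> K0; exact: lip_trunc. Qed.
Let ftK K : 0 <= K -> forall x, `|ft K x| <= K.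
Proof. by move=> K0 x; exact: trunc_le. Qed.
Let bft K : 0 <= K -> bounded_mfun (ft K : borel X -> R).
Proof. by move=> K0; exact: lip_bounded_mfun L0 (ftL K0) (ftK K0). Qed.
Let ft_le K : 0 <= K -> forall x, `|ft K x| <= `|f x|.
Proof.
move=> K0 x; have h1 := ler_norm (f x); have h2 := ler_norm (- f x).
rewrite normrN in h2; rewrite /ft /trunc ler_norml.
by case: (ltP (f x)); case: (ltP K (f x)) => *; apply/andP; split; lra.
Qed.
Let bcst (c : R) : bounded_mfun (fun _ : borel X => c).
Proof. exact: bounded_mfun_cst. Qed.

Let kernel_op_centered t (h : borel X -> R) : bounded_mfun h ->
  kernel_op Pt t (fun x => h x - \int[Pi]_y h y) =
  (fun x => kernel_op Pt t h x - \int[Pi]_y h y).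
Proof. by move=> bh; rewrite (kernel_opB Pt t bh (bcst _)) kernel_op_cst. Qed.

Let powR_small e K : 0 < e -> exists N : R, K <= N /\ 0 < N /\ N `^ (1 - p) <= e.
Proof.
move=> e0; pose N := Num.max K (e^-1 `^ ((p - 1)^-1)).
have N0 : 0 < N by rewrite lt_max powR_gt0 ?orbT// invr_gt0.
exists N; split; [by rewrite le_max lexx|split => //].
have p10 : 0 < p - 1 by rewrite subr_gt0.
rewrite (_ : 1 - p = - (p - 1)); last by ring.
rewrite powRN -[leRHS]invrK lef_pV2 ?posrE ?invr_gt0 ?powR_gt0//.
rewrite [leLHS](_ : _ = (e^-1 `^ (p - 1)^-1) `^ (p - 1)); last first.
  by rewrite -powRrM mulVf ?gt_eqF// powRr1// invr_ge0 ltW.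
rewrite ge0_ler_powR ?nnegrE ?powR_ge0 ?(ltW p10) ?(ltW N0)//.
by rewrite le_max lexx orbT.
Qed.

Let rho_small e : 0 < e -> exists t, rho rate p t <= e.
Proof.
move=> e0; apply: contrapT => /forallNP h.
pose N := (Num.truncn (S / e)).+1.
have : e * N%:R <= S.
  apply: le_trans (rho_sum N); rewrite mulr_natr -[N in leLHS]card_ord -sumr_const.
  by apply: ler_sum => t _; rewrite leNgt; apply/negP => /ltW; exact: h.
by rewrite mulrC -ler_pdivlMr// leNgt truncnS_gt.
Qed.

(** The difference of truncations is [2 * L]-Lipschitz and dominated by [f], so its decay sum is at
    most [C * S], while its norm is that of the tail at [K]. Nothing depends on [N], which can
    therefore be sent to infinity. *)
Let truncated_sum K N n dl : 0 < K -> K <= N -> 0 <= dl ->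
  2 * (2 * (Num.sqrt A * K `^ (1 - p))) * (C * S) <= dl ^+ 2 ->
  L2norm P (fun w => \sum_(s < n) (ftc N (X_ s w) - ftc K (X_ s w))) <= dl * Num.sqrt n%:R.
Proof.
move=> K0 KN dl0 small; have N0 := lt_le_trans K0 KN.
pose h (x : X) := ft N x - ft K x.
have bh : bounded_mfun (h : borel X -> R).
  by apply: bounded_mfunB; apply: bft; exact: ltW.
have hL : lip (2 * L) h.
  move=> x y; rewrite /h (_ : _ - _ = (ft N x - ft N y) - (ft K x - ft K y)); last by ring.
  rewrite (le_trans (ler_normB _ _))// -mulrA mulr_natl mulr2n lerD//.
    exact: ftL (ltW N0) x y.
  exact: ftL (ltW K0) x y.
have hK x : `|h x| <= `|f x - ft K x| := trunc_sub_mono _ (ltW K0) KN.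
have hf x : `|h x| <= `|f x| := le_trans (hK x) (trunc_sub _ (ltW K0)).
have [B hB] := bh.2.
have intB : \int[Pi]_y h y = \int[Pi]_y ft N y - \int[Pi]_y ft K y.
  by rewrite prob_intB//; apply: bounded_mfun_integrable; apply: bft; exact: ltW.
rewrite (_ : (fun w => _) = (fun w => \sum_(s < n) ((fun x => h x - \int[Pi]_y h y) (X_ s w)))); last first.
  by apply/funext => w; apply: eq_bigr => s _; rewrite intB /ftc /h; ring.
have [sqK tailK] := trunc_tail_L2 p_gt1 f_int L0 fL (fun x => lexx _) K0.
have sqh := bounded_mfun_sq Pi bh.
apply: (sum_L2norm_sqrt hX (phi := fun x : borel X => h x - \int[Pi]_y h y)
  (S := C * S) (D := 2 * (Num.sqrt A * K `^ (1 - p)))) => //.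
- exact: bounded_mfunB.
- move=> k; apply: (le_trans (y := C * \sum_(t < k) rho rate p t)).
    rewrite mulr_sumr; apply: ler_sum => t _; rewrite kernel_op_centered//.
    exact: (lip_decay hX mM M_ge1 rate_range hBL M_int p_gt1 f_int t L20 hL hB hf).
  by rewrite ler_wpM2l.
- by rewrite mulr_ge0.
- apply: le_trans (centered_L2norm sqh).2 _; rewrite ler_wpM2l//.
  apply: le_trans tailK; apply: L2norm_le; first exact: L2norm_ge0.
  rewrite L2norm_sqr; apply: prob_int_le; [exact: sqh.2|exact: sqK.2|].
  move=> x; rewrite -real_normK ?num_real// -[leRHS]real_normK ?num_real//.
  by rewrite lerXn2r ?nnegrE.
Qed.

Let sqf : sq_integrable Pi (f : borel X -> R).
Proof. exact: (trunc_sq_integrable p_gt1 f_int L0 fL (fun x => lexx _)). Qed.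

Let sqfc : sq_integrable Pi fc. Proof. exact: (centered_L2norm sqf).1. Qed.

Let bftc K : 0 <= K -> bounded_mfun (ftc K).
Proof. by move=> K0; apply: bounded_mfunB; [exact: bft|exact: bcst]. Qed.

(** The covariance bound needs bounded functions, so [f] is reached through a second level [N],
    chosen after [n] and so high that the crude bound on the sum of the tails beyond [N] falls below
    [e]. *)
Let tail_sum K n dl : 0 < K -> 0 <= dl ->
  2 * (2 * (Num.sqrt A * K `^ (1 - p))) * (C * S) <= dl ^+ 2 ->
  L2norm P (fun w => \sum_(s < n) (fc (X_ s w) - ftc K (X_ s w))) <= dl * Num.sqrt n%:R.
Proof.
move=> K0 dl0 small; apply/ler_addgt0Pl => e e0.
pose B := n%:R * (2 * Num.sqrt A) + 1.
have B0 : 0 < B by rewrite ltr_wpDl// !mulr_ge0 ?sqrtr_ge0.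
have [N [KN [N0 Ne]]] := powR_small K (divr_gt0 e0 B0).
have [sqN tailN] := trunc_tail_L2 p_gt1 f_int L0 fL (fun x => lexx _) N0.
have [sqNc tailNc] := centered_L2norm sqN.
have [s1 le1] := sum_L2norm_le hX n sqNc.
have le2 := truncated_sum n K0 KN dl0 small.
have s2 : sq_integrable P (fun w => \sum_(s < n) (ftc N (X_ s w) - ftc K (X_ s w))).
  apply: (sum_L2norm_le hX n (F := fun x => ftc N x - ftc K x) _).1.
  by apply: bounded_mfun_sq; apply: bounded_mfunB; apply: bftc; exact: ltW.
rewrite (_ : (fun w => _) = fun w => \sum_(s < n)
    ((fun x : borel X => f x - trunc N (f x) - \int[Pi]_y (f y - trunc N (f y))) (X_ s w)) +
    \sum_(s < n) (ftc N (X_ s w) - ftc K (X_ s w))); last first.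
  apply/funext => w; rewrite -big_split/=; apply: eq_bigr => s _.
  rewrite prob_intB; [|exact: sq_integrable_integrable|].
    by rewrite /fc /ftc /ft; ring.
  by apply: bounded_mfun_integrable; apply: bft; exact: ltW.
apply: le_trans (L2norm_triangle s1 s2) _.
rewrite [leRHS]addrC addrC; apply: lerD => //.
apply: le_trans le1 _; apply: (le_trans (y := B * (e / B))); last first.
  by rewrite mulrC divfK// gt_eqF.
apply: (le_trans (y := n%:R * (2 * (Num.sqrt A * N `^ (1 - p))))).
  by rewrite ler_wpM2l//; apply: le_trans tailNc _; rewrite ler_wpM2l.
rewrite (_ : n%:R * _ = n%:R * (2 * Num.sqrt A) * N `^ (1 - p)); last by ring.
by rewrite ler_pM ?powR_ge0// ?lerDl// !mulr_ge0 ?sqrtr_ge0.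
Qed.

(** The centered [f] splits into its tail beyond the level [K], the coboundary [g - P_1 g], the term
    [P_T (ftc K)] and an L_2-null remainder [r]. The tail and [P_T (ftc K)] get [dl / 2] each: their
    norms are made small by the choice of [K] and of [T], while their decay sums stay below
    [C * S]. *)
Lemma martingale_approximation dl : 0 < dl -> exists2 g : borel X -> R, bounded_mfun g &
  forall n, L2norm P (fun w => \sum_(s < n)
    (f (X_ s w) - \int[Pi]_y f y - (g (X_ s w) - kernel_op Pt 1 g (X_ s w)))) <=
    dl * Num.sqrt n%:R.
Proof.
move=> dl0; have dl20 : 0 < dl / 2 by rewrite divr_gt0.
have dl2sq : 0 < (dl / 2) ^+ 2 by rewrite exprn_gt0.
pose B1 := 2 * (2 * Num.sqrt A) * (C * S) + 1.
have B10 : 0 < B1 by rewrite ltr_wpDl// !mulr_ge0 ?sqrtr_ge0.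
have [K [_ [K0 Ke]]] := powR_small 0 (divr_gt0 dl2sq B10).
have smallK : 2 * (2 * (Num.sqrt A * K `^ (1 - p))) * (C * S) <= (dl / 2) ^+ 2.
  rewrite (_ : _ * _ = (2 * (2 * Num.sqrt A) * (C * S)) * K `^ (1 - p)); last by ring.
  apply: (le_trans (y := B1 * ((dl / 2) ^+ 2 / B1))); last by rewrite mulrC divfK// gt_eqF.
  by rewrite ler_pM ?powR_ge0// ?lerDl// !mulr_ge0 ?sqrtr_ge0.
pose B2 := 2 * C * (C * S) + 1.
have B20 : 0 < B2 by rewrite ltr_wpDl// !mulr_ge0.
have [T Te] := rho_small (divr_gt0 dl2sq B20).
have bK := bftc (ltW K0).
pose g := resolvent Pt T (ftc K).
have bg : bounded_mfun g := bounded_resolvent Pt T bK.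
exists g => // n.
have bT := kernel_op_bounded Pt T bK.
have decay t : L2norm Pi (kernel_op Pt t (ftc K)) <= C * rho rate p t.
  rewrite /ftc kernel_op_centered; last exact: bft (ltW K0).
  exact: (lip_decay hX mM M_ge1 rate_range hBL M_int p_gt1 f_int t L20
    (lip2 (ftL (ltW K0))) (ftK (ltW K0)) (ft_le (ltW K0))).
have le1 : L2norm P (fun w => \sum_(s < n) kernel_op Pt T (ftc K) (X_ s w)) <= dl / 2 * Num.sqrt n%:R.
  apply: (sum_L2norm_sqrt hX (phi := kernel_op Pt T (ftc K))
    (S := C * S) (D := C * rho rate p T)) => //.
  (* Shifted by [T], the decay sum consists of the last [k] terms of a sum of [T + k] nonnegative
     ones, hence stays below [S]. *)
  - move=> k; apply: (le_trans (y := C * \sum_(t < k) rho rate p (t + T))).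
      rewrite mulr_sumr; apply: ler_sum => t _.
      by rewrite (kernel_opS_L2norm hX t T bK).
    rewrite ler_wpM2l//; apply: le_trans (rho_sum (T + k)).
    rewrite big_split_ord/= -[leLHS]add0r lerD ?sumr_ge0//.
    by apply: ler_sum => t _; rewrite addnC.
  - by rewrite mulr_ge0.
  - exact: ltW.
  rewrite [leLHS](_ : _ = (2 * C * (C * S)) * rho rate p T); last by ring.
  apply: (le_trans (y := B2 * ((dl / 2) ^+ 2 / B2))); last by rewrite mulrC divfK// gt_eqF.
  by rewrite ler_pM// ?lerDl// !mulr_ge0.
have le2 := tail_sum n K0 (ltW dl20) smallK.
pose r (x : borel X) := ftc K x - (g x - kernel_op Pt 1 g x) - kernel_op Pt T (ftc K) x.
have br : bounded_mfun r.
  do !apply: bounded_mfunB => //; exact: kernel_op_bounded.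
have r0 : L2norm Pi r = 0 := resolvent_eq hX T bK.
have [s3 le3] := sum_L2norm_le hX n (bounded_mfun_sq Pi br).
rewrite r0 mulr0 in le3.
have [s1 _] := sum_L2norm_le hX n (bounded_mfun_sq Pi bT).
have [s2 _] := sum_L2norm_le hX n (sq_integrableB sqfc (bounded_mfun_sq Pi bK)).
rewrite (_ : (fun w => _) = fun w => \sum_(s < n) (fc (X_ s w) - ftc K (X_ s w)) +
    (\sum_(s < n) kernel_op Pt T (ftc K) (X_ s w) + \sum_(s < n) r (X_ s w))); last first.
  apply/funext => w; rewrite -!big_split/=; apply: eq_bigr => s _.
  by rewrite /r /fc; ring.
apply: le_trans (L2norm_triangle s2 (sq_integrableD s1 s3)) _.
rewrite [X in _ <= X * _](splitr dl) mulrDl lerD//.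
apply: le_trans (L2norm_triangle s1 s3) _.
by rewrite -[leRHS]addr0 lerD.
Qed.

End martingale_approximation.

(** * Passage to the limit *)

Section central_limit.
Context d (Omega : measurableType d) dX (X : measurableType dX) (R : realType).
Variables (P : probability Omega R) (Pi : probability X R).
Variables (Pt : nat -> R.-pker X ~> X) (X_ : nat -> {RV P >-> X}).
Hypothesis hX : stationary_markov Pi Pt X_.
Hypothesis dense : coboundary_dense Pi Pt.
Variable f : X -> R.
Hypothesis sqf : sq_integrable Pi f.
Hypothesis approx : forall dl, 0 < dl -> exists2 g : X -> R, bounded_mfun g &
  forall n, L2norm P (fun w => \sum_(s < n)
    (f (X_ s w) - \int[Pi]_y f y - (g (X_ s w) - kernel_op Pt 1 g (X_ s w)))) <=
    dl * Num.sqrt n%:R.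

Definition centered_sum n (w : Omega) : R := \sum_(s < n) (f (X_ s w) - \int[Pi]_y f y).
Let S := centered_sum.
Let c n : R := (Num.sqrt n%:R)^-1.

Let sqfc : sq_integrable Pi (fun x => f x - \int[Pi]_y f y).
Proof. by apply: sq_integrableB => //; exact: sq_integrable_cst. Qed.

Let sqS n : sq_integrable P (S n).
Proof. exact: (sum_L2norm_le hX n sqfc).1. Qed.

Let sqrtn_gt0 n : (0 < n)%N -> 0 < Num.sqrt n%:R :> R.
Proof. by move=> n0; rewrite sqrtr_gt0 ltr0n. Qed.

Let c_cvg0 : c n @[n --> \oo] --> (0 : R).
Proof.
apply/cvgr0Pnorm_le => e e0.
exists (Num.truncn (e ^- 2)).+1 => // n /= Nn.
have n0 : (0 < n)%N by exact: leq_trans Nn.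
rewrite ger0_norm ?invr_ge0 ?sqrtr_ge0// /c -[leRHS]invrK.
rewrite lef_pV2 ?posrE ?invr_gt0 ?sqrtn_gt0// -[leLHS]gtr0_norm ?invr_gt0//.
rewrite -sqrtr_sqr ler_wsqrtr// exprVn.
by apply: le_trans (ltW (truncnS_gt _)) _; rewrite ler_nat.
Qed.

Let c_small e : 0 < e -> \forall n \near \oo, (0 < n)%N /\ c n <= e.
Proof.
move=> e0; near=> n; split; first by near: n; exact: nbhs_infty_gt.
apply: le_trans (ler_norm _) _; near: n.
by move/cvgr0Pnorm_le : c_cvg0; exact.
Unshelve. all: by end_near. Qed.

Lemma martingale_dist dl : 0 < dl -> exists2 g : X -> R, bounded_mfun g &
  exists2 B : R, 0 <= B &
  forall n, L2norm P (fun w => S n w - martingale Pt X_ g n w) <=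
    dl * Num.sqrt n%:R + B.
Proof.
move=> dl0; have [g bg hg] := approx dl0; exists g => //.
have [B gB] := bg.2.
have B0 : 0 <= B by apply: le_trans (gB point).
exists (2 * B); first by rewrite mulr_ge0.
move=> n.
have bX i : bounded_mfun (fun w => g (X_ i w)) by apply: bounded_mfun_comp bg _.
have sqg : sq_integrable Pi (fun x => f x - \int[Pi]_y f y - (g x - kernel_op Pt 1 g x)).
  apply: sq_integrableB => //; apply: bounded_mfun_sq; apply: bounded_mfunB => //.
  exact: kernel_op_bounded.
have [s1 _] := sum_L2norm_le hX n sqg.
have s2 := bounded_mfun_sq P (bounded_mfunB (bX 0%N) (bX n)).
rewrite (_ : (fun w => S n w - _) = fun w => \sum_(s < n)
    (f (X_ s w) - \int[Pi]_y f y - (g (X_ s w) - kernel_op Pt 1 g (X_ s w))) +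
    (g (X_ 0%N w) - g (X_ n w))); last first.
  apply/funext => w; rewrite /S /centered_sum /martingale.
  elim: n {s1 s2} => [|n ih]; first by rewrite !big_ord0 !subrr addr0.
  rewrite !big_ord_recr/= /increment.
  by move: ih; move: (\sum_(s < n) _) (\sum_(s < n) _) (\sum_(s < n) _) => a b c' ih; lra.
apply: le_trans (L2norm_triangle s1 s2) _; apply: lerD; first exact: hg.
apply: L2norm_le; first by rewrite mulr_ge0.
apply: le_trans (ler_norm _) _; apply: prob_int_bound.
  by apply: bounded_mfunX; exact: bounded_mfunB.
move=> w; rewrite normrX lerXn2r ?nnegrE ?mulr_ge0//.
by rewrite (le_trans (ler_normB _ _))// mulr_natl mulr2n lerD.
Qed.

(** Standard deviations rather than variances: they are L_2 norms, so two of them differ by at most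
    the L_2 distance of the variables, and the approximation error passes to them directly. *)
Let sn n : R := c n * L2norm P (S n).

Let increment_sd g := Num.sqrt (increment_variance Pi Pt g).

Let sn_dist dl g B n : bounded_mfun g -> (0 < n)%N ->
  L2norm P (fun w => S n w - martingale Pt X_ g n w) <= dl * Num.sqrt n%:R + B ->
  `|sn n - increment_sd g| <= dl + B * c n.
Proof.
move=> bg n0 le1.
have sqM : sq_integrable P (martingale Pt X_ g n).
  by apply: bounded_mfun_sq; exact: bounded_past (bounded_martingale Pt X_ bg (leqnn n)).
have sdE : increment_sd g = c n * L2norm P (martingale Pt X_ g n).
  rewrite /L2norm (martingale_variance hX bg) sqrtrM; last exact: (increment_variance_ge0 hX bg).
  by rewrite mulrC -mulrA divff ?mulr1// gt_eqF// sqrtn_gt0.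
have cn0 : 0 < c n by rewrite invr_gt0 sqrtn_gt0.
rewrite sdE -mulrBr normrM gtr0_norm//.
apply: (le_trans (y := c n * (dl * Num.sqrt n%:R + B))).
  by rewrite ler_wpM2l ?(ltW cn0)//; apply: le_trans (L2norm_dist (sqS n) sqM) le1.
by rewrite mulrDr mulrCA mulVf ?mulr1 ?gt_eqF ?sqrtn_gt0// mulrC.
Qed.

Lemma sn_cvg : cvgn sn.
Proof.
apply: cauchy_cvg; apply: cauchy_exP => e e0.
have [g bg [B B0 hg]] := martingale_dist (divr_gt0 e0 (ltr0Sn R 1)).
exists (increment_sd g).
have e2 : 0 < e / 4 / (B + 1) by rewrite !divr_gt0// ltr_wpDl.
suff : \forall n \near \oo, ball (increment_sd g) e (sn n) by [].
near=> n.
have [n0 cn] : (0 < n)%N /\ c n <= e / 4 / (B + 1) by near: n; exact: c_small.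
rewrite /ball/= distrC (le_lt_trans (sn_dist bg n0 (hg n)))//.
have : B * c n <= e / 4.
  apply: (le_trans (y := (B + 1) * (e / 4 / (B + 1)))).
    by rewrite ler_pM ?lerDl// invr_ge0 sqrtr_ge0.
  by rewrite mulrC divfK// gt_eqF// ltr_wpDl.
by move: (B * c n) => t tle; lra.
Unshelve. all: by end_near. Qed.

Definition limit_sd : R := limn sn.
Let sg := limit_sd.

Let sn_sg : sn n @[n --> \oo] --> sg. Proof. exact: sn_cvg. Qed.

Lemma limit_sd_ge0 : 0 <= sg.
Proof.
apply: limr_ge; first exact: sn_cvg.
by apply: nearW => n; rewrite mulr_ge0 ?invr_ge0 ?sqrtr_ge0.
Qed.

Let increment_sd_dist dl g B : bounded_mfun g -> 0 <= B ->
  (forall n, L2norm P (fun w => S n w - martingale Pt X_ g n w) <= dl * Num.sqrt n%:R + B) ->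
  `|sg - increment_sd g| <= dl.
Proof.
move=> bg B0 hg; apply/ler_addgt0Pl => e e0.
have e2 : 0 < e / 2 / (B + 1) by rewrite !divr_gt0// ltr_wpDl.
have e20 : 0 < e / 2 by rewrite divr_gt0.
near \oo%classic => n.
have [n0 cn] : (0 < n)%N /\ c n <= e / 2 / (B + 1) by near: n; exact: c_small.
have le1 : `|sg - sn n| <= e / 2.
  by near: n; move/cvgrPdist_le : sn_sg; exact.
have le2 := sn_dist bg n0 (hg n).
have le3 : B * c n <= e / 2.
  apply: (le_trans (y := (B + 1) * (e / 2 / (B + 1)))).
    by rewrite ler_pM ?lerDl// invr_ge0 sqrtr_ge0.
  by rewrite mulrC divfK// gt_eqF// ltr_wpDl.
rewrite (_ : sg - _ = (sg - sn n) + (sn n - increment_sd g)); last by ring.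
apply: le_trans (ler_normD _ _) _.
by move: (B * c n) le2 le3 le1 => t le2 le3 le1; lra.
Unshelve. all: by end_near. Qed.

Lemma variance_cvg :
  variance P (fun w => (Num.sqrt n%:R)^-1 * \sum_(s < n) f (X_ s w))
    @[n --> \oo] --> (sg ^+ 2)%:E.
Proof.
have vE n : variance P (fun w => (Num.sqrt n%:R)^-1 * \sum_(s < n) f (X_ s w)) = (sn n ^+ 2)%:E.
  have sqX i : sq_integrable P (fun w => f (X_ i w)) := stationary_sq_integrable hX i sqf.
  have sqY k : sq_integrable P (fun w => \sum_(s < k) f (X_ s w)).
    exact: (@sq_integrable_sum _ _ _ _ k (fun s w => f (X_ s w))).
  have EY : fine ('E_P[(fun w => (Num.sqrt n%:R)^-1 * \sum_(s < n) f (X_ s w))%R])%E =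
      c n * (n%:R * \int[Pi]_y f y).
    rewrite unlock -[LHS]/(\int[P]_w (c n * \sum_(s < n) f (X_ s w))).
    rewrite prob_intZ; last exact: sq_integrable_integrable.
    congr (_ * _); elim: n => [|n ih].
      rewrite mul0r -[RHS](prob_int_cst P).
      by apply: eq_Rintegral => w _; rewrite big_ord0.
    under eq_Rintegral do rewrite big_ord_recr/=.
    rewrite prob_intD; [|exact: (sq_integrable_integrable (sqY n))
      |exact: (sq_integrable_integrable (sqX n))].
    rewrite ih (stationary_expectation hX n (sq_integrable_integrable sqf)).
    by rewrite -natr1 mulrDl mul1r.
  rewrite /variance unlock EY unlock.
  rewrite /sn exprMn L2norm_sqr -[X in _ = X%:E]prob_intZ; last exact: (sqS n).2.
  rewrite /Rintegral fineK; last first.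
    apply: integrable_fin_num => //.
    exact: real_integrableZ (sqS n).2.
  apply: eq_integral => w _; congr EFin => /=.
  rewrite [(_ * _) w]/(_ * _)/= /c -exprMn expr2.
  have -> : c n * \sum_(s < n) f (X_ s w) - c n * (n%:R * \int[Pi]_y f y) = c n * S n w.
    rewrite -mulrBr; congr (_ * _); rewrite /S /centered_sum sumrB; congr (_ - _).
    by rewrite sumr_const card_ord mulr_natl.
  by [].
under eq_fun do rewrite vE.
apply: cvg_EFin; first exact: nearW.
by under eq_fun do rewrite expr2; rewrite expr2; exact: cvgM.
Qed.

Let measurable_cS n : measurable_fun setT (fun w => c n * S n w).
Proof. by apply: measurable_funM => //; exact: (sqS n).1. Qed.

(** Three comparisons: the limit variance with that of the martingale, by continuity of [heat0] in
    the variance; the sums of [f] with the martingale, by the Lipschitz bound in space; the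
    martingale with the Gaussian. The order of choices is [dl], then [g] with its constants, and [n]
    last. *)
Lemma smooth_clt (z e : R) : 0 < e ->
  \int[P]_w heat0 z e (c n * S n w) @[n --> \oo] --> heat0 z (e + sg ^+ 2) 0.
Proof.
move=> e0; apply/cvgrPdist_le => /= eta eta0.
have split3 (a b u w : R) : a - w = (a - b) - (u - b) - (w - u) by ring.
have [C C0 bounds] := heat_bounds z e0.
have [[_ _ lipC _ _] _] := bounds e (lexx e).
have cont : continuous_at sg (fun s : R => heat0 z (e + s ^+ 2) 0).
  apply: (@continuous_comp R R R (fun s : R => e + s ^+ 2) (fun v : R => heat0 z v 0)).
    apply: (@continuousD _ R R (cst e) (fun s : R => s ^+ 2)).
      exact: cst_continuous.
    exact: exprn_continuous.
  apply: differentiable_continuous; apply/derivable1_diffP.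
  have v0 : 0 < e + sg ^+ 2 by rewrite ltr_pwDl// sqr_ge0.
  exact: (@ex_derive _ _ _ _ _ _ _ (is_derive_heat0v z 0 v0)).
have eta5 : 0 < eta / 5 by rewrite divr_gt0.
have /cvgrPdist_le/(_ _ eta5)/nbhs_ballP[r /= r0 hr] := cont.
have C1 : 0 < C + 1 by rewrite ltr_wpDl.
(* The first bound keeps the standard deviation of the martingale within the continuity radius at
   [sg], the second makes [C * dl] small. *)
pose dl := Num.min (r / 2) (eta / 5 / (C + 1)).
have dl0 : 0 < dl by rewrite lt_min !divr_gt0.
have dlr : dl < r by rewrite gt_min; apply/orP; left; lra.
have Cdl : C * dl <= eta / 5.
  apply: (le_trans (y := (C + 1) * (eta / 5 / (C + 1)))); last first.
    by rewrite mulrC divfK// gt_eqF.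
  by rewrite ler_pM ?lerDl ?(ltW dl0)// ge_min lexx orbT.
have [g bg [B B0 hg]] := martingale_dist dl0.
have sgg := increment_sd_dist bg B0 hg.
have le1 : `|heat0 z (e + sg ^+ 2) 0 - heat0 z (e + increment_variance Pi Pt g) 0| <= eta / 5.
  have -> : increment_variance Pi Pt g = increment_sd g ^+ 2.
    by rewrite sqr_sqrtr//; exact: (increment_variance_ge0 hX bg).
  by apply: hr; rewrite /ball/=; exact: le_lt_trans dlr.
have [D D0 clt] := martingale_clt_bound hX dense bg z e0.
have D1 : 0 < D + 1 by rewrite ltr_wpDl.
have [D' clt'] := clt _ (divr_gt0 eta5 D1).
have Ddl : D * (eta / 5 / (D + 1)) <= eta / 5.
  apply: (le_trans (y := (D + 1) * (eta / 5 / (D + 1)))); last first.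
    by rewrite mulrC divfK// gt_eqF.
  by rewrite ler_wpM2r ?lerDl// !divr_ge0 ?(ltW eta0) ?(ltW D1).
(* Collects the coefficients of [c n], all fixed before [n]; the absolute value is there because
   [D'] has no known sign. *)
pose E := `|D'| + C * B + 1.
have E0 : 0 < E by rewrite ltr_wpDl// addr_ge0// mulr_ge0.
have E2 : 0 < eta / 5 / E by rewrite !divr_gt0.
near=> n.
have [n0 cn] : (0 < n)%N /\ c n <= eta / 5 / E by near: n; exact: c_small.
have cn0 : 0 < c n by rewrite invr_gt0 sqrtn_gt0.
have Ec : E * c n <= eta / 5 by rewrite mulrC -ler_pdivlMr.
have := clt' n n0; rewrite -/(c n) => le2.
have pM := bounded_past (bounded_martingale Pt X_ bg (leqnn n)).
have bheat (Y : Omega -> R) : measurable_fun setT Y -> bounded_mfun (fun w => heat0 z e (Y w)).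
  move=> mY; split; first by apply: measurableT_comp => //; exact: measurable_heat0.
  by exists 1 => w; rewrite ger0_norm ?ncdf_ge0// ncdf_le1.
have b1 := bheat _ (measurable_cS n).
have b2 := bheat _ (bounded_mfunZ (c n) pM).1.
have sqD := sq_integrableB (sqS n) (bounded_mfun_sq P pM).
have le3 : `|\int[P]_w heat0 z e (c n * S n w) -
    \int[P]_w heat0 z e (c n * martingale Pt X_ g n w)| <= C * (dl + B * c n).
  rewrite -prob_intB; [|exact: bounded_mfun_integrable..].
  have b12 := bounded_mfunB b1 b2.
  apply: le_trans (prob_int_norm (bounded_mfun_integrable P b12)) _.
  have iD : P.-integrable setT (EFin \o (fun w => `|S n w - martingale Pt X_ g n w|)).
    apply: (le_integrable _ _ _ (sq_integrable_integrable sqD)) => //.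
      by apply/measurable_EFinP; apply: measurableT_comp => //; exact: sqD.1.
    by move=> w _ /=; rewrite normr_id.
  apply: (le_trans (y := \int[P]_w (C * c n * `|S n w - martingale Pt X_ g n w|))).
    apply: prob_int_le; last first.
    - move=> w; rewrite -mulrA -[c n](gtr0_norm cn0) -normrM gtr0_norm//.
      have := lipC (c n * martingale Pt X_ g n w) (c n * (S n w - martingale Pt X_ g n w)).
      by rewrite -mulrDr subrKC.
    - exact: real_integrableZ.
    - by apply: bounded_mfun_integrable; exact: bounded_mfun_norm.
  rewrite prob_intZ// -mulrA ler_wpM2l//.
  apply: (le_trans (y := c n * (dl * Num.sqrt n%:R + B))).
    rewrite ler_wpM2l ?(ltW cn0)//; apply: le_trans (hg n).
    exact: prob_int_le_L2norm.
  by rewrite mulrDr mulrCA mulVf ?mulr1 ?gt_eqF ?sqrtn_gt0// mulrC.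
rewrite (split3 _ (heat0 z (e + increment_variance Pi Pt g) 0)
  (\int[P]_w heat0 z e (c n * martingale Pt X_ g n w))).
apply: le_trans (ler_normB _ _) _.
have : `|heat0 z (e + sg ^+ 2) 0 - heat0 z (e + increment_variance Pi Pt g) 0 -
  (\int[P]_w heat0 z e (c n * martingale Pt X_ g n w) - heat0 z (e + increment_variance Pi Pt g) 0)|
   <= eta / 5 + (D * (eta / 5 / (D + 1)) + D' * c n).
  by apply: le_trans (ler_normB _ _) _; exact: lerD.
have D'c : D' * c n <= `|D'| * c n by rewrite ler_wpM2r ?(ltW cn0)// ler_norm.
move: le3 Ec Cdl Ddl D'c; rewrite /E mulrDr !mulrDl mul1r mulrA.
move: (D * _) (D' * c n) (`|D'| * c n) (C * B * c n) (C * dl) (c n) cn0 `|_ - _| `|_ - _ - _|.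
by move=> *; lra.
Unshelve. all: by end_near. Qed.

End central_limit.

(** * Removal of the Gaussian smoothing *)

Section mollification.
Context {R : realType}.
Implicit Types (z s eta dl : R).

Lemma ncdf_tails eta : 0 < eta -> exists2 A : R, 0 < A &
  forall y, A <= y -> 1 - eta <= ncdf y /\ ncdf (- y) <= eta.
Proof.
move=> eta0.
have /cvgrPdist_le/(_ eta eta0)[A1 [_ h1]] := @cvg_ncdf_y R.
have /cvgrPdist_le/(_ eta eta0)[A2 [_ h2]] := @cvg_ncdf_Ny R.
exists (Num.max 1 (Num.max (A1 + 1) (- A2 + 1))); first by rewrite lt_max ltr01.
move=> y; rewrite !ge_max => /and3P[_ y1 y2]; split.
  have := h1 y; rewrite ler_norml => /(_ ltac:(lra))/andP[_].
  by lra.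
have := h2 (- y); rewrite ler_norml => /(_ ltac:(lra))/andP[].
by lra.
Qed.

Lemma gaussian_cdfE s z : 0 < s -> gaussian_cdf (s ^+ 2) z = (ncdf (z / s))%:E.
Proof.
move=> s0; rewrite /gaussian_cdf sqrf_eq0 gt_eqF// sqrtr_sqr gtr0_norm//.
exact: normal_prob_scale.
Qed.

(** The threshold moves by [dl] while the smoothing has standard deviation [dl ^+ 2], far smaller:
    the errors [ncdf] at [dl^-1] and [- dl^-1] vanish with [dl]. For [s > 0] the rest is continuity
    at [dl = 0]. For [s = 0] the smoothing is all that remains, and [(z + dl) / dl ^+ 2] and
    [(z - dl) / dl ^+ 2] go to infinity with the sign of [z]. *)
Lemma gaussian_mollified s z eta : 0 <= s -> s != 0 \/ z != 0 -> 0 < eta ->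
  exists2 dl : R, 0 < dl &
  [/\ heat0 (z + dl) (dl ^+ 4 + s ^+ 2) 0 + (1 - ncdf dl^-1) <=
        fine (gaussian_cdf (s ^+ 2) z) + eta &
      fine (gaussian_cdf (s ^+ 2) z) - eta <=
        heat0 (z - dl) (dl ^+ 4 + s ^+ 2) 0 - ncdf (- dl^-1)].
Proof.
move=> s0 sz eta0; have eta20 : 0 < eta / 2 by rewrite divr_gt0.
have [A A0 tails] := ncdf_tails eta20.
have [s00|sn0] := eqVneq s 0.
  have zn0 : z != 0 by case: sz; rewrite // s00 eqxx.
  have z0 : 0 < `|z| by rewrite normr_gt0.
  rewrite s00 /gaussian_cdf expr0n/= eqxx.
  (* [A^-1] puts [dl^-1] in the tails; [|z| / 2] leaves at least [|z| / 2] of the threshold after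
     the shift; [|z| / (2 * A)], with [dl <= 1], makes that at least [A] after division by
     [dl ^+ 2]. *)
  pose dl := Num.min 1 (Num.min A^-1 (Num.min (`|z| / 2) (`|z| / (2 * A)))).
  have dl0 : 0 < dl by rewrite !lt_min ltr01 invr_gt0 A0 !divr_gt0// mulr_gt0.
  have /and4P[dl1 dlA dlz dlzA] : [&& dl <= 1, dl <= A^-1, dl <= `|z| / 2 & dl <= `|z| / (2 * A)].
    by rewrite /dl !ge_min !lexx !orbT.
  exists dl => //.
  have [t1 t2] : 1 - eta / 2 <= ncdf dl^-1 /\ ncdf (- dl^-1) <= eta / 2.
    by apply: tails; rewrite -[leLHS]invrK lef_pV2 ?posrE ?invr_gt0.
  have d2 : Num.sqrt (dl ^+ 4 + 0) = dl ^+ 2.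
    by rewrite addr0 (exprM dl 2 2 : dl ^+ 4 = _) sqrtr_sqr ger0_norm// sqr_ge0.
  have d20 : 0 < dl ^+ 2 by rewrite exprn_gt0.
  have big (y : R) : `|z| / 2 <= y -> A <= y / dl ^+ 2.
    move=> zy; rewrite ler_pdivlMr// expr2 mulrA.
    apply: (le_trans (y := A * dl)).
      by rewrite ler_piMr// mulr_ge0// ltW.
    apply: le_trans zy; rewrite mulrC -ler_pdivlMr//.
    by apply: le_trans dlzA _; rewrite invfM mulrA.
  rewrite /heat0 !subr0 d2.
  have [zpos|zneg] := ltP 0 z.
    have zz : `|z| = z by rewrite gtr0_norm.
    have [h _] := tails _ (big (z - dl) ltac:(lra)).
    have := ncdf_le1 ((z + dl) / dl ^+ 2).
    by rewrite (ltW zpos)/=; split; lra.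
  have zneg' : z < 0 by rewrite lt_neqAle zn0.
  have zz : `|z| = - z by rewrite ltr0_norm.
  have [_ h] := tails _ (big (- (z + dl)) ltac:(lra)).
  rewrite mulNr opprK in h.
  have := ncdf_ge0 ((z - dl) / dl ^+ 2).
  by rewrite (leNgt 0 z) zneg'/=; split; lra.
have spos : 0 < s by rewrite lt_neqAle eq_sym sn0.
rewrite gaussian_cdfE//=.
(* Used with [a = 1] and [a = -1] for the two shifts; [s > 0] keeps the denominator away from 0 at
   [dl = 0]. *)
have cont (a : R) : heat0 (z + a * dl) (dl ^+ 4 + s ^+ 2) 0 @[dl --> (0 : R)] --> ncdf (z / s).
  have -> : z / s = (z + a * 0) / Num.sqrt (0 ^+ 4 + s ^+ 2).
    by rewrite mulr0 addr0 expr0n/= add0r sqrtr_sqr gtr0_norm.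
  have num : z + a * dl - 0 @[dl --> (0 : R)] --> z + a * 0.
    under eq_fun do rewrite subr0.
    by apply: cvgD; [exact: cvg_cst|apply: cvgM; [exact: cvg_cst|exact: cvg_id]].
  have pol : dl ^+ 4 + s ^+ 2 @[dl --> (0 : R)] --> 0 ^+ 4 + s ^+ 2.
    by apply: cvgD; [exact: exprn_continuous|exact: cvg_cst].
  have den := cvg_comp _ _ pol (@sqrt_continuous R _).
  have den0 : Num.sqrt (0 ^+ 4 + s ^+ 2) != 0 by rewrite expr0n/= add0r sqrtr_sqr normr_eq0.
  exact: (cvg_comp _ _ (cvgM num (cvgV den0 den)) (@continuous_ncdf R _)).
have /cvgrPdist_le/(_ _ eta20)/nbhs_ballP[r1 /= r10 hr1] := cont 1.
have /cvgrPdist_le/(_ _ eta20)/nbhs_ballP[r2 /= r20 hr2] := cont (- 1).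
pose dl := Num.min A^-1 (Num.min (r1 / 2) (r2 / 2)).
have dl0 : 0 < dl by rewrite !lt_min invr_gt0 A0 !divr_gt0.
have /and3P[dlA dlr1 dlr2] : [&& dl <= A^-1, dl <= r1 / 2 & dl <= r2 / 2].
  by rewrite /dl !ge_min !lexx !orbT.
exists dl => //.
have [t1 t2] : 1 - eta / 2 <= ncdf dl^-1 /\ ncdf (- dl^-1) <= eta / 2.
  by apply: tails; rewrite -[leLHS]invrK lef_pV2 ?posrE ?invr_gt0.
have b1 : ball (0 : R) r1 dl by rewrite /ball/= sub0r normrN gtr0_norm//; lra.
have b2 : ball (0 : R) r2 dl by rewrite /ball/= sub0r normrN gtr0_norm//; lra.
have := hr1 _ b1; have := hr2 _ b2; rewrite mulN1r mul1r !ler_norml => /andP[h1 h2] /andP[h3 h4].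
by split; lra.
Qed.

(* The tails of the mollified indicators: [x <= z] forces
   [(z + dl - x) / dl^2 >= dl^-1] and, conversely, [z < x] forces
   [(z - dl - x) / dl^2 <= - dl^-1]. *)
Lemma mollified_indicator_le z x dl : 0 < dl ->
  ((x <= z)%R%:R <= heat0 (z + dl) (dl ^+ 4) x + (1 - ncdf dl^-1)) /\
  (heat0 (z - dl) (dl ^+ 4) x - ncdf (- dl^-1) <= (x <= z)%R%:R).
Proof.
move=> dl0; have dn0 : dl != 0 by rewrite gt_eqF.
have d2 : Num.sqrt (dl ^+ 4) = dl ^+ 2.
  by rewrite (exprM dl 2 2 : dl ^+ 4 = _) sqrtr_sqr ger0_norm// sqr_ge0.
have d20 : 0 < dl ^+ 2 by rewrite exprn_gt0.
have dV : dl^-1 = dl / dl ^+ 2 by rewrite expr2 invfM mulrA divff// mul1r.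
rewrite /heat0 d2.
have [xz|zx] := leP x z; split => /=.
- have le1 : dl^-1 <= (z + dl - x) / dl ^+ 2.
    rewrite [leLHS]dV ler_wpM2r ?invr_ge0 ?(ltW d20)//.
    by rewrite addrAC lerDr subr_ge0.
  by rewrite addrCA lerDl subr_ge0 ncdf_le.
- by rewrite lerBlDr (le_trans (ncdf_le1 _))// lerDl ncdf_ge0.
- by rewrite addr_ge0 ?ncdf_ge0// subr_ge0 ncdf_le1.
- rewrite subr_le0; apply: ncdf_le; rewrite [in leRHS]dV -mulNr.
  rewrite ler_wpM2r ?invr_ge0 ?(ltW d20)//.
  by rewrite addrAC gerDr subr_le0 ltW.
Qed.

End mollification.

Section distribution_limit.
Context d (Omega : measurableType d) (R : realType) (P : probability Omega R).
Variables (Y : nat -> Omega -> R) (s : R).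
Hypothesis s0 : 0 <= s.
Hypothesis mY : forall n, measurable_fun setT (Y n).
Hypothesis smooth : forall z e : R, 0 < e ->
  \int[P]_w heat0 z e (Y n w) @[n --> \oo] --> heat0 z (e + s ^+ 2) 0.

(** The mollification width is fixed first, from the target accuracy; [smooth] is then applied at
    the fixed variance [dl ^+ 4] and the two thresholds [z + dl] and [z - dl]. *)
Lemma cdf_cvg_gaussian (z : R) : s != 0 \/ z != 0 ->
  P [set w | Y n w <= z] @[n --> \oo] --> gaussian_cdf (s ^+ 2) z.
Proof.
move=> sz.
have squeeze (a b a' b' q phi t u eta : R) : `|a - a'| <= eta / 2 -> `|b - b'| <= eta / 2 ->
    a + t <= phi + eta / 2 -> phi - eta / 2 <= b - u -> q <= a' + t -> b' - u <= q ->
    `|phi - q| <= eta.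
  rewrite !ler_norml => /andP[? ?] /andP[? ?] ? ? ? ?.
  by apply/andP; split; lra.
have mA n : measurable [set w | Y n w <= z].
  rewrite (_ : [set w | _] = Y n @^-1` `]-oo, z]); last first.
    by apply/seteqP; split => w /=; rewrite in_itv/=.
  by rewrite -[X in measurable X]setTI; apply: mY.
pose p n : R := \int[P]_w \1_[set w | Y n w <= z] w.
have PE n : P [set w | Y n w <= z] = (p n)%:E.
  by rewrite /p prob_int_indic// fineK// fin_num_measure.
have gE : gaussian_cdf (s ^+ 2) z = (fine (gaussian_cdf (s ^+ 2) z))%:E.
  have [->|sn0] := eqVneq s 0; first by rewrite /gaussian_cdf expr0n/= eqxx.
  by rewrite gaussian_cdfE// lt_neqAle eq_sym sn0.
under eq_fun do rewrite PE.
rewrite gE; apply: cvg_EFin; first exact: nearW.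
set Phi := fine _.
apply/cvgrPdist_le => eta eta0.
have eta20 : 0 < eta / 2 by rewrite divr_gt0.
have [dl dl0 [up lo]] := gaussian_mollified s0 sz eta20.
have e0 : 0 < dl ^+ 4 by rewrite exprn_gt0.
have /cvgrPdist_le/(_ _ eta20) cup := @smooth (z + dl) _ e0.
have /cvgrPdist_le/(_ _ eta20) clo := @smooth (z - dl) _ e0.
apply: filterS2 cup clo => n h_up h_lo.
have bheat a : bounded_mfun (fun w => heat0 a (dl ^+ 4) (Y n w)).
  split; first by apply: measurableT_comp => //; exact: measurable_heat0.
  by exists 1 => w; rewrite ger0_norm ?ncdf_ge0// ncdf_le1.
have bA : bounded_mfun (\1_[set w | Y n w <= z] : Omega -> R) by exact: bounded_mfun_indic.
have bc (c : R) : bounded_mfun (fun _ : Omega => c) by exact: bounded_mfun_cst.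
have indE w : \1_[set w | Y n w <= z] w = (Y n w <= z)%R%:R :> R.
  rewrite indicE; congr (_%:R); congr nat_of_bool.
  by apply/idP/idP; rewrite inE.
have pup : p n <= \int[P]_w heat0 (z + dl) (dl ^+ 4) (Y n w) + (1 - ncdf dl^-1).
  rewrite -(prob_int_cst P (1 - ncdf dl^-1)) -prob_intD; [|exact: bounded_mfun_integrable..].
  apply: prob_int_le; [exact: bounded_mfun_integrable| |].
    by apply: bounded_mfun_integrable; exact: bounded_mfunD.
  by move=> w; rewrite indE; exact: (mollified_indicator_le _ _ dl0).1.
have plo : \int[P]_w heat0 (z - dl) (dl ^+ 4) (Y n w) - ncdf (- dl^-1) <= p n.
  rewrite -(prob_int_cst P (ncdf (- dl^-1))) -prob_intB; [|exact: bounded_mfun_integrable..].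
  apply: prob_int_le; [|exact: bounded_mfun_integrable|].
    by apply: bounded_mfun_integrable; exact: bounded_mfunB.
  by move=> w; rewrite indE; exact: (mollified_indicator_le _ _ dl0).2.
exact: squeeze h_up h_lo up lo pup plo.
Qed.

End distribution_limit.

Theorem corollary7 (R : realType) (X : pointedMetricType R)
    (d : measure_display) (Omega : measurableType d) (P : probability Omega R)
    (Pi : probability (borel X) R)
    (Pt : nat -> R.-pker (borel X) ~> (borel X))
    (X_ : nat -> {RV P >-> borel X})
    (hX : stationary_markov Pi Pt X_)
    (M : X -> R) (mM : measurable_fun [set: borel X] (M : borel X -> R))
    (M_ge1 : forall x : X, 1 <= M x)
    (rate : R -> R)
    (rate_range : forall u : R, 0 <= u -> 0 < rate u <= 1)
    (rate_decr : forall u v : R, 0 <= u -> u < v -> rate v < rate u)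
    (rate_lim : rate u @[u --> +oo] --> (0 : R))
    (hBL : forall (x : X) (t : nat),
       (BL_dist (Pt t x) Pi <= (M x * rate t%:R)%:E)%E)
    (M_int : (\int[Pi]_x (M x)%:E < +oo)%E)
    (p : R) (p_gt1 : 1 < p)
    (rate_int : (\int[lebesgue_measure]_(u in `[0%R, +oo[)
       (rate u `^ (2^-1 * (1 - p^-1)))%:E < +oo)%E)
    (f : X -> R) (f_lip : (lip_norm f < +oo)%E)
    (f_L2p : ('N[Pi]_((2 * p)%:E)[EFin \o f] < +oo)%E) :
  exists sigma2 : R,
    variance P (fun w => (Num.sqrt n%:R)^-1 * \sum_(s < n) f (X_ s w))
      @[n --> \oo] --> sigma2%:E /\
    (* For sigma2 = 0 the limit law is the unit mass at 0, and z = 0 is the one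
       discontinuity point of its distribution function. *)
    forall z : R, sigma2 != 0 \/ z != 0 ->
      P [set w | (Num.sqrt n%:R)^-1 *
                 \sum_(s < n) (f (X_ s w) - \int[Pi]_x f x) <= z]
        @[n --> \oo] --> gaussian_cdf sigma2 z.
Proof.
have p0 : 0 < p := lt_trans ltr01 p_gt1.
have [L L0 fL] := lip_norm_lip f_lip.
have mf := lip_measurable L0 fL.
have f_int : Pi.-integrable setT (EFin \o (fun x : borel X => `|f x| `^ (2 * p))).
  apply/integrableP; split.
    apply/measurable_EFinP; apply: (@measurableT_comp _ _ _ _ _ _ (@powR R ^~ (2 * p))) => //.
    exact: measurableT_comp.
  have p2 : 2 * p != 0 by rewrite mulf_neq0// gt_eqF.
  have := poweR_Lnorm Pi (EFin \o f : borel X -> \bar R) p2 => h.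
  apply: (le_lt_trans (y := ('N[Pi]_((2 * p)%:E)[EFin \o f] `^ (2 * p))%E)).
    rewrite h le_eqVlt; apply/orP; left; apply/eqP; apply: eq_integral => x _ /=.
    by rewrite ger0_norm ?powR_ge0.
  exact: poweR_lty.
have a0 : 0 <= 2^-1 * (1 - p^-1).
  by rewrite mulr_ge0 ?invr_ge0// subr_ge0 invf_le1// ltW.
have [S rhoS] : exists S : R, forall n, \sum_(t < n) rho rate p t <= S.
  (* The monotonicity of [rate] is assumed on [[0, +oo[] only; extending it by its value at 0 gives
     a function monotone on the whole line, as the integral test expects. *)
  pose r u := rate (Num.max 0 u) `^ (2^-1 * (1 - p^-1)).
  have r_ni : nonincreasing_fun r.
    move=> u v uv; rewrite /r.
    have mu0 (t : R) : 0 <= Num.max 0 t by rewrite le_max lexx.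
    have /andP[/ltW ru _] := rate_range _ (mu0 u); have /andP[/ltW rv _] := rate_range _ (mu0 v).
    rewrite ge0_ler_powR ?nnegrE//.
    have : Num.max 0 u <= Num.max 0 v by rewrite ge_max !le_max lexx uv !orbT.
    by rewrite le_eqVlt => /orP[/eqP ->//|lt_uv]; exact/ltW/rate_decr.
  have [||S hS] := nonincreasing_sum_le_integral r_ni.
  - by move=> u; exact: powR_ge0.
  - apply: le_lt_trans rate_int; rewrite le_eqVlt; apply/orP; left; apply/eqP.
    apply: eq_integral => u; rewrite inE/= in_itv/= andbT => u0.
    by rewrite /r (max_idPr u0).
  exists S => n; apply: le_trans (hS n); apply: ler_sum => t _.
  by rewrite /r /rho (max_idPr (ler0n R t)).
have dense : coboundary_dense Pi Pt.
  exact: (lip_coboundary_dense hX mM M_ge1 rate_range rate_lim hBL M_int).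
have sqf : sq_integrable Pi (f : borel X -> R).
  exact: (trunc_sq_integrable p_gt1 f_int L0 fL (fun x => lexx _)).
have approx := martingale_approximation hX mM M_ge1 rate_range hBL M_int p_gt1
  f_int L0 fL rhoS.
exists (limit_sd Pi X_ f ^+ 2); split.
  exact: (variance_cvg hX sqf approx).
move=> z; rewrite sqrf_eq0 => sz.
apply: (cdf_cvg_gaussian (Y := fun n w => (Num.sqrt n%:R)^-1 * centered_sum Pi X_ f n w)) => //.
- exact: (limit_sd_ge0 hX sqf approx).
- move=> n; apply: measurable_funM => //.
  have sqfc : sq_integrable Pi (fun x : borel X => f x - \int[Pi]_y f y).
    by apply: sq_integrableB => //; exact: sq_integrable_cst.
  exact: (sum_L2norm_le hX n sqfc).1.1.
- by move=> z' e e0; exact: (smooth_clt hX dense sqf approx).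
Qed.
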